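(* Let $g$ be a pseudo-Riemannian metric on an $n$-dimensional manifold $M$, let $L$ be a $(1,1)$-tensor field compatible with $g$, and suppose that at every point of a neighborhood of $p\in M$ the operator $L$ is conjugate to a single $n\times n$ Jordan block with a real eigenvalue $\lambda$ (a function of the point). Then near $p$ there exist a local coordinate system $x_1,\dots,x_n$ and a sign $\varepsilon\in\{+1,-1\}$ such that $\lambda$ depends only on $x_n$ and, in these coordinates, $$ g=\varepsilon\begin{pmatrix} & & & & a_{n-1}\\ & & & 1 & a_{n-2}\\ & & \cdot & & \vdots\\ & 1 & & & a_1\\ a_{n-1} & a_{n-2} & \dots & a_1 & \sum_{i=1}^{n-2}a_ia_{n-i-1} \end{pmatrix},\qquad L=\begin{pmatrix} \lambda(x_n) & 1 & & & a_1\\ & \lambda(x_n) & \ddots & & a_2\\ & & \ddots & 1 & \vdots\\ & & & \lambda(x_n) & a_{n-1}\\ & & & & \lambda(x_n) \end{pmatrix}, $$ where $a_i=i\,\lambda'_{x_n}\,x_i$ for $i=1,\dots,n-2$, $a_{n-1}=1+(n-1)\lambda'_{x_n}x_{n-1}$, and $\lambda'_{x_n}=\partial\lambda/\partial x_n$. That is: $\varepsilon g(\partial_{x_i},\partial_{x_j})=1$ if $i,j<n$ and $i+j=n+1$, and $=0$ for all other $i,j<n$; $\varepsilon g(\partial_{x_i},\partial_{x_n})=a_{n-i}$ for $i<n$; $\varepsilon g(\partial_{x_n},\partial_{x_n})=\sum_{i=1}^{n-2}a_ia_{n-i-1}$; and $L\partial_{x_1}=\lambda\partial_{x_1}$, $L\partial_{x_i}=\lambda\partial_{x_i}+\partial_{x_{i-1}}$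 for $1<i<n$, $L\partial_{x_n}=\lambda\partial_{x_n}+\sum_{k=1}^{n-1}a_k\partial_{x_k}$. Conversely, let $\lambda=\lambda(x_n)$ be an arbitrary smooth function with $\lambda(x_n)\neq0$ for all $x_n$, let $\varepsilon\in\{+1,-1\}$, and put $a_i=i\,\lambda'_{x_n}\,x_i$ for $i=1,\dots,n-2$ and $a_{n-1}=1+(n-1)\lambda'_{x_n}x_{n-1}$. Then the symmetric form $g$ and the $(1,1)$-tensor field $L$ given in the coordinates $x_1,\dots,x_n$ by $$ g=\varepsilon\begin{pmatrix} & & & & a_{n-1}\\ & & & 1 & a_{n-2}\\ & & \cdot & & \vdots\\ & 1 & & & a_1\\ a_{n-1} & a_{n-2} & \dots & a_1 & \sum_{i=1}^{n-2}a_ia_{n-i-1} \end{pmatrix},\qquad L=\begin{pmatrix} \lambda(x_n) & 1 & & & a_1\\ & \lambda(x_n) & \ddots & & a_2\\ & & \ddots & 1 & \vdots\\ & & & \lambda(x_n) & a_{n-1}\\ & & & & \lambda(x_n) \end{pmatrix} $$ are compatible in the domain where $g$ is nondegenerate, i.e. where $1+(n-1)\lambda'_{x_n}x_{n-1}\neq0$.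
   Context: All objects are smooth; metrics may have arbitrary signature. A $(1,1)$-tensor field $L$ (viewed as a field of endomorphisms of $TM$) is called compatible with $g$ (equivalently, $g$ and $L$ are compatible) if $L$ is $g$-selfadjoint, nondegenerate at every point, and satisfies, at every point and for every tangent vector $u$, $$\nabla_u L=\tfrac12\bigl(u\otimes d\,\mathrm{tr}\,L+(u\otimes d\,\mathrm{tr}\,L)^*\bigr),$$ where $\nabla$ is the Levi-Civita connection of $g$, $u\otimes\alpha$ denotes the operator $v\mapsto\alpha(v)u$, and $*$ denotes the $g$-adjoint ($g(Av,w)=g(v,A^*w)$). Unspecified entries of the matrices are $0$. The displayed entrywise description is for $n\ge2$; for $n=1$ the formulas read $g=\varepsilon\,dx_1^2$ and $L=\lambda(x_1)\cdot\mathrm{Id}$. *)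

(* Defs.v *)
From HB Require Import structures.
From mathcomp Require Import all_boot all_order all_algebra.
From mathcomp Require Import all_classical all_reals all_analysis.
Set Implicit Arguments.
Unset Strict Implicit.
Unset Printing Implicit Defensive.
Import Order.TTheory GRing.Theory Num.Theory.
Import numFieldNormedType.Exports.
Local Open Scope classical_set_scope.
Local Open Scope ring_scope.

(* Points of R^n are row vectors. Matrices of tensor components act on column
   vectors, so column [j] of the matrix of an operator [A] holds the components
   of [A (d/dx_j)], and a bilinear form [g] is [v, w |-> v^T *m g *m w]. *)

Section Calculus.
Variables (R : realType) (n : nat).
Implicit Types (U : set 'rV[R]_n) (x : 'rV[R]_n).

Definition pder (i : 'I_n) (f : 'rV[R]_n -> R) x : R := 'D_(delta_mx 0 i) f x.

Definition pders (s : seq 'I_n) (f : 'rV[R]_n -> R) : 'rV[R]_n -> R :=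
  foldr pder f s.

(* Infinite differentiability; only meant for open [U]. *)
Definition smooth_on U (f : 'rV[R]_n -> R) : Prop :=
  forall (s : seq 'I_n) x, U x -> differentiable (pders s f) x.

Definition smooth_mx_on U p q (A : 'rV[R]_n -> 'M[R]_(p, q)) : Prop :=
  forall i j, smooth_on U (fun x => A x i j).

Definition smooth1_on (J : set R) (f : R -> R) : Prop :=
  forall (k : nat) t, J t -> derivable (derive1n k f) t 1.

Definition pder_mx p q (i : 'I_n) (A : 'rV[R]_n -> 'M[R]_(p, q)) x :
    'M[R]_(p, q) :=
  \matrix_(a, b) pder i (fun y => A y a b) x.

(* Row index: component of [F]; column index: variable. *)
Definition Jmx (F : 'rV[R]_n -> 'rV[R]_n) x : 'M[R]_n :=
  \matrix_(a, b) pder b (fun y => F y 0 a) x.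

End Calculus.

Section Coordinates.
Variables (R : realType) (n : nat).
Implicit Types (g L : 'rV[R]_n -> 'M[R]_n) (x : 'rV[R]_n) (U : set 'rV[R]_n).

Definition pseudo_metric_on U g : Prop :=
  smooth_mx_on U g /\
  forall x, U x -> (g x)^T = g x /\ g x \in unitmx.

(* Levi-Civita connection: the entry (k, j) of [christoffel g x i] is
   Gamma^k_ij = 1/2 g^kl (d_i g_jl + d_j g_il - d_l g_ij). *)
Definition christoffel g x (i : 'I_n) : 'M[R]_n :=
  invmx (g x) *m
  \matrix_(l, j) (2%:R^-1 * (pder i (fun y => g y j l) x
                             + pder j (fun y => g y i l) x
                             - pder l (fun y => g y i j) x)).

(* (nabla_i L)^k_j = d_i L^k_j + Gamma^k_il L^l_j - L^k_l Gamma^l_ij. *)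
Definition cov_der g L x (u : 'cV[R]_n) : 'M[R]_n :=
  \sum_(i < n) u i 0 *: (pder_mx i L x + christoffel g x i *m L x
                         - L x *m christoffel g x i).

(* The unique A^* with g(A v, w) = g(v, A^* w), for [G] symmetric and
   invertible. *)
Definition gadjoint (G A : 'M[R]_n) : 'M[R]_n := invmx G *m A^T *m G.

Definition dtr L x : 'rV[R]_n := \row_j pder j (fun y => \tr (L y)) x.

Definition compatible_on U g L : Prop :=
  forall x, U x ->
  [/\ gadjoint (g x) (L x) = L x,
      L x \in unitmx
    & forall u : 'cV[R]_n,
        cov_der g L x u =
        2%:R^-1 *: (u *m dtr L x + gadjoint (g x) (u *m dtr L x))].

End Coordinates.

Section Manifold.
Variables (R : realType) (n : nat) (M : topologicalType).

(* [chart_map] and [chart_inv] are only relevant on [chart_dom] and on its image. *)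
Record chart := Chart {
  chart_dom : set M;
  chart_map : M -> 'rV[R]_n;
  chart_inv : 'rV[R]_n -> M }.

Definition chart_img (c : chart) : set 'rV[R]_n := chart_map c @` chart_dom c.

Definition is_chart (c : chart) : Prop :=
  [/\ open (chart_dom c), open (chart_img c),
      forall q, chart_dom c q -> chart_inv c (chart_map c q) = q,
      forall q, chart_dom c q -> {for q, continuous (chart_map c)}
    & forall x, chart_img c x -> {for x, continuous (chart_inv c)}].

Definition overlap (c c' : chart) : set 'rV[R]_n :=
  chart_map c @` (chart_dom c `&` chart_dom c').

Definition transition (c c' : chart) : 'rV[R]_n -> 'rV[R]_n :=
  chart_map c' \o chart_inv c.

Definition smoothly_compat (c c' : chart) : Prop :=
  smooth_mx_on (overlap c c') (transition c c') /\
  smooth_mx_on (overlap c' c) (transition c' c).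

(* The atlas is maximal, so its elements are all the local coordinate systems
   of the manifold. *)
Record smooth_manifold := SmoothManifold {
  atlas : set chart;
  manifold_hausdorff : hausdorff_space M;
  manifold_second_countable : @second_countable M;
  atlas_chart : forall c, atlas c -> is_chart c;
  atlas_cover : forall q, exists c, atlas c /\ chart_dom c q;
  atlas_compat : forall c c', atlas c -> atlas c' -> smoothly_compat c c';
  atlas_maximal : forall c, is_chart c ->
    (forall c', atlas c' -> smoothly_compat c c') -> atlas c }.

(* A tensor field of type (0,2) or (1,1) is the family of its matrices of
   components in all charts, as functions of the coordinates, subject to the
   transformation law of its type. *)
Definition tensor_components := chart -> 'rV[R]_n -> 'M[R]_n.

Variable S : smooth_manifold.

Definition is_tensor02 (g : tensor_components) : Prop :=
  (forall c, atlas S c -> smooth_mx_on (chart_img c) (g c)) /\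
  forall c c' x, atlas S c -> atlas S c' -> overlap c c' x ->
    let J := Jmx (transition c c') x in
    g c x = J^T *m g c' (transition c c' x) *m J.

Definition is_tensor11 (L : tensor_components) : Prop :=
  (forall c, atlas S c -> smooth_mx_on (chart_img c) (L c)) /\
  forall c c' x, atlas S c -> atlas S c' -> overlap c c' x ->
    let J := Jmx (transition c c') x in
    L c x = invmx J *m L c' (transition c c' x) *m J.

Definition pseudo_riemannian (g : tensor_components) : Prop :=
  is_tensor02 g /\ forall c, atlas S c -> pseudo_metric_on (chart_img c) (g c).

Definition compatible (g L : tensor_components) : Prop :=
  forall c, atlas S c -> compatible_on (chart_img c) (g c) (L c).

Definition jordan_block (lam : R) : 'M[R]_n :=
  \matrix_(i, j) if i == j then lam else (i.+1 == j :> nat)%:R.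

Definition single_jordan_at (L : tensor_components) (q : M) (lam : R) : Prop :=
  forall c, atlas S c -> chart_dom c q ->
  exists2 P : 'M[R]_n, P \in unitmx &
    L c (chart_map c q) = P *m jordan_block lam *m invmx P.

End Manifold.

(* The dimension is N = n.+1. The coordinate x_i (1 <= i <= N) is
   [x 0 (inord i.-1)]; x_N is [x 0 ord_max]. *)
Section NormalForm.
Variables (R : realType) (n : nat).
Implicit Types (lam : R -> R) (x : 'rV[R]_n.+1).

Definition xc x (i : nat) : R := x 0 (inord i.-1).

(* a_i for 1 <= i <= N-1 = n *)
Definition acoef lam x (i : nat) : R :=
  (i == n)%:R + i%:R * derive1 lam (xc x n.+1) * xc x i.

(* In the two matrices I and J are the indices counted from 1. *)
Definition nf_metric (eps : R) lam x : 'M[R]_n.+1 :=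
  eps *: \matrix_(i, j)
    let N := n.+1 in let I := i.+1 in let J := j.+1 in
    if N == 1%N then 1
    else if (I < N)%N && (J < N)%N then (I + J == N.+1)%N%:R
    else if (I < N)%N then acoef lam x (N - I)
    else if (J < N)%N then acoef lam x (N - J)
    else \sum_(1 <= k < N.-1) acoef lam x k * acoef lam x (N - k - 1).

Definition nf_endo lam x : 'M[R]_n.+1 :=
  \matrix_(i, j)
    let N := n.+1 in let I := i.+1 in let J := j.+1 in
    if I == J then lam (xc x N)
    else if J == N then acoef lam x I
    else (I.+1 == J)%:R.

End NormalForm.

(* Main.v *)
Require Import Defs.
From HB Require Import structures.
From mathcomp Require Import all_boot all_order all_algebra.
From mathcomp Require Import all_classical all_reals all_analysis.
From mathcomp Require Import ring lra zify.
Set Implicit Arguments.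
Unset Strict Implicit.
Unset Printing Implicit Defensive.
Import Order.TTheory GRing.Theory Num.Theory.
Import numFieldNormedType.Exports.
Local Open Scope classical_set_scope.
Local Open Scope ring_scope.

(** Write [N = n.+1], let [lam] be the eigenvalue and [X = L - lam] the
    nilpotent part of [L], and count indices from [0] to [n].

    As [X] is [g]-selfadjoint with a single Jordan block, there is a vector
    field [xi], unique up to sign, with [g (X^k xi, xi) = 0] for [k < n] and
    [eps = +1] or [-1] for [k = n]. The frame [X^n xi, .., X xi, xi] turns [L]
    into its Jordan block and [g] into [eps] times the antidiagonal matrix
    ([exists_adapted_coframe]). Let [theta^0, .., theta^n] be the dual coframe.

    In this frame compatibility can be solved for the connection. The trace of
    the compatibility equation against [X] says that [d lam] kills the image of
    [X], that is, [d lam = mu theta^n]. Then the equation prescribes the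
    commutator of the connection matrix with [X]; as that matrix is skew for the
    antidiagonal form, and no nonzero skew matrix commutes with [X]
    ([skew_comm_shift]), the connection matrix is [mu] times an explicit one
    ([block_connection]). Therefore compatibility is equivalent, given
    [d lam = mu theta^n], to the vanishing of the torsion of this explicit
    connection, which is the structure equation
    [d theta^k = k theta^(k-1) /\ d lam] ([compatible_structure] and
    [structure_compatible]).

    The structure equation is integrated one row after the other: once
    [x_(k-1)] is known, the form [theta^k - k x_(k-1) d lam] is closed, and the
    Poincare lemma yields [x_k] with [theta^k = d x_k + k x_(k-1) d lam]. With
    all [x_k] vanishing at [p], their differentials agree there with the
    coframe, so they are coordinates by the inverse function theorem. In these
    coordinates [d lam] is proportional to [d x_n], so [lam] is a function of
    [x_n] alone, and the matrix of the coframe becomes [nf_coframe]. Expanding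
    [g] and [L] in terms of it gives precisely the matrices of the statement
    ([nf_metricE] and [nf_endoE]).

    Conversely the forms [d x_k + k x_(k-1) d lam] satisfy the structure
    equation for any function [lam] ([potential_coframe_structure]), and for
    [lam = lam (x_n)] the differential [d lam] is a multiple of the last of
    them; hence the normal form is compatible wherever they are independent.

    The analysis needed is developed for row vectors with the sup norm:
    stability of infinite differentiability, symmetry of second derivatives,
    the local Poincare lemma and the inverse function theorem. *)

(** * Infinitely differentiable functions of several variables *)

Section Pder.
Variables (R : realType) (n : nat).
Implicit Types (U : set 'rV[R]_n) (f g : 'rV[R]_n -> R) (x v : 'rV[R]_n).

Lemma derivable_pder f x (i : 'I_n) :
  differentiable f x -> derivable f x (delta_mx 0 i).
Proof. exact: diff_derivable. Qed.

Lemma diff_pderE f x v : differentiable f x ->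
  'd f x v = \sum_j v 0 j * pder j f x.
Proof.
move=> df; rewrite {1}(row_sum_delta v) linear_sum /=.
by apply: eq_bigr => j _; rewrite linearZ /pder deriveE.
Qed.

Lemma derive_pderE f x v : differentiable f x ->
  'D_v f x = \sum_j v 0 j * pder j f x.
Proof. by move=> df; rewrite deriveE // diff_pderE. Qed.

Lemma pderD f g x i : differentiable f x -> differentiable g x ->
  pder i (fun y => f y + g y) x = pder i f x + pder i g x.
Proof. by move=> df dg; rewrite /pder deriveD //; exact: derivable_pder. Qed.

Lemma pderN f x i : differentiable f x ->
  pder i (fun y => - f y) x = - pder i f x.
Proof. by move=> df; rewrite /pder deriveN //; exact: derivable_pder. Qed.

Lemma pderM f g x i : differentiable f x -> differentiable g x ->
  pder i (fun y => f y * g y) x = f x * pder i g x + pder i f x * g x.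
Proof.
move=> df dg; rewrite /pder deriveM; try exact: derivable_pder.
by rewrite /GRing.scale /= [g x * _]mulrC.
Qed.

Lemma pderV f x i : differentiable f x -> f x != 0 ->
  pder i (fun y => (f y)^-1) x = - pder i f x * ((f x)^-1 * (f x)^-1).
Proof.
move=> df fx; rewrite /pder deriveV //; last exact: derivable_pder.
by rewrite /GRing.scale /= -expr2 -exprVn mulNr mulrC mulNr.
Qed.

Lemma pder_cst (a : R) x (i : 'I_n) : pder i (fun=> a) x = 0.
Proof. exact: derive_cst. Qed.

Lemma pder_sum (I : finType) (F : I -> 'rV[R]_n -> R) x i :
  (forall j, differentiable (F j) x) ->
  pder i (fun y => \sum_j F j y) x = \sum_j pder i (F j) x.
Proof.
move=> dF.
suff H r : differentiable (fun y => \sum_(j <- r) F j y) x /\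
    pder i (fun y => \sum_(j <- r) F j y) x = \sum_(j <- r) pder i (F j) x.
  by have [] := H (index_enum I).
elim: r => [|j r [dr pr]].
  rewrite big_nil (_ : (fun y => _) = fun=> 0); last first.
    by apply/funext => y; rewrite big_nil.
  by split; [exact: differentiable_cst|rewrite pder_cst].
rewrite big_cons (_ : (fun y => _) = fun y => F j y + \sum_(k <- r) F k y).
  by split; [exact: differentiableD|rewrite pderD // pr].
by apply/funext => y; rewrite big_cons.
Qed.

Lemma pder_coord x (i j : 'I_n) :
  pder i (fun y : 'rV[R]_n => y 0 j) x = (i == j)%:R.
Proof.
rewrite /pder deriveE; last exact: differentiable_coord.
have -> : 'd (fun y : 'rV[R]_n => y 0 j : R) x =
          (fun y : 'rV[R]_n => y 0 j) :> (_ -> R).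
  have lin : linear (fun y : 'rV[R]_n => y 0 j : R^o).
    by move=> a u v; rewrite !mxE.
  pose HL := GRing.isLinear.Build _ _ _ _ _ lin.
  pose L : {linear 'rV[R]_n -> R^o} := HB.pack (fun y : 'rV[R]_n => y 0 j : R^o) HL.
  have := @diff_lin R _ _ L x.
  by apply; exact: coord_continuous.
by rewrite mxE eqxx /= eq_sym.
Qed.

End Pder.

Section EpsilonDifferentiability.
Variables (R : realType) (V W : normedModType R).

Lemma differentiable_eps (f : V -> W) (df : {linear V -> W}) x :
  continuous df ->
  (forall e, 0 < e ->
     \forall h \near 0, `|f (h + x) - f x - df h| <= e * `|h|) ->
  differentiable f x /\ 'd f x = df :> (V -> W).
Proof.
move=> dfc H.
have E : f \o shift x = cst (f x) + df +o_ 0 id.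
  apply/eqaddoP => e e0; near=> h.
  rewrite [X in `|X|](_ : _ = f (h + x) - f x - df h); last by rewrite !fctE opprD addrA.
  by near: h; exact: H.
have D := diff_unique dfc E; split=> //.
by apply/diff_locallyP; rewrite D.
Unshelve. all: by end_near. Qed.

Lemma differentiable_eps_ex (f : V -> W) x : differentiable f x ->
  forall e, 0 < e ->
    \forall h \near 0, `|f (h + x) - f x - 'd f x h| <= e * `|h|.
Proof.
move=> /diff_locallyP [dc /eqaddoP E] e e0; have := E e e0.
by apply: filterS => h; rewrite /= !fctE opprD addrA.
Qed.

Lemma near_eq_differentiable (f g : V -> W) x :
  (\near x, f x = g x) -> differentiable f x -> differentiable g x.
Proof.
move=> fg df; apply: (differentiable_eps (df := 'd f x) _ _).1.
  exact: diff_continuous.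
move=> e e0; have := differentiable_eps_ex df e0.
apply: filterS2; last first.
  by move: fg; rewrite (near_shift 0) /=; exact.
by move=> h /=; rewrite subr0 (nbhs_singleton fg) => ->.
Unshelve. all: by end_near. Qed.

End EpsilonDifferentiability.

Lemma open_nearW (T : topologicalType) (U : set T) (P : T -> Prop) x :
  open U -> U x -> (forall y, U y -> P y) -> \near x, P x.
Proof. by move=> oU Ux H; apply: filterS H _; exact: open_nbhs_nbhs. Qed.

Section Ck.
Variables (R : realType) (n : nat).
Implicit Types (U V : set 'rV[R]_n) (f g : 'rV[R]_n -> R).

(** Differentiability of order [k.+1], by recursion on the order: unlike
    [smooth_on], it supports inductions in which the derivative of a function
    is expressed through the function itself. *)
Fixpoint Ck (k : nat) U f : Prop :=
  (forall x, U x -> differentiable f x) /\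
  if k is k'.+1 then forall i, Ck k' U (pder i f) else True.

Lemma Ck_diff k U f x : Ck k U f -> U x -> differentiable f x.
Proof. by case: k => [|k] [df _]; exact: df. Qed.

Lemma Ck_pder k U f i : Ck k.+1 U f -> Ck k U (pder i f).
Proof. by move=> [_ pf]; exact: pf. Qed.

Lemma Ck_le k U f : Ck k.+1 U f -> Ck k U f.
Proof.
elim: k f => [|k IHk] f [df pf]; first by split.
by split=> // i; exact: IHk.
Qed.

Lemma smooth_onP U f : smooth_on U f <-> forall k, Ck k U f.
Proof.
split=> [sf k|Cf s].
  elim: k f sf => [|k IHk] f sf; first by split=> //; exact: (sf [::]).
  split=> [|i]; first exact: (sf [::]).
  apply: IHk => s.
  by have := sf (rcons s i); rewrite /pders foldr_rcons.
elim/last_ind: s f Cf => [|s i IHs] f Cf x Ux; first exact: (Ck_diff (Cf 0%N)).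
by rewrite /pders foldr_rcons; apply: IHs => // k; exact: (Ck_pder _ (Cf k.+1)).
Qed.

Lemma Ck_sub k U V f : V `<=` U -> Ck k U f -> Ck k V f.
Proof.
move=> VU; elim: k f => [|k IHk] f [df pf]; split.
- by move=> x /VU; exact: df.
- by [].
- by move=> x /VU; exact: df.
- by move=> i; exact: IHk (pf i).
Qed.

Lemma pder_ext U f g i x : open U -> {in U, f =1 g} -> U x ->
  pder i f x = pder i g x.
Proof.
move=> oU fg Ux; apply: near_eq_derive; apply: open_nearW oU Ux _ => y Uy.
by apply: fg; exact/mem_set.
Qed.

Lemma Ck_ext k U f g : open U -> {in U, f =1 g} -> Ck k U f -> Ck k U g.
Proof.
move=> oU; elim: k f g => [|k IHk] f g fg [df pf]; split=> //.
- move=> x Ux; apply: near_eq_differentiable (df _ Ux).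
  by apply: open_nearW oU Ux _ => y /mem_set; exact: fg.
- move=> x Ux; apply: near_eq_differentiable (df _ Ux).
  by apply: open_nearW oU Ux _ => y /mem_set; exact: fg.
- move=> i; apply: IHk (pf i) => x /set_mem Ux; exact: pder_ext Ux.
Qed.

Lemma Ck_cst k U (a : R) : Ck k U (fun=> a).
Proof.
elim: k a => [|k IHk] a; split=> //.
move=> i; rewrite (_ : pder i _ = fun=> 0); first exact: IHk.
by apply/funext => x; rewrite pder_cst.
Qed.

Lemma Ck_coord k U j : Ck k U (fun x : 'rV[R]_n => x 0 j).
Proof.
case: k => [|k]; split=> //; try by move=> x _; exact: differentiable_coord.
move=> i; rewrite (_ : pder i _ = fun=> (i == j)%:R); first exact: Ck_cst.
by apply/funext => x; rewrite pder_coord.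
Qed.

Lemma Ck_add k U f g : open U ->
  Ck k U f -> Ck k U g -> Ck k U (fun x => f x + g x).
Proof.
move=> oU; elim: k f g => [|k IHk] f g [df pf] [dg pg]; split=> //;
  try by move=> x Ux; apply: differentiableD; [exact: df|exact: dg].
move=> i; apply: Ck_ext oU _ (IHk _ _ (pf i) (pg i)) => x /set_mem Ux.
by rewrite pderD //; [exact: df|exact: dg].
Qed.

Lemma Ck_opp k U f : open U -> Ck k U f -> Ck k U (fun x => - f x).
Proof.
move=> oU; elim: k f => [|k IHk] f [df pf]; split=> //;
  try by move=> x Ux; apply: differentiableN; exact: df.
move=> i; apply: Ck_ext oU _ (IHk _ (pf i)) => x /set_mem Ux.
by rewrite pderN //; exact: df.
Qed.

Lemma Ck_mul k U f g : open U ->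
  Ck k U f -> Ck k U g -> Ck k U (fun x => f x * g x).
Proof.
move=> oU; elim: k f g => [|k IHk] f g Cf Cg;
  (split; first by move=> x Ux; apply: differentiableM;
    [exact: (Ck_diff Cf)|exact: (Ck_diff Cg)]) => //.
move=> i.
have Cp := Ck_add oU (IHk _ _ (Ck_le Cf) (Ck_pder i Cg))
                     (IHk _ _ (Ck_pder i Cf) (Ck_le Cg)).
apply: Ck_ext oU _ Cp => x /set_mem Ux.
by rewrite pderM //; [exact: (Ck_diff Cf)|exact: (Ck_diff Cg)].
Qed.

Lemma Ck_inv k U f : open U -> (forall x, U x -> f x != 0) ->
  Ck k U f -> Ck k U (fun x => (f x)^-1).
Proof.
move=> oU f0; elim: k f f0 => [|k IHk] f f0 Cf;
  (split; first by move=> x Ux; apply: differentiableV;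
    [exact: (Ck_diff Cf)|exact: f0]) => //.
move=> i; have CV := IHk _ f0 (Ck_le Cf).
have Cp := Ck_mul oU (Ck_opp oU (Ck_pder i Cf)) (Ck_mul oU CV CV).
apply: Ck_ext oU _ Cp => x /set_mem Ux.
by rewrite pderV //; [exact: (Ck_diff Cf)|exact: f0].
Qed.

Lemma Ck_sum k U (I : Type) (r : seq I) (P : pred I) (F : I -> 'rV[R]_n -> R) :
  open U -> (forall j, P j -> Ck k U (F j)) ->
  Ck k U (fun x => \sum_(j <- r | P j) F j x).
Proof.
move=> oU CF; elim: r => [|j r IHr].
  apply: Ck_ext oU _ (Ck_cst k U 0) => x _; by rewrite big_nil.
case Pj: (P j).
  by apply: Ck_ext oU _ (Ck_add oU (CF j Pj) IHr) => x _; rewrite big_cons Pj.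
by apply: Ck_ext oU _ IHr => x _; rewrite big_cons Pj.
Qed.

Lemma Ck_prod k U (I : Type) (r : seq I) (P : pred I) (F : I -> 'rV[R]_n -> R) :
  open U -> (forall j, P j -> Ck k U (F j)) ->
  Ck k U (fun x => \prod_(j <- r | P j) F j x).
Proof.
move=> oU CF; elim: r => [|j r IHr].
  apply: Ck_ext oU _ (Ck_cst k U 1) => x _; by rewrite big_nil.
case Pj: (P j).
  by apply: Ck_ext oU _ (Ck_mul oU (CF j Pj) IHr) => x _; rewrite big_cons Pj.
by apply: Ck_ext oU _ IHr => x _; rewrite big_cons Pj.
Qed.

End Ck.

Section Composition.
Variables (R : realType).

Lemma differentiable_row m n (F : 'rV[R]_m -> 'rV[R]_n) x :
  (forall j, differentiable (fun y => F y 0 j) x) -> differentiable F x.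
Proof.
move=> dF.
rewrite (_ : F = \sum_(j < n) (fun y => F y 0 j *: delta_mx 0 j)).
  by apply: differentiable_sum => j; exact: differentiableZl.
by apply/funext => y; rewrite {1}(row_sum_delta (F y)) fct_sumE.
Qed.

Lemma differentiable_compr m n (F : 'rV[R]_m -> 'rV[R]_n) (f : 'rV[R]_n -> R) x :
  (forall j, differentiable (fun y => F y 0 j) x) ->
  differentiable f (F x) -> differentiable (fun y => f (F y)) x.
Proof. by move=> dF df; apply: differentiable_comp => //; exact: differentiable_row. Qed.

Lemma pder_comp m n (F : 'rV[R]_m -> 'rV[R]_n) (f : 'rV[R]_n -> R) x i :
  (forall j, differentiable (fun y => F y 0 j) x) ->
  differentiable f (F x) ->
  pder i (fun y => f (F y)) x =
  \sum_j pder i (fun y => F y 0 j) x * pder j f (F x).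
Proof.
move=> dF df; have DF := differentiable_row dF.
rewrite {1}/pder deriveE; last exact: differentiable_comp.
rewrite (diff_comp DF df) /= diff_pderE //; apply: eq_bigr => j _.
congr (_ * _); rewrite -deriveE // derive_mx ?mxE //.
exact: diff_derivable.
Qed.

Lemma Ck_comp m n k (U : set 'rV[R]_m) (V : set 'rV[R]_n)
    (F : 'rV[R]_m -> 'rV[R]_n) (f : 'rV[R]_n -> R) :
  open U -> (forall x, U x -> V (F x)) ->
  (forall j, Ck k U (fun y => F y 0 j)) -> Ck k V f ->
  Ck k U (fun y => f (F y)).
Proof.
move=> oU UV; elim: k f => [|k IHk] f CF Cf; (split; first by
  move=> x Ux; apply: differentiable_compr => [j|];
  [exact: (Ck_diff (CF j))|apply: (Ck_diff Cf); exact: UV]) => // i.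
have Cp : Ck k U (fun x => \sum_j pder i (fun y => F y 0 j) x * pder j f (F x)).
  apply: Ck_sum => // j _; apply: Ck_mul => //.
    exact: (Ck_pder i (CF j)).
  by apply: IHk; [move=> l; exact: Ck_le|exact: Ck_pder].
apply: Ck_ext oU _ Cp => x /set_mem Ux; rewrite pder_comp // => [j|].
  exact: (Ck_diff (CF j)).
by apply: (Ck_diff Cf); exact: UV.
Qed.

End Composition.

Section SmoothMatrices.
Variables (R : realType) (n : nat) (U : set 'rV[R]_n).
Hypothesis oU : open U.

Lemma smooth_diff f x : smooth_on U f -> U x -> differentiable f x.
Proof. by move=> sf; exact: (sf [::]). Qed.

Lemma smooth_pder f i : smooth_on U f -> smooth_on U (pder i f).
Proof. by move=> /smooth_onP Cf; apply/smooth_onP => k; exact: Ck_pder. Qed.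

Lemma smooth_ext f g : {in U, f =1 g} -> smooth_on U f -> smooth_on U g.
Proof. by move=> fg /smooth_onP Cf; apply/smooth_onP => k; exact: Ck_ext fg _. Qed.

Lemma smooth_cst (a : R) : smooth_on U (fun=> a).
Proof. by apply/smooth_onP => k; exact: Ck_cst. Qed.

Lemma smooth_coord i : smooth_on U (fun x : 'rV[R]_n => x 0 i).
Proof. by apply/smooth_onP => k; exact: Ck_coord. Qed.

Lemma smooth_add f g :
  smooth_on U f -> smooth_on U g -> smooth_on U (fun x => f x + g x).
Proof.
by move=> /smooth_onP Cf /smooth_onP Cg; apply/smooth_onP => k; exact: Ck_add.
Qed.

Lemma smooth_opp f : smooth_on U f -> smooth_on U (fun x => - f x).
Proof. by move=> /smooth_onP Cf; apply/smooth_onP => k; exact: Ck_opp. Qed.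

Lemma smooth_mul f g :
  smooth_on U f -> smooth_on U g -> smooth_on U (fun x => f x * g x).
Proof.
by move=> /smooth_onP Cf /smooth_onP Cg; apply/smooth_onP => k; exact: Ck_mul.
Qed.

Lemma smooth_inv f : (forall x, U x -> f x != 0) ->
  smooth_on U f -> smooth_on U (fun x => (f x)^-1).
Proof. by move=> f0 /smooth_onP Cf; apply/smooth_onP => k; exact: Ck_inv. Qed.

Lemma smooth_sum (I : Type) (r : seq I) (P : pred I) (F : I -> 'rV[R]_n -> R) :
  (forall j, P j -> smooth_on U (F j)) ->
  smooth_on U (fun x => \sum_(j <- r | P j) F j x).
Proof.
move=> sF; apply/smooth_onP => k; apply: Ck_sum => // j Pj.
by have /smooth_onP := sF j Pj.
Qed.

Lemma smooth_prod (I : Type) (r : seq I) (P : pred I) (F : I -> 'rV[R]_n -> R) :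
  (forall j, P j -> smooth_on U (F j)) ->
  smooth_on U (fun x => \prod_(j <- r | P j) F j x).
Proof.
move=> sF; apply/smooth_onP => k; apply: Ck_prod => // j Pj.
by have /smooth_onP := sF j Pj.
Qed.

Lemma smooth_mx_ext p q (A B : 'rV[R]_n -> 'M[R]_(p, q)) :
  {in U, A =1 B} -> smooth_mx_on U A -> smooth_mx_on U B.
Proof. by move=> AB sA i j; apply: smooth_ext (sA i j) => x Ux; rewrite AB. Qed.

Lemma smooth_mxM p q r (A : 'rV[R]_n -> 'M[R]_(p, q)) (B : 'rV[R]_n -> 'M[R]_(q, r)) :
  smooth_mx_on U A -> smooth_mx_on U B -> smooth_mx_on U (fun x => A x *m B x).
Proof.
move=> sA sB i j.
apply: (@smooth_ext (fun x => \sum_k A x i k * B x k j)) => [x _|].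
  by rewrite mxE.
by apply: smooth_sum => k _; exact: smooth_mul.
Qed.

Lemma smooth_mxD p q (A B : 'rV[R]_n -> 'M[R]_(p, q)) :
  smooth_mx_on U A -> smooth_mx_on U B -> smooth_mx_on U (fun x => A x + B x).
Proof.
move=> sA sB i j; apply: smooth_ext (smooth_add (sA i j) (sB i j)) => x _.
by rewrite mxE.
Qed.

Lemma smooth_mxZ p q (f : 'rV[R]_n -> R) (A : 'rV[R]_n -> 'M[R]_(p, q)) :
  smooth_on U f -> smooth_mx_on U A -> smooth_mx_on U (fun x => f x *: A x).
Proof.
by move=> sf sA i j; apply: smooth_ext (smooth_mul sf (sA i j)) => x _; rewrite mxE.
Qed.

Lemma smooth_mx_cst p q (A : 'M[R]_(p, q)) : smooth_mx_on U (fun=> A).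
Proof. by move=> i j; exact: smooth_cst. Qed.

Lemma smooth_mxT p q (A : 'rV[R]_n -> 'M[R]_(p, q)) :
  smooth_mx_on U A -> smooth_mx_on U (fun x => (A x)^T).
Proof. by move=> sA i j; apply: smooth_ext (sA j i) => x _; rewrite mxE. Qed.

Lemma smooth_det p (A : 'rV[R]_n -> 'M[R]_p) :
  smooth_mx_on U A -> smooth_on U (fun x => \det (A x)).
Proof.
move=> sA; apply: smooth_sum => s _; apply: smooth_mul; first exact: smooth_cst.
by apply: smooth_prod => i _; exact: sA.
Qed.

Lemma smooth_trace p (A : 'rV[R]_n -> 'M[R]_p) :
  smooth_mx_on U A -> smooth_on U (fun x => \tr (A x)).
Proof. by move=> sA; apply: smooth_sum => i _; exact: sA. Qed.

Lemma smooth_invmx p (A : 'rV[R]_n -> 'M[R]_p) :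
  (forall x, U x -> A x \in unitmx) ->
  smooth_mx_on U A -> smooth_mx_on U (fun x => invmx (A x)).
Proof.
move=> uA sA i j.
have sc : smooth_on U (fun x => (\det (A x))^-1 * cofactor (A x) j i).
  apply: smooth_mul.
    apply: smooth_inv (smooth_det sA) => x /uA.
    by rewrite unitmxE unitfE.
  apply: smooth_mul; first exact: smooth_cst.
  apply: smooth_det => a b.
  by apply: smooth_ext (sA (lift j a) (lift i b)) => x _; rewrite !mxE.
apply: smooth_ext sc => x /set_mem Ux.
by rewrite /invmx uA // !mxE.
Qed.

End SmoothMatrices.

Lemma smooth_sub (R : realType) n (U V : set 'rV[R]_n) f :
  V `<=` U -> smooth_on U f -> smooth_on V f.
Proof. by move=> VU sf s x /VU; exact: sf. Qed.

Lemma smooth_mx_sub (R : realType) n (U V : set 'rV[R]_n) p q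
    (A : 'rV[R]_n -> 'M[R]_(p, q)) :
  V `<=` U -> smooth_mx_on U A -> smooth_mx_on V A.
Proof. by move=> VU sA i j; exact: smooth_sub (sA i j). Qed.

Lemma smooth_comp (R : realType) m n (U : set 'rV[R]_m) (V : set 'rV[R]_n)
    (F : 'rV[R]_m -> 'rV[R]_n) (f : 'rV[R]_n -> R) :
  open U -> (forall x, U x -> V (F x)) ->
  smooth_mx_on U F -> smooth_on V f -> smooth_on U (fun y => f (F y)).
Proof.
move=> oU UV sF /smooth_onP Cf; apply/smooth_onP => k.
apply: Ck_comp UV _ (Cf k) => // j.
by have /smooth_onP := sF 0 j.
Qed.

(** * Mean value estimates and the symmetry of second derivatives *)

Section RowNorm.
Variables (R : realType) (n : nat).
Implicit Types (x v h : 'rV[R]_n) (C e : R).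

Lemma normr_coord v j : `|v 0 j| <= `|v|.
Proof.
rewrite [leRHS]/Num.Def.normr /= mx_normrE.
exact: (le_bigmax _ (fun ij => `|v ij.1 ij.2|) (0, j)).
Qed.

Lemma normr_row_le v e : 0 <= e -> (forall j, `|v 0 j| <= e) -> `|v| <= e.
Proof.
move=> e0 ve; rewrite [leLHS]/Num.Def.normr /= mx_normrE.
by apply: bigmax_le => // -[i j] _; rewrite /= ord1.
Qed.

Lemma normr_delta (j : 'I_n) : `|delta_mx 0 j : 'rV[R]_n| <= 1.
Proof.
apply: normr_row_le => // i; rewrite mxE.
by case: (_ && _); rewrite ?normr1 ?normr0.
Qed.

Lemma mem_ball_rv x r h : ball x r (x + h) <-> `|h| < r.
Proof. by rewrite -ball_normE /= opprD addrA subrr add0r normrN. Qed.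

Lemma mem_ballP x r y : ball x r y <-> `|y - x| < r.
Proof. by rewrite -ball_normE /= distrC. Qed.

Lemma sum_coord_le v (a : 'I_n -> R) (C : R) : (forall j, `|a j| <= C) ->
  `|\sum_j v 0 j * a j| <= n%:R * C * `|v|.
Proof.
move=> aC; apply: le_trans (ler_norm_sum _ _ _) _.
have -> : n%:R * C * `|v| = \sum_(j < n) `|v| * C.
  by rewrite sumr_const card_ord -mulr_natl; ring.
by apply: ler_sum => j _; rewrite normrM ler_pM ?normr_coord.
Qed.

Lemma sum_delta (k : 'I_n) (F : 'I_n -> R) :
  \sum_l (delta_mx 0 k : 'rV[R]_n) 0 l * F l = F k.
Proof.
rewrite (bigD1 k) //= big1 ?addr0; first by rewrite mxE !eqxx mul1r.
by move=> l lk; rewrite mxE (negPf lk) andbF mul0r.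
Qed.

Lemma sum_scale_delta (k : 'I_n) (c : R) (F : 'I_n -> R) :
  \sum_l (c *: delta_mx 0 k : 'rV[R]_n) 0 l * F l = c * F k.
Proof.
rewrite -[in RHS](sum_delta k F) mulr_sumr; apply: eq_bigr => l _.
by rewrite mxE mulrA.
Qed.

End RowNorm.

Lemma normr_mulmx_le (R : realType) n p (v : 'rV[R]_n) (B : 'M[R]_(n, p)) :
  `|v *m B| <= `|v| * \sum_i \sum_j `|B i j|.
Proof.
have S0 (i : 'I_n) : 0 <= \sum_j `|B i j| by apply: sumr_ge0.
apply: normr_row_le => [|j]; first by rewrite mulr_ge0 // sumr_ge0.
rewrite mxE; apply: le_trans (ler_norm_sum _ _ _) _.
rewrite mulr_sumr; apply: ler_sum => i _; rewrite normrM ler_pM ?normr_coord //.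
by rewrite (bigD1 j) //= lerDl sumr_ge0.
Qed.

Section MeanValue.
Variables (R : realType) (n : nat).
Implicit Types (f : 'rV[R]_n -> R) (x v h : 'rV[R]_n).

Lemma is_derive_line f x v (t : R) : differentiable f (x + t *: v) ->
  is_derive t 1 (fun s => f (x + s *: v)) (\sum_j v 0 j * pder j f (x + t *: v)).
Proof.
move=> df; rewrite -derive_pderE //.
have H : derivable f (x + t *: v) v by exact: diff_derivable.
suff E : (fun h : R => h^-1 *: (f (x + (h *: 1 + t) *: v) - f (x + t *: v))) =
    (fun h : R => h^-1 *: (f (h *: v + (x + t *: v)) - f (x + t *: v))).
  by apply: DeriveDef; [rewrite /derivable /= E|rewrite /derive /= E].
apply/funext => h; congr (_ *: (f _ - _)).
by rewrite scalerDl [_%:A]mulr1 addrCA.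
Qed.

Lemma mean_value f x v :
  (forall t : R, 0 <= t <= 1 -> differentiable f (x + t *: v)) ->
  exists2 t : R, 0 < t < 1 & f (x + v) - f x = \sum_j v 0 j * pder j f (x + t *: v).
Proof.
move=> df.
have D (t : R) : t \in `]0, 1[%R ->
    is_derive t 1 (fun s => f (x + s *: v)) (\sum_j v 0 j * pder j f (x + t *: v)).
  rewrite in_itv /= => /andP[t0 t1]; apply: is_derive_line; apply: df.
  by rewrite !ltW.
have [|t] := MVT ltr01 D.
  apply: derivable_within_continuous => t; rewrite in_itv /= => t01.
  by have [] := is_derive_line (df _ t01).
rewrite in_itv /= scale1r scale0r addr0 subr0 mulr1 => t01 E.
by exists t.
Qed.

Lemma segment_ball x v (r t : R) : `|v| < r -> 0 <= t <= 1 -> ball x r (x + t *: v).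
Proof.
move=> vr /andP[t0 t1]; apply/mem_ball_rv; rewrite normrZ ger0_norm //.
by apply: le_lt_trans vr; rewrite ler_piMl.
Qed.

Lemma segment_ball2 (x0 x v : 'rV[R]_n) (r t : R) :
  ball x0 r x -> ball x0 r (x + v) -> 0 <= t <= 1 -> ball x0 r (x + t *: v).
Proof.
rewrite !mem_ballP => xr xvr /andP[t0 t1].
have -> : x + t *: v - x0 = (1 - t) *: (x - x0) + t *: (x + v - x0).
  by apply/rowP => j; rewrite !mxE; ring.
have [->|tN0] := eqVneq t 0; first by rewrite subr0 scale1r scale0r addr0.
apply: le_lt_trans (ler_normD _ _) _; rewrite !normrZ.
rewrite (ger0_norm t0) ger0_norm ?subr_ge0 //.
have tp : 0 < t by rewrite lt_neqAle eq_sym tN0.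
have := ltr_pM2l tp `|x + v - x0| r; rewrite xvr => H2.
have H1 : (1 - t) * `|x - x0| <= (1 - t) * r by rewrite ler_wpM2l ?subr_ge0 // ltW.
lra.
Qed.

(** Balls are convex, so the mean value theorem applies to any two points of one. *)
Lemma lipschitz_ball f (x0 x v : 'rV[R]_n) (r C : R) :
  (forall y, ball x0 r y -> differentiable f y) ->
  (forall y j, ball x0 r y -> `|pder j f y| <= C) ->
  ball x0 r x -> ball x0 r (x + v) -> `|f (x + v) - f x| <= n%:R * C * `|v|.
Proof.
move=> df bf xr xvr.
have [t t01|t /andP[t0 t1] ->] := @mean_value f x v.
  by apply: df; exact: segment_ball2.
apply: sum_coord_le => j; apply: bf; apply: segment_ball2 => //.
by rewrite !ltW.
Qed.

Lemma differentiable_grad f x (a : 'I_n -> R) :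
  (forall e : R, 0 < e -> \forall h \near (0 : 'rV[R]_n),
     `|f (h + x) - f x - \sum_j h 0 j * a j| <= e * `|h|) ->
  differentiable f x /\ forall i, pder i f x = a i.
Proof.
move=> H.
pose G (h : 'rV[R]_n) : R := \sum_j h 0 j * a j.
have Gt (x1 : 'rV[R]_n) j : differentiable (fun h : 'rV[R]_n => h 0 j * a j) x1.
  by apply: differentiableM; [exact: differentiable_coord|exact: differentiable_cst].
have dG x1 : differentiable G x1.
  rewrite (_ : G = \sum_(j < n) (fun h : 'rV[R]_n => h 0 j * a j)).
    exact: differentiable_sum.
  by apply/funext => h; rewrite fct_sumE.
have pG i x1 : pder i G x1 = a i.
  rewrite /G pder_sum //.
  rewrite (bigD1 i) //= big1 ?addr0 => [|j ji].
    rewrite pderM ?pder_cst ?pder_coord; last 2 first.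
    - exact: differentiable_coord.
    - exact: differentiable_cst.
    by rewrite eqxx mulr0 mul1r add0r.
  rewrite pderM ?pder_cst ?pder_coord; last 2 first.
  - exact: differentiable_coord.
  - exact: differentiable_cst.
  by rewrite eq_sym (negPf ji) mulr0 mul0r add0r.
have EG h : 'd G 0 h = \sum_j h 0 j * a j.
  by rewrite diff_pderE //; apply: eq_bigr => j _; rewrite pG.
have [|e e0|df Edf] := @differentiable_eps R 'rV[R]_n R f ('d G 0) x.
- exact: diff_continuous.
- by have := H e e0; apply: filterS => h; rewrite EG.
split; first exact: df.
move=> i; rewrite /pder (deriveE _ df).
transitivity ('d G 0 (delta_mx 0 i)).
  exact: (congr1 (fun F : 'rV[R]_n -> R => F (delta_mx 0 i)) Edf).
by rewrite EG sum_delta.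
Qed.

Lemma differentiable_grad_ex f x : differentiable f x ->
  forall e : R, 0 < e -> \forall h \near (0 : 'rV[R]_n),
     `|f (h + x) - f x - \sum_j h 0 j * pder j f x| <= e * `|h|.
Proof.
move=> df e e0; have := differentiable_eps_ex df e0.
by apply: filterS => h; rewrite diff_pderE.
Qed.

End MeanValue.

Section Schwarz.
Variables (R : realType) (n : nat).
Implicit Types (U : set 'rV[R]_n) (f : 'rV[R]_n -> R).

Lemma shift_diff f x (a : 'rV[R]_n) :
  differentiable f (x + a) -> differentiable (fun y => f (y + a)) x /\
  forall i, pder i (fun y => f (y + a)) x = pder i f (x + a).
Proof.
move=> df; apply: differentiable_grad => e e0.
have := differentiable_grad_ex df e0; apply: filterS => h.
by rewrite addrA.
Qed.

(** The mean value theorem is applied first along [j], then along [i]. *)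
Lemma second_difference f x (r h : R) i j : 0 < h -> h + h < r ->
  (forall y, ball x r y -> differentiable f y) ->
  (forall y, ball x r y -> differentiable (pder j f) y) ->
  exists2 y, ball x r y &
    f (x + h *: delta_mx 0 j + h *: delta_mx 0 i) - f (x + h *: delta_mx 0 j)
    - f (x + h *: delta_mx 0 i) + f x = h * h * pder i (pder j f) y.
Proof.
move=> h0 hr df ddf; set ei := delta_mx 0 i; set ej := delta_mx 0 j.
have inb (s t : R) : 0 <= s <= 1 -> 0 <= t <= 1 ->
    ball x r (x + t *: (h *: ej) + s *: (h *: ei)).
  move=> /andP[s0 s1] /andP[t0 t1]; rewrite -addrA; apply/mem_ball_rv.
  apply: le_lt_trans (ler_normD _ _) _; rewrite !normrZ.
  rewrite (ger0_norm s0) (ger0_norm t0) (gtr0_norm h0).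
  apply: le_lt_trans hr; apply: lerD.
    apply: (le_trans (ler_piMl _ t1)); first by rewrite mulr_ge0 // ltW.
    by rewrite ler_piMr ?normr_delta // ltW.
  apply: (le_trans (ler_piMl _ s1)); first by rewrite mulr_ge0 // ltW.
  by rewrite ler_piMr ?normr_delta // ltW.
pose g y := f (y + h *: ei) - f y.
have D (t : R) : 0 <= t <= 1 -> differentiable g (x + t *: (h *: ej)) /\
    pder j g (x + t *: (h *: ej)) =
    pder j f (x + t *: (h *: ej) + h *: ei) - pder j f (x + t *: (h *: ej)).
  move=> t01.
  have d1 : differentiable f (x + t *: (h *: ej) + h *: ei).
    by apply: df; have := inb 1 t; rewrite scale1r; apply => //; rewrite ler01 lexx.
  have d2 : differentiable f (x + t *: (h *: ej)).
    by apply: df; have := inb 0 t; rewrite scale0r addr0; apply => //; rewrite lexx ler01.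
  have [d3 p3] := shift_diff d1.
  split; first by apply: differentiableB.
  by rewrite /g pderD ?pderN ?p3 //; apply: differentiableN.
have [t /D[]//|t t01 E1] := @mean_value R n g x (h *: ej).
have t01' : 0 <= t <= 1 by case/andP: t01 => t0 t1; rewrite !ltW.
have [s s01|s s01 E2] := @mean_value R n (pder j f) (x + t *: (h *: ej)) (h *: ei).
  by apply: ddf; exact: inb.
exists (x + t *: (h *: ej) + s *: (h *: ei)).
  by apply: inb => //; case/andP: s01 => s0 s1; rewrite !ltW.
move: E1; rewrite sum_scale_delta (D t t01').2 E2 sum_scale_delta mulrA => <-.
by rewrite /g opprB addrA addrAC.
Qed.

(** Schwarz's theorem: at nearby points, both second derivatives take the value
    of one and the same second difference quotient. *)
Lemma pder_swap U f x i j : open U -> smooth_on U f -> U x ->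
  pder i (pder j f) x = pder j (pder i f) x.
Proof.
move=> oU sf Ux.
apply/eqP; rewrite -subr_eq0 -normr_eq0 eq_le normr_ge0 andbT.
suff key (e : R) : 0 < e ->
    `|pder i (pder j f) x - pder j (pder i f) x| <= e.
  by apply/ler_addgt0Pr => e e0; rewrite add0r; exact: key.
move=> e0.
have e2 : 0 < e / 2 by rewrite divr_gt0.
have cA : {for x, continuous (pder i (pder j f))}.
  by apply: differentiable_continuous; apply: (sf [:: i; j]).
have cB : {for x, continuous (pder j (pder i f))}.
  by apply: differentiable_continuous; apply: (sf [:: j; i]).
have nA : \forall y \near x, `|pder i (pder j f) x - pder i (pder j f) y| < e / 2.
  by move/cvgrPdist_lt : cA; apply.
have nB : \forall y \near x, `|pder j (pder i f) x - pder j (pder i f) y| < e / 2.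
  by move/cvgrPdist_lt : cB; apply.
have nU : \forall y \near x, U y by exact: open_nbhs_nbhs.
have /nbhs_ballP[r r0 Hr] : nbhs x [set y | [/\ U y,
    `|pder i (pder j f) x - pder i (pder j f) y| < e / 2 &
    `|pder j (pder i f) x - pder j (pder i f) y| < e / 2]].
  by apply: filterS3 nU nA nB => y Uy Ay By; split.
have r4 : 0 < r / 4 by rewrite divr_gt0.
have hr : r / 4 + r / 4 < r by lra.
have [||y1 b1 E1] := @second_difference f x r (r / 4) i j r4 hr.
- by move=> y /Hr [Uy _ _]; exact: (sf [::]).
- by move=> y /Hr [Uy _ _]; exact: (sf [:: j]).
have [||y2 b2 E2] := @second_difference f x r (r / 4) j i r4 hr.
- by move=> y /Hr [Uy _ _]; exact: (sf [::]).
- by move=> y /Hr [Uy _ _]; exact: (sf [:: i]).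
have E : pder i (pder j f) y1 = pder j (pder i f) y2.
  have k0 : r / 4 * (r / 4) != 0 by rewrite mulf_neq0 // gt_eqF.
  apply: (mulfI k0); move: E1 E2.
  rewrite (addrAC x ((r / 4) *: delta_mx 0 j) ((r / 4) *: delta_mx 0 i)).
  move=> E1 E2; apply: etrans (esym E1) (etrans _ E2).
  by rewrite [X in X + _]addrAC.
have [_ A1 _] := Hr _ b1; have [_ _ B2] := Hr _ b2.
move: A1 B2; rewrite E.
set A := pder i _ _; set B := pder j _ _; set C := pder j _ _ => A1 B2.
have -> : A - C = (A - B) - (C - B) by ring.
apply: le_trans (ler_normB _ _) _.
by rewrite (splitr e); apply: lerD; [exact: ltW A1|exact: ltW B2].
Unshelve. all: by end_near. Qed.

End Schwarz.

(** * The local Poincare lemma for one-forms *)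

Section Poincare.
Variables (R : realType).

Lemma exists_primitive (p : R -> R) (a b : R) : a < b ->
  (forall t, a <= t <= b -> {for t, continuous p}) ->
  exists P : R -> R, forall t, a < t < b -> is_derive t 1 P (p t).
Proof.
move=> ab cp.
have pi : lebesgue_measure.-integrable `[a, b] (EFin \o p).
  apply: continuous_compact_integrable; first exact: segment_compact.
  by apply: continuous_in_subspaceT => t; rewrite inE /= in_itv => /cp.
exists (fun x => \int[lebesgue_measure]_(t in `[a, x]) p t)%R => t /andP[a_t tb].
have [|dP EP] := continuous_FTC1_closed tb pi a_t.
  by apply: cp; rewrite !ltW.
by apply: DeriveDef; [exact: dP|rewrite -derive1E; exact: EP].
Qed.

Lemma near_bounded n (I : finType) (h : I -> 'rV[R]_n -> R) (x : 'rV[R]_n) :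
  (forall i, {for x, continuous (h i)}) ->
  exists2 K : R, 0 < K & \forall y \near x, forall i, `|h i y| <= K.
Proof.
move=> ch; exists (1 + \sum_i (`|h i x| + 1)).
  by rewrite ltr_wpDr // sumr_ge0 // => i _; rewrite addr_ge0.
set K := 1 + _.
apply: (@filter_forall _ _ (fun i y => `|h i y| <= K) (nbhs x) (nbhs_filter x)).
move=> i; rewrite /K.
have H : \forall y \near x, `|h i x - h i y| < 1.
  by move/cvgrPdist_lt : (ch i); apply.
apply: filterS H => y hy.
have -> : h i y = h i x - (h i x - h i y) by ring.
apply: le_trans (ler_normB _ _) _; rewrite (bigD1 i) //= addrA.
have H0 : 0 <= \sum_(j | j != i) (`|h j x| + 1).
  by apply: sumr_ge0 => j _; rewrite addr_ge0.
lra.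
Qed.

Variable n : nat.
Implicit Types (w : 'I_n -> 'rV[R]_n -> R) (x h d : 'rV[R]_n).

(** This estimates the derivative in [t] of
    [P_(x + h) t - P_x t - t * \sum_i h_i w_i(x0 + t d)], where [P_x] is a
    primitive of [t |-> \sum_i d_i w_i(x0 + t d)] and [d = x - x0]: closedness
    cancels all the terms that are linear in [h]. *)
Lemma closed_form_remainder w x0 (r K : R) d h (t : R) : 0 <= K ->
  (forall y i, ball x0 r y -> differentiable (w i) y) ->
  (forall y i j, ball x0 r y -> differentiable (pder j (w i)) y) ->
  (forall y i j, ball x0 r y -> `|pder j (w i) y| <= K) ->
  (forall y i j k, ball x0 r y -> `|pder k (pder j (w i)) y| <= K) ->
  (forall y i j, ball x0 r y -> pder i (w j) y = pder j (w i) y) ->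
  `|d| < r -> `|d + h| < r -> 0 <= t <= 1 ->
  `|\sum_i (d + h) 0 i * w i (x0 + t *: (d + h))
    - \sum_i d 0 i * w i (x0 + t *: d)
    - (\sum_i h 0 i * w i (x0 + t *: d)
       + t * \sum_i h 0 i * \sum_j d 0 j * pder j (w i) (x0 + t *: d))|
  <= (n%:R * n%:R * K * (1 + n%:R * r)) * `|h| ^+ 2.
Proof.
move=> K0 dw ddw bw bbw cl dr dhr t01; have /andP[t0 t1] := t01.
set y := x0 + t *: d; have -> : x0 + t *: (d + h) = y + t *: h.
  by rewrite scalerDr addrA.
have yr : ball x0 r y by exact: segment_ball.
have yhr : ball x0 r (y + t *: h).
  by rewrite /y -addrA -scalerDr; exact: segment_ball.
have th : `|t *: h| <= `|h| by rewrite normrZ ger0_norm // ler_piMl.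
have A i : `|w i (y + t *: h) - w i y| <= n%:R * K * `|h|.
  apply: le_trans (lipschitz_ball (C := K) _ _ yr yhr) _.
  - by move=> z; exact: dw.
  - by move=> z j; exact: bw.
  - by rewrite ler_wpM2l // mulr_ge0.
have B j : `|w j (y + t *: h) - w j y - t * \sum_i h 0 i * pder i (w j) y|
    <= n%:R * n%:R * K * `|h| ^+ 2.
  have [s s01|s s01 ->] := @mean_value R n (w j) y (t *: h).
    by apply: dw; exact: segment_ball2.
  have -> : \sum_k (t *: h) 0 k * pder k (w j) (y + s *: (t *: h))
      - t * \sum_i h 0 i * pder i (w j) y =
      \sum_k h 0 k * (t * (pder k (w j) (y + s *: (t *: h)) - pder k (w j) y)).
    rewrite mulr_sumr -sumrB; apply: eq_bigr => k _; rewrite mxE; ring.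
  have -> : n%:R * n%:R * K * `|h| ^+ 2 = n%:R * (n%:R * K * `|h|) * `|h| by ring.
  apply: sum_coord_le => k; rewrite normrM ger0_norm //.
  apply: le_trans (ler_piMl _ t1) _; first exact: normr_ge0.
  have s01' : 0 <= s <= 1 by case/andP: s01 => *; rewrite !ltW.
  apply: le_trans (lipschitz_ball (x0 := x0) (r := r) (C := K) _ _ yr _) _.
  - by move=> z; exact: ddw.
  - by move=> z l; exact: bbw.
  - exact: segment_ball2.
  - rewrite ler_wpM2l // ?mulr_ge0 //; apply: le_trans th.
    by case/andP: s01' => s0 s1; rewrite normrZ ger0_norm // ler_piMl.
have -> : \sum_i (d + h) 0 i * w i (y + t *: h) - \sum_i d 0 i * w i y
    - (\sum_i h 0 i * w i y
       + t * \sum_i h 0 i * \sum_j d 0 j * pder j (w i) y)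
  = \sum_i h 0 i * (w i (y + t *: h) - w i y)
    + \sum_j d 0 j * (w j (y + t *: h) - w j y - t * \sum_i h 0 i * pder i (w j) y).
  have -> : \sum_i h 0 i * \sum_j d 0 j * pder j (w i) y =
      \sum_j d 0 j * \sum_i h 0 i * pder i (w j) y.
    under eq_bigr do rewrite mulr_sumr.
    rewrite exchange_big /=; apply: eq_bigr => j _; rewrite mulr_sumr.
    by apply: eq_bigr => i _; rewrite cl // mulrCA.
  rewrite mulr_sumr opprD addrA -!sumrB -big_split /=.
  apply: eq_bigr => i _; rewrite mxE; ring.
apply: le_trans (ler_normD _ _) _.
have B1 := sum_coord_le h A; have B2 := sum_coord_le d B.
apply: le_trans (lerD B1 B2) _.
have r0 : `|d| <= r by exact: ltW.
have -> : n%:R * n%:R * K * (1 + n%:R * r) * `|h| ^+ 2 =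
  n%:R * (n%:R * K * `|h|) * `|h| + n%:R * (n%:R * n%:R * K * `|h| ^+ 2) * r by ring.
by rewrite lerD2l ler_wpM2l // !mulr_ge0 // exprn_ge0.
Qed.

(** A closed one-form has a potential near any point. The potential is the
    integral along rays from [x0]; that its gradient is [w] follows from the
    bound on [closed_form_remainder] by the mean value theorem, without
    differentiating under the integral sign. *)
Lemma poincare (U : set 'rV[R]_n) w x0 : open U -> U x0 ->
  (forall i, smooth_on U (w i)) ->
  (forall x i j, U x -> pder i (w j) x = pder j (w i) x) ->
  exists r : R, exists F : 'rV[R]_n -> R,
    [/\ 0 < r, ball x0 r `<=` U, F x0 = 0, smooth_on (ball x0 r) F &
        forall x i, ball x0 r x -> pder i F x = w i x].
Proof.
move=> oU Ux0 sw cl.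
have [K1 K10 nK1] : exists2 K : R, 0 < K &
    \forall y \near x0, forall ij : 'I_n * 'I_n, `|pder ij.2 (w ij.1) y| <= K.
  apply: near_bounded => ij; apply: differentiable_continuous.
  exact: (sw ij.1 [:: ij.2]).
have [K2 K20 nK2] : exists2 K : R, 0 < K & \forall y \near x0,
    forall ij : 'I_n * 'I_n * 'I_n, `|pder ij.2 (pder ij.1.2 (w ij.1.1)) y| <= K.
  apply: near_bounded => ij; apply: differentiable_continuous.
  exact: (sw ij.1.1 [:: ij.2; ij.1.2]).
have /nbhs_ballP[r3 /= r30 Hr] : nbhs x0 [set y | [/\ U y,
    forall ij : 'I_n * 'I_n, `|pder ij.2 (w ij.1) y| <= K1 &
    forall ij : 'I_n * 'I_n * 'I_n, `|pder ij.2 (pder ij.1.2 (w ij.1.1)) y| <= K2]].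
  by apply: filterS3 (open_nbhs_nbhs (conj oU Ux0)) nK1 nK2 => y Uy Ay By; split.
pose r : R := r3 / 3.
have r0 : 0 < r by rewrite /r divr_gt0.
have rr3 : 3 * r = r3 by rewrite /r; field.
pose K : R := K1 + K2.
have K0 : 0 <= K by rewrite /K addr_ge0 // ltW.
have rU3 y : ball x0 r3 y -> U y by move=> /Hr[].
have rr y : ball x0 r y -> ball x0 r3 y.
  by apply: le_ball; rewrite -rr3; lra.
have rU y : ball x0 r y -> U y by move/rr/rU3.
have inb d (t : R) : `|d| < r -> -1 <= t <= 2 -> ball x0 r3 (x0 + t *: d).
  move=> dr /andP[t1 t2]; apply/mem_ball_rv; rewrite normrZ.
  have t3 : `|t| <= 2 by rewrite ler_norml t2 andbT; lra.
  have := ler_wpM2r (normr_ge0 d) t3; lra.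
pose p d (t : R) := \sum_i d 0 i * w i (x0 + t *: d).
have dp d (t : R) : `|d| < r -> -1 <= t <= 2 ->
    is_derive t 1 (p d) (\sum_i d 0 i * \sum_j d 0 j * pder j (w i) (x0 + t *: d)).
  move=> dr t12.
  rewrite (_ : p d = \sum_(i < n) (fun t : R => d 0 i * w i (x0 + t *: d))); last first.
    by apply/funext => s; rewrite /p fct_sumE.
  apply: is_derive_sum => i.
  have H : is_derive t 1 (fun s : R => w i (x0 + s *: d))
      (\sum_j d 0 j * pder j (w i) (x0 + t *: d)).
    by apply: is_derive_line; apply: (sw i [::]); apply: rU3; exact: inb.
  exact: is_deriveZ.
have prim d : exists P : R -> R,
    `|d| < r -> forall t : R, -1 < t < 2 -> is_derive t 1 P (p d t).
  have [dr|_] := boolP (`|d| < r); last by exists (fun=> 0).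
  have [||P HP] := @exists_primitive (p d) (-1) 2; first lra.
    move=> t t12; apply: differentiable_continuous.
    by apply/derivable1_diffP; have [] := dp d t dr t12.
  by exists P.
have [P HP] := choice prim.
pose F x := P (x - x0) 1 - P (x - x0) 0.
have GF x : ball x0 r x -> differentiable F x /\ forall i, pder i F x = w i x.
  move=> xr; apply: differentiable_grad => e e0.
  pose d := x - x0.
  have dr : `|d| < r by apply/mem_ballP.
  pose C : R := n%:R * n%:R * K * (1 + n%:R * r).
  have C0 : 0 <= C.
    by rewrite /C !mulr_ge0 // addr_ge0 // mulr_ge0 // ltW.
  have n1 : \forall h \near (0 : 'rV[R]_n), `|h| < r - `|d|.
    have := @nbhs0_lt R 'rV[R]_n (r - `|d|); apply; lra.
  have n2 : \forall h \near (0 : 'rV[R]_n), `|h| < e / (C + 1).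
    apply: (@nbhs0_lt R 'rV[R]_n); rewrite divr_gt0 //; lra.
  apply: filterS2 n1 n2 => h h1 h2.
  have dhr : `|d + h| < r by apply: le_lt_trans (ler_normD _ _) _; lra.
  pose Phi (t : R) := P (d + h) t - P d t - t * \sum_i h 0 i * w i (x0 + t *: d).
  pose q (t : R) := \sum_i h 0 i * w i (x0 + t *: d).
  pose dPhi (t : R) := p (d + h) t - p d t
    - (q t + t * \sum_i h 0 i * \sum_j d 0 j * pder j (w i) (x0 + t *: d)).
  have DPhi (t : R) : -1 < t < 2 -> is_derive t 1 Phi (dPhi t).
    move=> t12; have t12' : -1 <= t <= 2 by case/andP: t12 => *; rewrite !ltW.
    have D1 := HP _ dhr t t12; have D2 := HP _ dr t t12.
    have Dq : is_derive t 1 q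
        (\sum_i h 0 i * \sum_j d 0 j * pder j (w i) (x0 + t *: d)).
      rewrite (_ : q = \sum_(i < n) (fun t : R => h 0 i * w i (x0 + t *: d))); last first.
        by apply/funext => s; rewrite /q fct_sumE.
      apply: is_derive_sum => i.
      have H : is_derive t 1 (fun s : R => w i (x0 + s *: d))
          (\sum_j d 0 j * pder j (w i) (x0 + t *: d)).
        by apply: is_derive_line; apply: (sw i [::]); apply: rU3; exact: inb.
      exact: is_deriveZ.
    have Dtq := is_deriveM (is_derive_id t 1) Dq.
    rewrite (_ : Phi = P (d + h) - P d - id * q) //.
    apply: (is_derive_eq (is_deriveB (is_deriveB D1 D2) Dtq)).
    rewrite /dPhi /GRing.scale /= mulr1; congr (_ - _); exact: addrC.
  have [||c] := @MVT R Phi dPhi 0 1 ltr01.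
  - move=> t; rewrite in_itv /= => /andP[t0 t1]; apply: DPhi; lra.
  - apply: derivable_within_continuous => t; rewrite in_itv /= => /andP[t0 t1].
    by have [|] := DPhi t; first lra.
  rewrite in_itv /= subr0 mulr1 => /andP[c0 c1] E.
  have EF : F (h + x) - F x - \sum_j h 0 j * w j x = dPhi c.
    rewrite -E /Phi /F mul1r mul0r subr0 scale1r.
    have -> : h + x - x0 = d + h by rewrite /d -addrA addrC.
    have -> : x0 + d = x by rewrite /d addrC subrK.
    by rewrite -/d; ring.
  rewrite EF.
  have rem : `|dPhi c| <= C * `|h| ^+ 2.
    apply: (@closed_form_remainder w x0 r K d h c) => //.
    - by move=> y i /rU Uy; exact: (sw i [::]).
    - by move=> y i j /rU Uy; exact: (sw i [:: j]).
    - move=> y i j /rr /Hr[_ /(_ (i, j)) /= A _]; rewrite /K; lra.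
    - move=> y i j k /rr /Hr[_ _ /(_ (i, j, k)) /= A]; rewrite /K; lra.
    - by move=> y i j /rU; exact: cl.
    - by rewrite !ltW.
  apply: le_trans rem _.
  rewrite expr2 mulrA ler_wpM2r //.
  have : (C + 1) * `|h| < e by rewrite mulrC -ltr_pdivlMr //; lra.
  have := normr_ge0 h; lra.
have d0 : `|0 : 'rV[R]_n| < r by rewrite normr0.
have F0 : F x0 = 0.
  rewrite /F subrr; have [||c _ ->] := @MVT R (P 0) (p 0) 0 1 ltr01.
  - move=> t; rewrite in_itv /= => /andP[t0 t1]; apply: HP => //; lra.
  - apply: derivable_within_continuous => t; rewrite in_itv /= => /andP[t0 t1].
    by have [|] := HP 0 d0 t; first lra.
  by rewrite /p big1 ?mul0r // => i _; rewrite mxE mul0r.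
exists r, F; split=> //.
  have F1 x : ball x0 r x -> differentiable F x by move=> /GF[].
  have ob : open (ball x0 r) by exact: ball_open.
  apply/smooth_onP => -[|k]; split => // i.
  apply: (@Ck_ext _ _ _ _ (w i)) => //.
    by move=> x /set_mem /GF[_ ->].
  by apply: Ck_sub rU _; have /smooth_onP := sw i.
by move=> x i /GF[_ ->].
Qed.

End Poincare.

(** * The inverse function theorem *)

(** This turns row vectors into complete normed modules, as Banach's fixed point
    theorem requires. *)
HB.instance Definition _ (R : realType) (n : nat) :=
  Uniform_isComplete.Build 'rV[R]_n (@cauchy_cvg _).

Section InverseFunction.
Variables (R : realType) (n : nat).
Implicit Types (x y : 'rV[R]_n) (U V : set 'rV[R]_n) (F G : 'rV[R]_n -> 'rV[R]_n).

Lemma smooth_Jmx U F : open U -> smooth_mx_on U F -> smooth_mx_on U (Jmx F).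
Proof.
move=> oU sF i j; apply: (smooth_ext oU _ (smooth_pder j (sF 0 i))) => x _.
by rewrite mxE.
Qed.

Lemma smooth_row_cont U F x : smooth_mx_on U F -> U x -> {for x, continuous F}.
Proof.
move=> sF Ux; apply: differentiable_continuous; apply: differentiable_row => j.
exact: (sF 0 j [::]).
Qed.

(** Composing with the inverse of the derivative at [x0] makes the derivative
    close to the identity near [x0]; as points are rows, matrices act on the
    right, which explains the transpose in [B]. *)
Lemma near_identity U F (x0 : 'rV[R]_n) (B := invmx (Jmx F x0)^T) :
  open U -> U x0 -> smooth_mx_on U F -> Jmx F x0 \in unitmx ->
  exists2 r : R, 0 < r & [/\ ball x0 r `<=` U,
    forall x, ball x0 r x -> Jmx F x \in unitmx &
    forall x y, ball x0 r x -> ball x0 r y ->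
      `|(y - F y *m B) - (x - F x *m B)| <= 2^-1 * `|y - x|].
Proof.
move=> oU Ux0 sF uJ.
pose H (a : 'I_n) (x : 'rV[R]_n) : R := x 0 a - (F x *m B) 0 a.
have sH a : smooth_on U (H a).
  apply: (smooth_add oU (smooth_coord _)); apply: smooth_opp => //.
  exact: (smooth_mxM oU sF (smooth_mx_cst _)).
have pH a b (x : 'rV[R]_n) : U x -> pder b (H a) x = (1%:M - (Jmx F x)^T *m B) b a.
  move=> Ux.
  have d2 : differentiable (fun x : 'rV[R]_n => \sum_c F x 0 c * B c a) x.
    rewrite (_ : (fun x => _) = \sum_(c < n) (fun x : 'rV[R]_n => F x 0 c * B c a)).
      apply: differentiable_sum => c; apply: differentiableM.
        exact: (sF 0 c [::]).
      exact: differentiable_cst.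
    by apply/funext => y; rewrite fct_sumE.
  rewrite (_ : H a = fun x : 'rV[R]_n => x 0 a + - \sum_c F x 0 c * B c a); last first.
    by apply/funext => y; rewrite /H mxE.
  rewrite pderD ?pderN //; last 2 first.
  - exact: differentiable_coord.
  - exact: differentiableN.
  rewrite pder_coord pder_sum => [|c].
    rewrite !mxE; congr (_ - _); apply: eq_bigr => c _; rewrite !mxE pderM.
    - by rewrite pder_cst mulr0 add0r.
    - exact: (sF 0 c [::]).
    - exact: differentiable_cst.
  apply: differentiableM; first exact: (sF 0 c [::]).
  exact: differentiable_cst.
have pH0 a b : pder b (H a) x0 = 0.
  by rewrite pH // /B mulmxV ?unitmx_tr // subrr mxE.
pose C : R := (2 * (n%:R + 1))^-1.
have n1 : 0 < n%:R + 1 :> R by rewrite ltr_wpDl.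
have C0 : 0 < C by rewrite /C invr_gt0 mulr_gt0.
have nC : n%:R * C <= 2^-1.
  rewrite /C invfM mulrCA ler_piMr ?invr_ge0 // ler_pdivrMr // mul1r; lra.
have n2 : \forall y \near x0, forall ab : 'I_n * 'I_n, `|pder ab.2 (H ab.1) y| <= C.
  apply: (@filter_forall _ _ (fun ab y => `|pder ab.2 (H ab.1) y| <= C)
    (nbhs x0) (nbhs_filter x0)) => ab.
  have cp : {for x0, continuous (pder ab.2 (H ab.1))}.
    by apply: differentiable_continuous; exact: (sH ab.1 [:: ab.2]).
  have near_p : \forall y \near x0,
      `|pder ab.2 (H ab.1) x0 - pder ab.2 (H ab.1) y| < C.
    by move/cvgrPdist_lt : cp; apply.
  by apply: filterS near_p => y; rewrite pH0 sub0r normrN; exact: ltW.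
have n3 : \forall y \near x0, \det (Jmx F y) != 0.
  have cd : {for x0, continuous (fun y => \det (Jmx F y))}.
    apply: differentiable_continuous; apply: (smooth_diff _ Ux0).
    exact: smooth_det (smooth_Jmx oU sF).
  have d0 : 0 < `|\det (Jmx F x0)|.
    by rewrite normr_gt0 -unitfE -unitmxE.
  have near_d : \forall y \near x0,
      `|\det (Jmx F x0) - \det (Jmx F y)| < `|\det (Jmx F x0)|.
    by move/cvgrPdist_lt : cd; apply.
  apply: filterS near_d => y; apply: contraTneq => ->.
  by rewrite subr0 ltxx.
have /nbhs_ballP[r /= r0 Hr] : nbhs x0 [set y | [/\ U y,
    forall ab : 'I_n * 'I_n, `|pder ab.2 (H ab.1) y| <= C & \det (Jmx F y) != 0]].
  by apply: filterS3 (open_nbhs_nbhs (conj oU Ux0)) n2 n3 => y ? ? ?; split.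
exists r => //; split.
- by move=> y /Hr[].
- by move=> y /Hr[_ _]; rewrite unitmxE unitfE.
move=> x y xr yr; apply: normr_row_le; first by rewrite mulr_ge0.
move=> a; have -> : (y - F y *m B - (x - F x *m B)) 0 a = H a y - H a x.
  by rewrite /H !mxE.
have Ey : y = x + (y - x) by rewrite addrC subrK.
apply: le_trans (_ : _ <= n%:R * C * `|y - x|) _; last by rewrite ler_wpM2r.
rewrite {1}Ey; apply: (@lipschitz_ball R n (H a) x0 x (y - x) r C).
- by move=> z /Hr[Uz _ _]; exact: (sH a [::]).
- by move=> z j /Hr[_ /(_ (a, j))].
- by [].
- by rewrite -Ey.
Qed.

(** The preimage of [y] is the fixed point of the contraction
    [x |-> x - F x B + y B]. The derivative of the inverse [G] at [y] is
    [invmx (Jmx F (G y))]: it involves only [G] itself, so that the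
    differentiability of [G] improves order by order. *)
Lemma inverse_function U F x0 :
  open U -> U x0 -> smooth_mx_on U F -> Jmx F x0 \in unitmx ->
  exists V (r : R) G,
    [/\ open V, V x0, V `<=` U, 0 < r &
     [/\ forall x, V x -> ball (F x0) r (F x) /\ G (F x) = x,
         forall y, ball (F x0) r y -> V (G y) /\ F (G y) = y &
         smooth_mx_on (ball (F x0) r) G]].
Proof.
move=> oU Ux0 sF uJ.
have [r1 r10 [rU uJr lipH]] := near_identity oU Ux0 sF uJ.
set B := invmx _ in lipH.
pose c : R := 1 + \sum_i \sum_j `|B i j|.
have c0 : 0 < c by rewrite /c ltr_wpDr // !sumr_ge0 // => i _; rewrite sumr_ge0.
have normB (v : 'rV[R]_n) : `|v *m B| <= c * `|v|.
  apply: le_trans (normr_mulmx_le _ _) _.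
  by rewrite mulrC ler_wpM2r // /c lerDr.
have lower x y : ball x0 r1 x -> ball x0 r1 y -> `|y - x| <= 2 * c * `|F y - F x|.
  move=> xr yr; have h1 := lipH _ _ xr yr; have h2 := normB (F y - F x).
  have h3 : `|y - x| <= `|y - F y *m B - (x - F x *m B)| + `|(F y - F x) *m B|.
    apply: le_trans (ler_normD _ _); rewrite mulmxBl.
    suff -> : y - F y *m B - (x - F x *m B) + (F y *m B - F x *m B) = y - x by [].
    by apply/rowP => j; rewrite !mxE; ring.
  lra.
pose del : R := r1 / 2.
have del0 : 0 < del by rewrite /del divr_gt0.
pose r : R := del / (2 * c).
have r0 : 0 < r by rewrite /r divr_gt0 // mulr_gt0.
have rdel : c * r = del / 2 by rewrite /r; field; rewrite gt_eqF.
pose V := [set x | ball x0 r1 x /\ ball (F x0) r (F x)].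
have surj y : ball (F x0) r y -> exists2 x, V x & F x = y.
  move=> yr.
  pose D := [set x : 'rV[R]_n | `|x - x0| <= del].
  have Dr x : D x -> ball x0 r1 x.
    by move=> Dx; apply/mem_ballP; apply: le_lt_trans Dx _; rewrite /del; lra.
  pose T x := x - F x *m B + y *m B.
  have TD : {homo T : x / D x}.
    move=> x Dx; have x0r : ball x0 r1 x0 by apply/mem_ballP; rewrite subrr normr0.
    have h1 := lipH _ _ x0r (Dr _ Dx); have h2 := normB (y - F x0).
    have h4 : `|y - F x0| < r by apply/mem_ballP.
    have h5 : c * `|y - F x0| <= c * r by rewrite ler_wpM2l // ltW.
    have h3 : `|T x - x0| <=
        `|x - F x *m B - (x0 - F x0 *m B)| + `|(y - F x0) *m B|.
      apply: le_trans (ler_normD _ _); rewrite mulmxBl /T.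
      suff -> : x - F x *m B + y *m B - x0 =
        x - F x *m B - (x0 - F x0 *m B) + (y *m B - F x0 *m B) by [].
      by apply/rowP => j; rewrite !mxE; ring.
    rewrite /D /=; have : `|x - x0| <= del by exact: Dx.
    lra.
  pose TF := isFun.Build _ _ D D T TD.
  pose Tf : {fun D >-> D} := HB.pack T TF.
  have [|||x Dx xT] := @banach_fixed_point R 'rV[R]_n D Tf.
  - have q0 : 0 <= 2^-1 :> R by rewrite invr_ge0.
    exists (NngNum q0); split => /=; first lra.
    move=> [x y'] [/= Dx Dy]; rewrite /Tf /= /T.
    have -> : x - F x *m B + y *m B - (y' - F y' *m B + y *m B) =
              x - F x *m B - (y' - F y' *m B) by apply/rowP => j; rewrite !mxE; ring.
    by apply: lipH; exact: Dr.
  - rewrite (_ : D = closed_ball_ (fun x => `|x|) x0 del); last first.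
      by apply/seteqP; split => z; rewrite /D /closed_ball_ /= distrC.
    exact: closed_closed_ball_.
  - by exists x0; rewrite /D /= subrr normr0 ltW.
  have /eqP : (F x - y) *m B = 0.
    have {xT} : x = x - F x *m B + y *m B by exact: xT.
    move/(congr1 (fun z => x - z)); rewrite subrr mulmxBl => E.
    by rewrite [RHS]E; apply/rowP => j; rewrite !mxE; ring.
  have uB : B \in unitmx by rewrite /B unitmx_inv unitmx_tr.
  rewrite -(mul0mx _ B) => /eqP /(can_inj (mulmxK uB)) /eqP; rewrite subr_eq0.
  by move=> /eqP Fxy; exists x => //; split; [exact: Dr|rewrite Fxy].
have [G HG] : {G | forall y, ball (F x0) r y -> V (G y) /\ F (G y) = y}.
  have ex (y : 'rV[R]_n) : exists x, ball (F x0) r y -> V x /\ F x = y.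
    have [yr|nyr] := pselect (ball (F x0) r y); last by exists x0.
    by have [x Vx Fx] := surj y yr; exists x.
  by exists (fun y => sval (cid (ex y))) => y; exact: (svalP (cid (ex y))).
have VU x : V x -> U x by move=> [/rU].
have oV : open V.
  rewrite openE => x [xr Fxr]; rewrite /interior.
  have cF : {for x, continuous F} by apply: smooth_row_cont sF _; exact: rU.
  have nF : \forall z \near x, ball (F x0) r (F z).
    by apply: cF; exact: open_nbhs_nbhs (conj (ball_open _ _) Fxr).
  have nx : \forall z \near x, ball x0 r1 z.
    exact: open_nbhs_nbhs (conj (ball_open _ _) xr).
  by apply: filterS2 nx nF => z; split.
have GF x : V x -> G (F x) = x.
  move=> [xr Fxr]; have [[Gr _] FG] := HG _ Fxr.
  apply/eqP; rewrite -subr_eq0 -normr_eq0 eq_le normr_ge0 andbT.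
  by have := lower _ _ xr Gr; rewrite FG subrr normr0 mulr0.
have dG y a : ball (F x0) r y -> differentiable (fun z => G z 0 a) y /\
    forall b, pder b (fun z => G z 0 a) y = invmx (Jmx F (G y)) a b.
  move=> yr; have [[xr Fxr] FG] := HG _ yr.
  move: xr Fxr FG; set x := G y => xr Fxr FG.
  set A := invmx _.
  pose cA : R := 1 + \sum_i \sum_j `|A^T i j|.
  have cA0 : 0 < cA by rewrite /cA ltr_wpDr // !sumr_ge0 // => i _; rewrite sumr_ge0.
  apply: differentiable_grad => e e0.
  pose e' : R := e / (cA * (2 * c)).
  have e'0 : 0 < e' by rewrite /e' divr_gt0 // !mulr_gt0.
  have : \forall h \near (0 : 'rV[R]_n), forall j : 'I_n,
      `|F (h + x) 0 j - F x 0 j - \sum_l h 0 l * pder l (fun z => F z 0 j) x|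
      <= e' * `|h|.
    apply: (@filter_forall _ _ (fun (j : 'I_n) (h : 'rV[R]_n) =>
      `|F (h + x) 0 j - F x 0 j - \sum_l h 0 l * pder l (fun z => F z 0 j) x|
      <= e' * `|h|) (nbhs (0 : 'rV[R]_n)) (nbhs_filter _)) => j.
    apply: (@differentiable_grad_ex R n (fun z => F z 0 j) x _ e' e'0).
    by apply: (sF 0 j [::]); exact: rU.
  move=> /nbhs_ballP[rho /= rho0 Hrho].
  have n1 : \forall k \near (0 : 'rV[R]_n), ball (F x0) r (k + y).
    have yr' : `|y - F x0| < r by apply/mem_ballP.
    have : \forall k \near (0 : 'rV[R]_n), `|k| < r - `|y - F x0|.
      by apply: nbhs0_lt; lra.
    apply: filterS => k kr; apply/mem_ballP; rewrite -addrA.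
    by apply: le_lt_trans (ler_normD _ _) _; lra.
  have n2 : \forall k \near (0 : 'rV[R]_n), `|k| < rho / (2 * c).
    by apply: nbhs0_lt; rewrite divr_gt0 // mulr_gt0.
  apply: filterS2 n1 n2 => k kr krho.
  have [[Gr _] FGk] := HG _ kr.
  pose h := G (k + y) - x.
  have Eh : h + x = G (k + y) by rewrite /h subrK.
  have hk : `|h| <= 2 * c * `|k|.
    have := lower _ _ xr Gr; rewrite FGk FG addrK; exact.
  have hrho : ball (0 : 'rV[R]_n) rho h.
    apply/mem_ballP; rewrite subr0; apply: le_lt_trans hk _.
    by rewrite mulrC -ltr_pdivlMr // mulr_gt0.
  have Hh := Hrho _ hrho.
  pose E := k - h *m (Jmx F x)^T.
  have normE : `|E| <= e' * `|h|.
    apply: normr_row_le; first by rewrite mulr_ge0 // ltW.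
    move=> j; have := Hh j; rewrite /= Eh FGk FG mxE addrK /E !mxE.
    by congr (`|_ - _| <= _); apply: eq_bigr => l _; rewrite !mxE.
  have hE : h - k *m A^T = - (E *m A^T).
    rewrite /E mulmxBl opprB -mulmxA -trmx_mul mulVmx ?uJr //.
    by rewrite trmx1 mulmx1.
  have -> : G (k + y) 0 a - G y 0 a - \sum_j k 0 j * A a j = (h - k *m A^T) 0 a.
    rewrite /h !mxE; congr (_ - _); apply: eq_bigr => l _; by rewrite !mxE.
  apply: le_trans (normr_coord _ _) _; rewrite hE normrN.
  apply: le_trans (normr_mulmx_le _ _) _.
  have k1 : `|E| * \sum_i \sum_j `|A^T i j| <= `|E| * cA.
    by rewrite ler_wpM2l // /cA lerDr.
  apply: le_trans k1 _.
  have k2 : `|E| * cA <= e' * (2 * c * `|k|) * cA.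
    rewrite ler_wpM2r //; first exact: ltW.
    by apply: le_trans normE _; rewrite ler_wpM2l // ltW.
  apply: le_trans k2 _.
  suff -> : e' * (2 * c * `|k|) * cA = e * `|k| by [].
  by rewrite /e'; field; rewrite !gt_eqF.
exists V, r, G; split=> //.
  by split; [apply/mem_ballP|apply/mem_ballP]; rewrite subrr normr0.
split=> // [x Vx|i a].
  by split; [case: Vx|exact: GF].
rewrite (ord1 i) => {i}; have ob : open (ball (F x0) r) by exact: ball_open.
have sJ : smooth_mx_on V (fun x => invmx (Jmx F x)).
  apply: smooth_invmx => // [x [xr _]|]; first exact: uJr.
  exact: smooth_mx_sub (smooth_Jmx oU sF).
apply/smooth_onP => k; elim: k a => [|k IHk] a.
  by split=> // y yr; have [] := dG y a yr.
split=> [y yr|b]; first by have [] := dG y a yr.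
have Cc : Ck k (ball (F x0) r) (fun y => invmx (Jmx F (G y)) a b).
  apply: (@Ck_comp _ _ _ k _ V G (fun x => invmx (Jmx F x) a b)) => //.
    by move=> y /HG[].
  by have /smooth_onP := sJ a b.
apply: Ck_ext ob _ Cc => y /set_mem yr.
by have [_ ->] := dG y a yr.
Qed.

End InverseFunction.

(** * The model nilpotent block and its infinitesimal isometries *)

Section ModelBlock.
Variables (R : realType) (n : nat).
Implicit Types (A B K : 'M[R]_n.+1) (u v : 'cV[R]_n.+1).

Definition antidiag : 'M[R]_n.+1 := \matrix_(i, j) (i + j == n)%N%:R.
Local Notation S := antidiag.
Definition shift_mx : 'M[R]_n.+1 := \matrix_(i, j) (i.+1 == j :> nat)%:R.
Local Notation X := shift_mx.
Local Notation e0 := (delta_mx ord0 0 : 'cV[R]_n.+1).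
Local Notation en := (delta_mx ord_max 0 : 'cV[R]_n.+1).

Lemma antidiag_mull p (A : 'M[R]_(n.+1, p)) i j : (S *m A) i j = A (rev_ord i) j.
Proof.
rewrite mxE (bigD1 (rev_ord i)) //= big1 ?addr0 => [|l lk].
  by rewrite mxE /= subSS subnKC ?eqxx ?mul1r // -ltnS.
rewrite mxE; case: eqP => [E|]; last by rewrite mul0r.
by case/eqP: lk; apply/val_inj => /=; lia.
Qed.

Lemma antidiagT : S^T = S.
Proof. by apply/matrixP => i j; rewrite !mxE addnC. Qed.

Lemma antidiag_mulr p (A : 'M[R]_(p, n.+1)) i j : (A *m S) i j = A i (rev_ord j).
Proof. by rewrite -[A *m S]trmxK trmx_mul antidiagT mxE antidiag_mull mxE. Qed.

Lemma antidiagK : S *m S = 1%:M.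
Proof.
apply/matrixP => i j; rewrite antidiag_mull !mxE /= subSS; congr (_%:R).
have := ltn_ord i; have := ltn_ord j; rewrite -val_eqE /=; lia.
Qed.

Lemma antidiag_unit : S \in unitmx.
Proof. by have [] := mulmx1_unit antidiagK. Qed.

Lemma shiftE i j : X i j = (i.+1 == j :> nat)%:R.
Proof. by rewrite mxE. Qed.

Lemma jordan_blockE (lam : R) : jordan_block n.+1 lam = lam%:M + X.
Proof.
apply/matrixP => i j; rewrite [in LHS]mxE [in RHS]mxE shiftE mxE.
case: eqP => [->|_]; last by rewrite mulr0n add0r.
by rewrite mulr1n (_ : (_ == _) = false) ?addr0 //; apply/eqP; lia.
Qed.

Lemma shift_mull p (A : 'M[R]_(n.+1, p)) i j :
  (X *m A) i j = if (i < n)%N then A (inord i.+1) j else 0.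
Proof.
rewrite mxE; case: ifP => Hi.
  rewrite (bigD1 (inord i.+1)) //= big1 ?addr0 => [|l lk].
    by rewrite shiftE inordK // eqxx mul1r.
  rewrite shiftE; case: eqP => [E|]; last by rewrite mul0r.
  by case/eqP: lk; apply/val_inj; rewrite /= inordK.
rewrite big1 // => l _; rewrite shiftE (_ : (_ == _) = false) ?mul0r //.
by apply/eqP; have := ltn_ord l; lia.
Qed.

Lemma shiftT_mull p (A : 'M[R]_(n.+1, p)) i j :
  (X^T *m A) i j = if (0 < i)%N then A (inord i.-1) j else 0.
Proof.
rewrite mxE; have := ltn_ord i => Hin; case: ifP => Hi.
  rewrite (bigD1 (inord i.-1)) //= big1 ?addr0 => [|l lk].
    by rewrite mxE shiftE inordK ?prednK ?eqxx ?mul1r //; lia.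
  rewrite mxE shiftE; case: eqP => [E|]; last by rewrite mul0r.
  by case/eqP: lk; apply/val_inj; rewrite /= inordK; lia.
rewrite big1 // => l _; rewrite mxE shiftE (_ : (_ == _) = false) ?mul0r //.
by apply/eqP; lia.
Qed.

Lemma shift_mulr p (A : 'M[R]_(p, n.+1)) i j :
  (A *m X) i j = if (0 < j)%N then A i (inord j.-1) else 0.
Proof.
by rewrite -[A *m X]trmxK trmx_mul mxE shiftT_mull; case: ifP; rewrite ?mxE.
Qed.

Lemma shift_antidiag : X^T *m S = S *m X.
Proof.
apply/matrixP => i j; rewrite antidiag_mulr antidiag_mull mxE !shiftE /=.
congr (_%:R); have := ltn_ord i; have := ltn_ord j; rewrite -?val_eqE /=; lia.
Qed.

Lemma antidiag_shiftT : S *m X^T = X *m S.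
Proof.
rewrite -[LHS]mulmx1 -antidiagK -[_ *m (_ *m _)]mulmxA (mulmxA X^T) shift_antidiag.
by rewrite !mulmxA antidiagK mul1mx.
Qed.

Lemma trace_shift : \tr X = 0.
Proof.
by rewrite /mxtrace big1 // => i _; rewrite mxE; case: eqP => // E; exfalso; lia.
Qed.

Lemma shift_e0 : X *m e0 = 0.
Proof.
by apply/colP => i; rewrite -colE !mxE; case: eqP => // ->.
Qed.

Lemma en_shift : en^T *m X = 0.
Proof.
apply/rowP => j; rewrite trmx_delta -rowE !mxE; case: eqP => // E.
by have := ltn_ord j; move: E => /=; lia.
Qed.

Lemma antidiag_en : S *m en = e0.
Proof.
apply/colP => i; rewrite antidiag_mull !mxE eqxx !andbT; congr (_%:R).
by have := ltn_ord i; rewrite -!val_eqE /=; lia.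
Qed.

Lemma antidiag_e0 : S *m e0 = en.
Proof. by rewrite -antidiag_en mulmxA antidiagK mul1mx. Qed.

Lemma shiftTX : X^T *m X = 1%:M - e0 *m e0^T.
Proof.
apply/matrixP => i j; rewrite shiftT_mull trmx_delta mul_delta_mx !mxE -?val_eqE /=.
have := ltn_ord i; have := ltn_ord j.
case: (posnP i) => [->|i0] _ Hi.
  by case: (posnP j) => [->|j0]; rewrite /= ?subrr // eq_sym (gtn_eqF j0) subrr.
rewrite inordK ?prednK // ?subr0; last by lia.
by congr (_%:R); lia.
Qed.

Lemma shiftXT : X *m X^T = 1%:M - en *m en^T.
Proof.
apply/matrixP => i j; rewrite shift_mull trmx_delta mul_delta_mx !mxE -?val_eqE /=.
have := ltn_ord i; have := ltn_ord j => Hj Hi.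
case: ifP => H.
  rewrite inordK // (ltn_eqF H) subr0; by congr (_%:R); lia.
have -> : (i == n :> nat) by apply/eqP; lia.
have -> : (i == j :> nat) = (j == n :> nat) by apply/eqP/eqP; lia.
by rewrite subrr.
Qed.

Definition grading (c : R) : 'M[R]_n.+1 := diag_mx (\row_i (i%:R - c)).

Lemma grading_e0 c : grading c *m e0 = - c *: e0.
Proof.
apply/colP => i; rewrite mul_diag_mx !mxE; case: eqP => [->|_] /=.
  by rewrite sub0r.
by rewrite !mulr0.
Qed.

Lemma shift_grading c :
  X *m grading c *m X^T = grading c + 1%:M - (n.+1%:R - c) *: (en *m en^T).
Proof.
apply/matrixP => i j.
rewrite -mulmxA shift_mull trmx_delta mul_delta_mx mul_diag_mx !mxE -?val_eqE /=.
have := ltn_ord i; have := ltn_ord j => Hj Hi.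
case: ifP => H.
  rewrite inordK // (ltn_eqF H) mulr0 subr0.
  have -> : (j.+1 == i.+1) = (i == j :> nat) by apply/eqP/eqP; lia.
  case: (i == j :> nat) => /=; rewrite ?mulr0 ?mulr0n ?addr0 //.
  by rewrite mulr1 mulr1n -natr1; ring.
have -> : (i == n :> nat) by apply/eqP; lia.
have -> : (i == j :> nat) = (j == n :> nat) by apply/eqP/eqP; lia.
case: (j == n :> nat) => /=; rewrite ?mulr0 ?mulr0n ?addr0 ?subr0 //.
have -> : nat_of_ord i = n by lia.
by rewrite mulr1 mulr1n -natr1; ring.
Qed.

Local Notation N2 := (n.+1%:R / 2 : R).

(** For a compatible pair, in a frame where [L] is the Jordan block and [g] is
    [eps] times the antidiagonal form, the connection matrix in the direction
    [u] is this one times the derivative of the eigenvalue along the last vector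
    of the frame. *)
Definition block_connection u : 'M[R]_n.+1 :=
  N2 *: (e0 *m u^T *m S *m X^T - X^T *m u *m en^T)
  + u ord_max 0 *: (grading N2 *m X^T).

Lemma grading_skew : (grading N2 *m X^T)^T *m S + S *m (grading N2 *m X^T) = 0.
Proof.
apply/matrixP => i j; rewrite [LHS]mxE antidiag_mulr antidiag_mull [in LHS]mxE.
rewrite !mul_diag_mx !mxE /=.
have := ltn_ord i; have := ltn_ord j => Hj Hi.
rewrite -?val_eqE /=.
have -> : (j.+1 == (n.+1 - i.+1)%N :> nat) = ((i + j).+1 == n)%N by apply/eqP/eqP; lia.
have -> : (i.+1 == (n.+1 - j.+1)%N :> nat) = ((i + j).+1 == n)%N by apply/eqP/eqP; lia.
case: eqP => [E|_]; last by rewrite !mulr0 addr0.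
rewrite !mulr1 !subSS !natrB; [|lia|lia].
have -> : n.+1%:R = (i%:R + j%:R + 2) :> R by rewrite -!natrD; congr (_%:R); lia.
have -> : n%:R = (i%:R + j%:R + 1) :> R by rewrite -natrD natr1; congr (_%:R); lia.
by field.
Qed.

Lemma block_connection_skew u :
  (block_connection u)^T *m S + S *m block_connection u = 0.
Proof.
have skewZ c K : K^T *m S + S *m K = 0 -> (c *: K)^T *m S + S *m (c *: K) = 0.
  by move=> HK; rewrite linearZ /= -scalemxAl -scalemxAr -scalerDr HK scaler0.
have skewD K1 K2 : K1^T *m S + S *m K1 = 0 -> K2^T *m S + S *m K2 = 0 ->
    (K1 + K2)^T *m S + S *m (K1 + K2) = 0.
  by move=> H1 H2; rewrite linearD /= mulmxDl mulmxDr addrACA H1 H2 addr0.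
apply: skewD; apply: skewZ; last exact: grading_skew.
rewrite linearB /= !trmx_mul !trmxK antidiagT mulmxBl mulmxBr -!mulmxA.
have -> : e0^T *m S = en^T by rewrite -[S]antidiagT -trmx_mul antidiag_e0.
rewrite !mulmxA antidiag_e0 antidiag_shiftT -!mulmxA antidiag_shiftT.
by rewrite addrA subrK subrr.
Qed.

(** The two rank-one terms are those of the compatibility equation. *)
Lemma block_connection_comm u :
  block_connection u *m X - X *m block_connection u =
  N2 *: (u *m en^T + e0 *m u^T *m S) - u ord_max 0 *: 1%:M.
Proof.
have uS : u^T *m S *m e0 = (u ord_max 0)%:M.
  rewrite -mulmxA antidiag_e0; apply/matrixP => i j; rewrite !ord1 -colE !mxE.
  by rewrite mulr1n.
have enu : en^T *m u = (u ord_max 0)%:M.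
  by apply/matrixP => i j; rewrite !ord1 trmx_delta -rowE !mxE mulr1n.
have PX : e0 *m u^T *m S *m X^T *m X =
    e0 *m u^T *m S - u ord_max 0 *: (e0 *m e0^T).
  rewrite -!mulmxA shiftTX !mulmxBr !mulmx1 !mulmxA; congr (_ - _).
  by rewrite -(mulmxA e0) -(mulmxA e0) uS mul_mx_scalar scalemxAl.
have XP : X *m (e0 *m u^T *m S *m X^T) = 0 by rewrite !mulmxA shift_e0 !mul0mx.
have QX : X^T *m u *m en^T *m X = 0 by rewrite -!mulmxA en_shift !mulmx0.
have XQ : X *m (X^T *m u *m en^T) = u *m en^T - u ord_max 0 *: (en *m en^T).
  rewrite !mulmxA shiftXT !mulmxBl !mul1mx; congr (_ - _).
  by rewrite -(mulmxA en) enu mul_mx_scalar scalemxAl.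
have DX : grading N2 *m X^T *m X = grading N2 + N2 *: (e0 *m e0^T).
  rewrite -mulmxA shiftTX mulmxBr mulmx1 mulmxA grading_e0 scaleNr mulNmx.
  by rewrite opprK scalemxAl.
have XD := shift_grading N2; rewrite -mulmxA in XD.
rewrite /block_connection mulmxDl mulmxDr -!scalemxAl -!scalemxAr mulmxBl mulmxBr.
rewrite PX XP QX XQ DX XD.
move: (e0 *m u^T *m S) (u *m en^T) (e0 *m e0^T) (en *m en^T) => A B C D.
by apply/matrixP => i j; rewrite !mxE; field.
Qed.

(** The torsion of a connection with this matrix is what turns into the
    right-hand side of the structure equation. *)
Lemma block_connection_torsion u v :
  block_connection u *m v - block_connection v *m u =
  grading 0 *m X^T *m (u ord_max 0 *: v - v ord_max 0 *: u).
Proof.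
have sym : u^T *m S *m X^T *m v = v^T *m S *m X^T *m u.
  rewrite [LHS]mx11_scalar [RHS]mx11_scalar; congr (_%:M).
  have -> : u^T *m S *m X^T *m v = (v^T *m S *m X^T *m u)^T; last by rewrite mxE.
  by rewrite !trmx_mul !trmxK antidiagT (mulmxA X) -antidiag_shiftT !mulmxA.
have enE w : en^T *m w = (w ord_max 0)%:M.
  by apply/matrixP => i j; rewrite !ord1 trmx_delta -rowE !mxE mulr1n.
rewrite /block_connection !mulmxDl -!scalemxAl !mulmxBl.
have -> : e0 *m u^T *m S *m X^T *m v = e0 *m (u^T *m S *m X^T *m v) by rewrite !mulmxA.
have -> : e0 *m v^T *m S *m X^T *m u = e0 *m (u^T *m S *m X^T *m v).
  by rewrite sym !mulmxA.
rewrite -!(mulmxA _ en^T) !enE !mul_mx_scalar -!(mulmxA (grading _)).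
have -> : grading 0 = grading N2 + N2%:M.
  by apply/matrixP => i j; rewrite !mxE; case: (i == j); rewrite ?mulr1n ?mulr0n; ring.
rewrite mulmxDl mul_scalar_mx (mulmxBr X^T) -!scalemxAr mulmxBr -!scalemxAr.
move: (e0 *m _) (X^T *m u) (X^T *m v) => A B C.
move: (grading N2 *m B) (grading N2 *m C) => D E'.
by apply/colP => i; rewrite !mxE; ring.
Qed.

(** Matrices commuting with [X] are constant along diagonals and therefore
    selfadjoint for the antidiagonal form. *)
Lemma skew_comm_shift K :
  K^T *m S + S *m K = 0 -> K *m X = X *m K -> K = 0.
Proof.
move=> skewK commK.
have step (i j i' j' : 'I_n.+1) : i' = i.+1 :> nat -> j' = j.+1 :> nat ->
    K i j = K i' j'.
  move=> Ei Ej.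
  have Hi' := ltn_ord i'; have Hj' := ltn_ord j'.
  have := congr1 (fun A : 'M[R]_n.+1 => A i j') commK.
  rewrite /= shift_mulr shift_mull.
  have -> : (0 < j')%N by rewrite Ej.
  have -> : (i < n)%N by lia.
  have -> : inord j'.-1 = j by apply/val_inj; rewrite /= inordK; lia.
  by have -> : inord i.+1 = i' by apply/val_inj; rewrite /= inordK; lia.
have toep d (i j i' j' : 'I_n.+1) : i' = (i + d)%N :> nat -> j' = (j + d)%N :> nat ->
    K i j = K i' j'.
  elim: d i j i' j' => [|d IHd] i j i' j' Ei Ej.
    by rewrite addn0 in Ei; rewrite addn0 in Ej; congr (K _ _); exact/val_inj.
  have Hi' := ltn_ord i'; have Hj' := ltn_ord j'.
  rewrite (IHd i j (inord (i + d)) (inord (j + d))); last 2 first.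
  - by rewrite inordK; lia.
  - by rewrite inordK; lia.
  by apply: step; rewrite inordK; lia.
apply/matrixP => i j; rewrite [RHS]mxE.
have := congr1 (fun A : 'M[R]_n.+1 => A (rev_ord i) j) skewK.
rewrite /= mxE antidiag_mulr antidiag_mull rev_ordK [in LHS]mxE mxE.
have Hi := ltn_ord i; have Hj := ltn_ord j.
have -> : K (rev_ord j) (rev_ord i) = K i j.
  have [le|/ltnW le] := leqP (n - j)%N i.
    by apply: (toep (i - (n - j))%N); rewrite /=; lia.
  by apply/esym; apply: (toep (n - j - i)%N); rewrite /=; lia.
by move=> E; lra.
Qed.

End ModelBlock.

(** * Compatibility in an adapted coframe *)

Section MatrixDerivatives.
Variables (R : realType) (n : nat).
Implicit Types (x : 'rV[R]_n).

Definition diff_mx p q (A : 'rV[R]_n -> 'M[R]_(p, q)) x :=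
  forall i j, differentiable (fun y => A y i j) x.

Lemma pder_mxM p q r (A : 'rV[R]_n -> 'M[R]_(p, q)) (B : 'rV[R]_n -> 'M[R]_(q, r)) x i :
  diff_mx A x -> diff_mx B x ->
  pder_mx i (fun y => A y *m B y) x = pder_mx i A x *m B x + A x *m pder_mx i B x.
Proof.
move=> dA dB; apply/matrixP => a b; rewrite !mxE -big_split /=.
rewrite (_ : (fun y => _) = fun y => \sum_k A y a k * B y k b); last first.
  by apply/funext => y; rewrite mxE.
rewrite pder_sum => [|k]; last exact: differentiableM.
by apply: eq_bigr => k _; rewrite pderM // !mxE addrC.
Qed.

Lemma diff_mxM p q r (A : 'rV[R]_n -> 'M[R]_(p, q)) (B : 'rV[R]_n -> 'M[R]_(q, r)) x :
  diff_mx A x -> diff_mx B x -> diff_mx (fun y => A y *m B y) x.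
Proof.
move=> dA dB a b.
rewrite (_ : (fun y => _) = \sum_(k < q) (fun y => A y a k * B y k b)).
  by apply: differentiable_sum => k; exact: differentiableM.
by apply/funext => y; rewrite mxE fct_sumE.
Qed.

Lemma diff_mxT p q (A : 'rV[R]_n -> 'M[R]_(p, q)) x :
  diff_mx A x -> diff_mx (fun y => (A y)^T) x.
Proof.
move=> dA a b; rewrite (_ : (fun y => _) = fun y => A y b a); first exact: dA.
by apply/funext => y; rewrite mxE.
Qed.

Lemma pder_mxT p q (A : 'rV[R]_n -> 'M[R]_(p, q)) x i :
  pder_mx i (fun y => (A y)^T) x = (pder_mx i A x)^T.
Proof.
apply/matrixP => a b; rewrite !mxE; congr (pder i _ x).
by apply/funext => y; rewrite mxE.
Qed.

Lemma diff_mx_cst p q (C : 'M[R]_(p, q)) x : diff_mx (fun=> C) x.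
Proof. by move=> i j; exact: differentiable_cst. Qed.

Lemma pder_mx_cst p q (C : 'M[R]_(p, q)) x (i : 'I_n) :
  pder_mx i (fun=> C) x = 0.
Proof. by apply/matrixP => a b; rewrite !mxE pder_cst. Qed.

Lemma pder_mx_ext p q (U : set 'rV[R]_n) (A B : 'rV[R]_n -> 'M[R]_(p, q)) x i :
  open U -> U x -> {in U, A =1 B} -> pder_mx i A x = pder_mx i B x.
Proof.
move=> oU Ux AB; apply/matrixP => a b; rewrite !mxE.
by apply: (pder_ext _ oU _ Ux) => y Uy; rewrite AB.
Qed.

Lemma smooth_diff_mx p q (U : set 'rV[R]_n) (A : 'rV[R]_n -> 'M[R]_(p, q)) x :
  smooth_mx_on U A -> U x -> diff_mx A x.
Proof. by move=> sA Ux i j; exact: (sA i j [::]). Qed.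

End MatrixDerivatives.

Section LeviCivita.
Variables (R : realType) (n : nat).
Variables (U : set 'rV[R]_n) (g : 'rV[R]_n -> 'M[R]_n) (x : 'rV[R]_n).
Hypotheses (oU : open U) (Ux : U x).
Hypothesis symg : forall y, U y -> (g y)^T = g y.
Hypothesis ug : g x \in unitmx.

Lemma pder_metric_sym i a b :
  pder i (fun y => g y a b) x = pder i (fun y => g y b a) x.
Proof.
apply: (pder_ext _ oU _ Ux) => y /set_mem Uy.
by rewrite -[in LHS](symg Uy) mxE.
Qed.

Lemma christoffel_lower i l j : (g x *m christoffel g x i) l j =
  2%:R^-1 * (pder i (fun y => g y j l) x + pder j (fun y => g y i l) x
             - pder l (fun y => g y i j) x).
Proof. by rewrite /christoffel mulKVmx // mxE. Qed.

Lemma christoffel_metric i :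
  pder_mx i g x = (christoffel g x i)^T *m g x + g x *m christoffel g x i.
Proof.
have -> : (christoffel g x i)^T *m g x = (g x *m christoffel g x i)^T.
  by rewrite [RHS]trmx_mul (symg Ux).
apply/matrixP => a b; rewrite [LHS]mxE [RHS]mxE [X in _ = X + _]mxE !christoffel_lower.
rewrite (pder_metric_sym i a b) (pder_metric_sym a i b) (pder_metric_sym b i a).
rewrite (pder_metric_sym b a i) (pder_metric_sym a b i); by field.
Qed.

Lemma christoffel_torsion i j :
  christoffel g x i *m delta_mx j 0 = christoffel g x j *m delta_mx i (0 : 'I_1).
Proof.
apply: (can_inj (mulKmx ug)); apply/colP => l.
rewrite (mulmxA _ (christoffel g x i)) (mulmxA _ (christoffel g x j)) -!colE.
rewrite [LHS]mxE [RHS]mxE !christoffel_lower.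
rewrite (pder_metric_sym l i j).
by congr (_ * _); ring.
Qed.

(** Koszul's argument: the three cyclic permutations of the metric equation
    determine the connection. *)
Lemma christoffel_unique (C : 'I_n -> 'M[R]_n) :
  (forall i, pder_mx i g x = (C i)^T *m g x + g x *m C i) ->
  (forall i j, C i *m delta_mx j 0 = C j *m delta_mx i (0 : 'I_1)) ->
  forall i, christoffel g x i = C i.
Proof.
move=> met tor i; apply: (can_inj (mulKmx ug)); apply/matrixP => l j.
rewrite christoffel_lower.
have E k a b : pder k (fun y => g y a b) x = (g x *m C k) b a + (g x *m C k) a b.
  have := congr1 (fun B : 'M[R]_n => B a b) (met k).
  rewrite /= [LHS]mxE [RHS]mxE => ->; congr (_ + _).
  by rewrite -[X in _ *m X](symg Ux) -trmx_mul mxE.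
have T k a b : (g x *m C k) a b = (g x *m C b) a k.
  have := congr1 (fun B : 'cV[R]_n => (g x *m B) a 0) (tor k b).
  by rewrite /= !mulmxA -!colE [LHS]mxE [RHS]mxE.
rewrite !E (T j i l) (T i j l) (T j l i); by field.
Qed.

End LeviCivita.

Lemma gadjointZ (R : realType) n (G B : 'M[R]_n) c :
  gadjoint G (c *: B) = c *: gadjoint G B.
Proof. by rewrite /gadjoint linearZ /= -scalemxAr -scalemxAl. Qed.

Section Coframe.
Variables (R : realType) (n : nat).
Local Notation N := n.+1.
Local Notation S := (antidiag R n).
Local Notation X := (shift_mx R n).
Local Notation e0 := (delta_mx ord0 0 : 'cV[R]_n.+1).
Local Notation en := (delta_mx ord_max 0 : 'cV[R]_n.+1).
Local Notation ee i := (delta_mx i 0 : 'cV[R]_n.+1).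
Local Notation N2 := (n.+1%:R / 2 : R).

(** The rows of [A x] are the one-forms of the coframe. *)
Definition adapted_coframe (U : set 'rV[R]_N) (g L A : 'rV[R]_N -> 'M[R]_N)
    (lam : 'rV[R]_N -> R) (eps : R) : Prop :=
  [/\ smooth_mx_on U A, smooth_on U lam, eps * eps = 1 &
      forall x, U x -> [/\ A x \in unitmx,
        g x = eps *: ((A x)^T *m S *m A x) &
        A x *m L x = jordan_block N (lam x) *m A x]].

Definition grad_row (lam : 'rV[R]_N -> R) x : 'rV[R]_N := \row_i pder i lam x.

(** [d theta^k = k theta^(k-1) /\ d lam], for the rows [theta^0 .. theta^n] of
    [A], evaluated on the coordinate fields [i] and [j]. *)
Definition structure_equation (A : 'rV[R]_N -> 'M[R]_N) (lam : 'rV[R]_N -> R) x :=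
  forall i j, pder_mx i A x *m ee j - pder_mx j A x *m ee i =
    grading n 0 *m X^T *m
      (pder j lam x *: (A x *m ee i) - pder i lam x *: (A x *m ee j)).

Variables (U : set 'rV[R]_N) (g L A : 'rV[R]_N -> 'M[R]_N).
Variables (lam : 'rV[R]_N -> R) (eps : R).
Hypothesis oU : open U.
Hypothesis adA : adapted_coframe U g L A lam eps.
Variable x : 'rV[R]_N.
Hypothesis Ux : U x.

Let sA := let: And4 sA _ _ _ := adA in sA.
Let slam := let: And4 _ sl _ _ := adA in sl.
Let eps2 := let: And4 _ _ e _ := adA in e.
Let pA := let: And4 _ _ _ p := adA in p.

Lemma coframe_eps_neq0 : eps != 0.
Proof.
by apply/eqP => e0'; have := eps2; rewrite e0' mulr0 => /eqP; rewrite eq_sym oner_eq0.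
Qed.

Lemma coframe_unit : A x \in unitmx. Proof. by case: (pA Ux). Qed.
Let uA := coframe_unit.

Lemma coframe_g y : U y -> g y = eps *: ((A y)^T *m S *m A y).
Proof. by move=> Uy; case: (pA Uy). Qed.

Lemma coframe_gsym y : U y -> (g y)^T = g y.
Proof.
move=> /coframe_g ->; rewrite linearZ /= !trmx_mul trmxK antidiagT.
by rewrite mulmxA.
Qed.

Lemma coframe_ginv : invmx (g x) = eps *: (invmx (A x) *m S *m (invmx (A x))^T).
Proof.
have ug : g x *m (eps *: (invmx (A x) *m S *m (invmx (A x))^T)) = 1%:M.
  rewrite (coframe_g Ux) -scalemxAl -scalemxAr scalerA eps2 scale1r.
  rewrite !mulmxA mulmxK // -(mulmxA _ S S) antidiagK mulmx1 -trmx_mul.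
  by rewrite mulVmx // trmx1.
by rewrite -[LHS]mulmx1 -ug mulKmx //; have [] := mulmx1_unit ug.
Qed.

Lemma coframe_gunit : g x \in unitmx.
Proof.
rewrite (coframe_g Ux) unitmxZ ?unitfE ?coframe_eps_neq0 //.
by rewrite !unitmx_mul unitmx_tr uA antidiag_unit.
Qed.
Let ug := coframe_gunit.

Lemma coframe_L y : U y -> L y = invmx (A y) *m (jordan_block N (lam y) *m A y).
Proof. by move=> Uy; have [uAy _ <-] := pA Uy; rewrite mulKmx. Qed.

Lemma coframe_selfadjoint : gadjoint (g x) (L x) = L x.
Proof.
rewrite /gadjoint coframe_ginv (coframe_g Ux) (coframe_L Ux) -!scalemxAl -scalemxAr.
rewrite scalerA eps2 scale1r !trmx_mul !mulmxA.
rewrite trmx_inv !mulmxKV ?unitmx_tr // -!mulmxA; congr (invmx _ *m _).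
rewrite !mulmxA; congr (_ *m _).
rewrite jordan_blockE [(_ + _)^T]linearD /= tr_scalar_mx mulmxDr mulmxDl.
rewrite -(mulmxA S X^T) shift_antidiag mulmxA antidiagK mul1mx.
by rewrite mul_mx_scalar -scalemxAl antidiagK scalemx1.
Qed.

Lemma coframe_dtr : dtr L x = n.+1%:R *: grad_row lam x.
Proof.
apply/rowP => j; rewrite !mxE.
have -> : pder j (fun y => \tr (L y)) x = pder j (fun y => n.+1%:R * lam y) x.
  apply: (pder_ext _ oU _ Ux) => y /set_mem Uy.
  have [uAy _ _] := pA Uy.
  rewrite (coframe_L Uy) mxtrace_mulC mulmxK // jordan_blockE mxtraceD.
  by rewrite trace_shift addr0 mxtrace_scalar mulr_natl.
rewrite pderM; first by rewrite pder_cst mul0r addr0.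
  exact: differentiable_cst.
exact: (slam [::]).
Qed.

(** The matrix of the Levi-Civita connection, in the direction of the coordinate
    field [i], relative to the frame dual to the rows of [A]. *)
Definition frame_connection i : 'M[R]_N :=
  (A x *m christoffel g x i - pder_mx i A x) *m invmx (A x).
Local Notation Om := frame_connection.

Lemma pder_coframe_g i : pder_mx i g x =
  eps *: ((pder_mx i A x)^T *m S *m A x + (A x)^T *m S *m pder_mx i A x).
Proof.
have dA := smooth_diff_mx sA Ux.
have -> : pder_mx i g x =
    pder_mx i (fun y => (A y)^T *m ((eps *: S) *m A y)) x.
  apply: (pder_mx_ext _ oU Ux) => y /set_mem Uy.
  by rewrite (coframe_g Uy) -scalemxAl -scalemxAr mulmxA.
have dS : diff_mx (fun y => (eps *: S) *m A y) x.
  by apply: diff_mxM => //; exact: diff_mx_cst.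
rewrite pder_mxM //; last exact: diff_mxT.
rewrite pder_mxT (pder_mxM i (diff_mx_cst _ _) dA) pder_mx_cst mul0mx add0r.
by rewrite scalerDr -!scalemxAl -!scalemxAr !mulmxA.
Qed.

(** Parallelism of [g] is skewness of the connection matrix in the frame, where
    [g] has constant components. *)
Lemma metric_skewP (Gam O : 'M[R]_N) i :
  A x *m Gam = pder_mx i A x + O *m A x ->
  pder_mx i g x = Gam^T *m g x + g x *m Gam <-> O^T *m S + S *m O = 0.
Proof.
move=> EO; rewrite pder_coframe_g (coframe_g Ux) -scalemxAr -scalemxAl -scalerDr.
have -> : Gam^T *m ((A x)^T *m S *m A x) + (A x)^T *m S *m A x *m Gam =
    ((pder_mx i A x)^T *m S *m A x + (A x)^T *m S *m pder_mx i A x)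
    + (A x)^T *m (O^T *m S + S *m O) *m A x.
  rewrite -(mulmxA _ (A x) Gam) EO !mulmxA -trmx_mul EO linearD /= trmx_mul.
  rewrite !mulmxDl !mulmxDr !mulmxDl !mulmxA [LHS]addrACA.
  by [].
split=> [/(scalerI coframe_eps_neq0)/esym/eqP|->].
  rewrite -subr_eq0 addrC addKr => /eqP E.
  have uT : (A x)^T \in unitmx by rewrite unitmx_tr.
  rewrite -[LHS](mulKmx uT) -[X in invmx _ *m X](mulmxK uA) E mul0mx mulmx0 //.
by rewrite mulmx0 mul0mx addr0.
Qed.

Lemma frame_connectionE i :
  A x *m christoffel g x i = pder_mx i A x + Om i *m A x.
Proof. by rewrite /frame_connection mulmxKV // addrC subrK. Qed.

Lemma frame_connection_skew i : (Om i)^T *m S + S *m Om i = 0.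
Proof.
apply/(metric_skewP (frame_connectionE i)).
exact: (christoffel_metric oU Ux coframe_gsym).
Qed.

Lemma frame_cov_der i :
  A x *m (pder_mx i L x + christoffel g x i *m L x - L x *m christoffel g x i)
    *m invmx (A x) = (pder i lam x)%:M + (Om i *m X - X *m Om i).
Proof.
have dA := smooth_diff_mx sA Ux.
have dL : diff_mx L x.
  have sL : smooth_mx_on U L.
    have sAi : smooth_mx_on U (fun y => invmx (A y)).
      by apply: smooth_invmx => // y Uy; case: (pA Uy).
    have sJ : smooth_mx_on U (fun y => jordan_block N (lam y)).
      move=> a b; case: (eqVneq a b) => [->|ab].
        by apply: (smooth_ext oU _ slam) => y _; rewrite mxE eqxx.
      apply: (smooth_ext oU _ (@smooth_cst R N U (a.+1 == b :> nat)%:R)) => y _.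
      by rewrite mxE (negPf ab).
    apply: (smooth_mx_ext oU (A := fun y => invmx (A y) *m (jordan_block N (lam y) *m A y))).
      by move=> y /set_mem Uy; rewrite (coframe_L Uy).
    by apply: smooth_mxM => //; exact: smooth_mxM.
  exact: smooth_diff_mx sL Ux.
have dlam : differentiable lam x by exact: (slam [::]).
have dJ : diff_mx (fun y => (lam y)%:M + X) x.
  move=> a b; rewrite (_ : (fun y => _) = fun y => lam y *+ (a == b) + X a b).
    apply: differentiableD; last exact: differentiable_cst.
    by case: (a == b); [exact: dlam|exact: differentiable_cst].
  by apply/funext => y; rewrite !mxE.
have E : pder_mx i A x *m L x + A x *m pder_mx i L x =
    (pder i lam x)%:M *m A x + ((lam x)%:M + X) *m pder_mx i A x.
  rewrite -pder_mxM //.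
  have -> : pder_mx i (fun y => A y *m L y) x =
      pder_mx i (fun y => ((lam y)%:M + X) *m A y) x.
    apply: (pder_mx_ext _ oU Ux) => y /set_mem Uy.
    by have [_ _ ->] := pA Uy; rewrite jordan_blockE.
  rewrite pder_mxM //; congr (_ *m _ + _); apply/matrixP => a b; rewrite !mxE.
  rewrite (_ : (fun y => _) = fun y => lam y *+ (a == b) + X a b); last first.
    by apply/funext => y; rewrite !mxE.
  rewrite pderD; last 2 first.
  - by case: (a == b); [exact: dlam|exact: differentiable_cst].
  - exact: differentiable_cst.
  by rewrite pder_cst addr0; case: (a == b) => //; rewrite pder_cst.
apply: (can_inj (mulmxK uA)); rewrite mulmxKV //.
have EL : A x *m L x = ((lam x)%:M + X) *m A x.
  by have [_ _ ->] := pA Ux; rewrite jordan_blockE.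
rewrite mulmxBr mulmxDr mulmxA frame_connectionE mulmxA EL -(mulmxA _ (A x)).
rewrite frame_connectionE mulmxDl -(mulmxA (Om i)) EL.
move/(canRL (addKr _)): E => ->.
set J := _ + X; transitivity ((pder i lam x)%:M *m A x
    + (Om i *m (J *m A x) - J *m (Om i *m A x))).
  rewrite (mulmxDr J (pder_mx i A x)).
  move: (_ *m L x) (_ *m A x) (J *m pder_mx i A x) (_ *m (J *m A x)) (J *m (_ *m A x)).
  by move=> B C D E F; apply/matrixP => a b; rewrite !mxE; ring.
move: (Om i) => O; rewrite [RHS]mulmxDl; congr (_ + _).
rewrite !mulmxA -mulmxBl; congr (_ *m _).
by rewrite /J mulmxDr mulmxDl mul_mx_scalar mul_scalar_mx opprD addrACA subrr add0r.
Qed.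

(** The compatibility equation in the direction of the coordinate field [i],
    written in the frame; [m] is the row of components of [d lam]. *)
Lemma coframe_compatP i (m := grad_row lam x *m invmx (A x)) (u := A x *m ee i) :
  cov_der g L x (ee i) =
    2%:R^-1 *: (ee i *m dtr L x + gadjoint (g x) (ee i *m dtr L x)) <->
  (pder i lam x)%:M + (Om i *m X - X *m Om i) =
    N2 *: (u *m m + S *m m^T *m u^T *m S).
Proof.
have -> : cov_der g L x (ee i) =
    pder_mx i L x + christoffel g x i *m L x - L x *m christoffel g x i.
  rewrite /cov_der (bigD1 i) //= big1 ?addr0 => [|j ji].
    by rewrite !mxE !eqxx scale1r.
  by rewrite !mxE (negPf ji) scale0r.
set Z := _ - _; set Y := 2%:R^-1 *: _.
rewrite -frame_cov_der -/Z.
have -> : N2 *: (u *m m + S *m m^T *m u^T *m S) = A x *m Y *m invmx (A x).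
  rewrite /Y coframe_dtr -(scalemxAr _ (ee i) (grad_row lam x)).
  set B := ee i *m grad_row lam x.
  rewrite gadjointZ -scalerDr scalerA -scalemxAr -scalemxAl [_^-1 * _]mulrC mulmxDr mulmxDl.
  congr (_ *: (_ + _)); first by rewrite /u /m /B !mulmxA.
  rewrite /gadjoint coframe_ginv (coframe_g Ux) -!scalemxAl -!scalemxAr -!scalemxAl.
  rewrite scalerA eps2 scale1r /B /u /m !trmx_mul !mulmxA mulmxV // mul1mx.
  by rewrite mulmxK.
split=> [-> //|E].
apply: (can_inj (mulKmx uA)); apply: (can_inj (mulmxK (_ : invmx (A x) \in unitmx))).
  by rewrite unitmx_inv.
exact: E.
Qed.

Lemma compat_linear :
  (forall i, cov_der g L x (ee i) =
    2%:R^-1 *: (ee i *m dtr L x + gadjoint (g x) (ee i *m dtr L x))) ->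
  forall u : 'cV[R]_N, cov_der g L x u =
    2%:R^-1 *: (u *m dtr L x + gadjoint (g x) (u *m dtr L x)).
Proof.
move=> E u.
have cov_sum : cov_der g L x u = \sum_i u i 0 *: cov_der g L x (ee i).
  rewrite {1}/cov_der; apply: eq_bigr => i _; congr (_ *: _).
  rewrite /cov_der (bigD1 i) //= big1 ?addr0 => [|j ji].
    by rewrite !mxE !eqxx scale1r.
  by rewrite !mxE (negPf ji) scale0r.
have uE : u = \sum_i u i 0 *: ee i.
  rewrite {1}[u]matrix_sum_delta; apply: eq_bigr => i _.
  by rewrite big_ord1.
rewrite cov_sum [in RHS]uE mulmx_suml /gadjoint linear_sum /= mulmx_sumr mulmx_suml.
rewrite -big_split scaler_sumr /=; apply: eq_bigr => i _; rewrite E.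
rewrite -/(gadjoint (g x) (_ *m _)) -scalemxAl gadjointZ -scalerDr.
by rewrite !scalerA mulrC.
Qed.

(** Tracing the compatibility equation against the nilpotent part of [L]
    forces [d lam] to be proportional to the last form of the coframe; the
    connection matrix is then determined algebraically, and torsion-freeness
    becomes the structure equation. *)
Lemma compatible_structure : compatible_on U g L ->
  (exists mu : R, grad_row lam x = mu *: (en^T *m A x)) /\
  structure_equation A lam x.
Proof.
move=> cpt; have [_ _ cptx] := cpt _ Ux.
pose m := grad_row lam x *m invmx (A x).
have mA : m *m A x = grad_row lam x by rewrite /m mulmxKV.
have E i : (pder i lam x)%:M + (Om i *m X - X *m Om i) =
    N2 *: (A x *m ee i *m m + S *m m^T *m (A x *m ee i)^T *m S).
  by apply/coframe_compatP; exact: cptx.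
clearbody m.
have mX : m *m X = 0.
  suff mXA : m *m X *m A x = 0 by rewrite -[LHS](mulmxK uA) mXA mul0mx.
  apply/rowP => i; rewrite [RHS]mxE.
  have := congr1 (fun B => \tr (X *m B)) (E i); rewrite /=.
  rewrite mulmxDr mulmxBr !mxtraceD mul_mx_scalar mxtraceZ trace_shift mulr0 add0r.
  rewrite [\tr (- _)]linearN /= mulmxA mxtrace_mulC addrN -scalemxAr mxtraceZ mulmxDr mxtraceD.
  set u := A x *m ee i.
  have -> : \tr (X *m (u *m m)) = (m *m X *m A x) 0 i.
    rewrite mulmxA mxtrace_mulC /u !mulmxA -colE.
    by rewrite trace_mx11 mxE.
  have -> : \tr (X *m (S *m m^T *m u^T *m S)) = (m *m X *m A x) 0 i.
    rewrite mulmxA mxtrace_mulC !mulmxA -(mulmxA S X S).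
    have -> : S *m (X *m S) = X^T by rewrite mulmxA -shift_antidiag -mulmxA antidiagK mulmx1.
    rewrite mxtrace_mulC -mxtrace_tr !trmx_mul !trmxK /u !mulmxA -colE.
    by rewrite trace_mx11 mxE.
  move/esym/eqP; rewrite mulf_eq0 => /orP[/eqP N0|/eqP]; last by move=> E0; lra.
  have : N2 != 0 by rewrite mulf_neq0 ?invr_eq0 ?pnatr_eq0.
  by rewrite N0 eqxx.
have mE : m = m 0 ord_max *: en^T.
  apply/rowP => j; rewrite trmx_delta !mxE eqxx /=; have [->|jN] := eqVneq j ord_max.
    by rewrite mulr1.
  have Hj := ltn_ord j.
  have jn : (j < n)%N.
    rewrite ltn_neqAle -ltnS Hj andbT; apply: contra jN => /eqP jn.
    exact/eqP/val_inj.
  rewrite mulr0; have := congr1 (fun B : 'rV[R]_N => B 0 (inord j.+1)) mX.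
  by rewrite /= shift_mulr mxE inordK //= inord_val.
set mu := m 0 ord_max in mE.
have gradE : grad_row lam x = mu *: (en^T *m A x).
  by rewrite scalemxAl -mE.
have dlamE i : pder i lam x = mu * (A x *m ee i) ord_max 0.
  have := congr1 (fun B : 'rV[R]_N => B 0 i) gradE.
  rewrite /= mxE => ->; rewrite mxE; congr (_ * _).
  by rewrite trmx_delta -rowE mxE -colE mxE.
split; first by exists mu.
have OmE i : Om i = mu *: block_connection (A x *m ee i).
  apply/eqP; rewrite -subr_eq0; apply/eqP; apply: skew_comm_shift.
    rewrite linearB /= mulmxBl mulmxBr addrACA frame_connection_skew add0r.
    rewrite -opprD linearZ /= -scalemxAl -scalemxAr -scalerDr.
    by rewrite block_connection_skew scaler0 oppr0.
  have := E i; rewrite mE dlamE.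
  move: (A x *m ee i) (Om i) => u O Eu.
  have {Eu} : O *m X - X *m O = mu *: (N2 *: (u *m en^T + e0 *m u^T *m S)
      - u ord_max 0 *: 1%:M).
    move/(canRL (addKr _)): Eu => ->.
    rewrite [(mu *: _)^T]linearZ /= trmxK.
    rewrite -!scalemxAr -!scalemxAl antidiag_en.
    move: (u *m _) (e0 *m _ *m S) => P Q; apply/matrixP => a b; rewrite !mxE.
    by case: (a == b); rewrite ?mulr1n ?mulr0n; ring.
  rewrite -block_connection_comm mulmxBl mulmxBr -scalemxAl -scalemxAr => Eu.
  rewrite scalerBr in Eu; move/(canRL (subrK _)): Eu => ->.
  by rewrite addrAC [_ - _ in X in X - _]addrC addrK addrC.
move=> i j.
have tor := christoffel_torsion oU Ux coframe_gsym ug i j.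
have : A x *m (christoffel g x i *m ee j) = A x *m (christoffel g x j *m ee i).
  by rewrite tor.
rewrite (mulmxA _ (christoffel g x i)) (mulmxA _ (christoffel g x j)).
rewrite !frame_connectionE !OmE !dlamE.
rewrite ![(_ + _) *m _]mulmxDl -!(scalemxAl mu).
rewrite -!(mulmxA (block_connection _)).
move: (A x *m ee i) (A x *m ee j) => u v.
rewrite -!scalerA -scalerBr -[v ord_max 0 *: u - _]opprB scalerN mulmxN -scalemxAr.
rewrite -block_connection_torsion.
move: (block_connection u *m v) (block_connection v *m u) => P Q.
move: (pder_mx i A x *m ee j) (pder_mx j A x *m ee i) => B C H.
apply/matrixP => a b.
have := congr1 (fun D : 'cV[R]_N => D a b) H; rewrite /= !mxE => {}H.
by lra.
Qed.

(** Conversely, by the structure equation the connection whose matrix is [mu]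
    times [block_connection] is torsion-free; as it is metric, it is the
    Levi-Civita connection. *)
Lemma structure_compatible (mu : R) :
  grad_row lam x = mu *: (en^T *m A x) -> structure_equation A lam x ->
  forall u : 'cV[R]_N, cov_der g L x u =
    2%:R^-1 *: (u *m dtr L x + gadjoint (g x) (u *m dtr L x)).
Proof.
move=> gradE str; apply: compat_linear => i; apply/coframe_compatP.
have dlamE j : pder j lam x = mu * (A x *m ee j) ord_max 0.
  have := congr1 (fun B : 'rV[R]_N => B 0 j) gradE.
  rewrite /= mxE => ->; rewrite mxE; congr (_ * _).
  by rewrite trmx_delta -rowE mxE -colE mxE.
pose O j := mu *: block_connection (A x *m ee j).
pose C j := invmx (A x) *m (pder_mx j A x + O j *m A x).
have AC j : A x *m C j = pder_mx j A x + O j *m A x by rewrite mulKVmx.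
clearbody C.
have chE j : christoffel g x j = C j.
  apply: (christoffel_unique Ux coframe_gsym ug) => {}j.
    apply/(metric_skewP (AC j)); rewrite linearZ /= -scalemxAl -scalemxAr -scalerDr.
    by rewrite block_connection_skew scaler0.
  move=> k; apply: (can_inj (mulKmx uA)); 
  rewrite (mulmxA _ (C j)) (mulmxA _ (C k)) !AC.
  have := str j k; rewrite !dlamE.
  rewrite ![(_ + _) *m _]mulmxDl /O -!(scalemxAl mu) -!(mulmxA (block_connection _)).
  move: (A x *m ee j) (A x *m ee k) => u v.
  rewrite -!scalerA -scalerBr -[v ord_max 0 *: u - _]opprB scalerN mulmxN -scalemxAr.
  rewrite -block_connection_torsion.
  move: (block_connection u *m v) (block_connection v *m u) => P Q.
  move: (pder_mx j A x *m ee k) (pder_mx k A x *m ee j) => B D H.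
  apply/matrixP => a b.
  have := congr1 (fun D : 'cV[R]_N => D a b) H; rewrite /= !mxE => {}H.
  by lra.
have OmE : Om i = O i.
  by rewrite /frame_connection chE AC addrC addKr mulmxK.
have mE : grad_row lam x *m invmx (A x) = mu *: en^T by rewrite gradE -scalemxAl mulmxK.
rewrite OmE dlamE mE /O.
rewrite -scalemxAl -scalemxAr -scalerBr block_connection_comm [(mu *: _)^T]linearZ /= trmxK.
rewrite -!scalemxAr -!scalemxAl antidiag_en.
move: (A x *m ee i) => u.
move: (u *m _) (e0 *m _ *m S) => P Q; apply/matrixP => a b; rewrite !mxE.
by case: (a == b); rewrite ?mulr1n ?mulr0n; ring.
Qed.

End Coframe.

(** * The normal form and the converse statement *)

Section NormalFormCoframe.
Variables (R : realType) (n : nat).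
Local Notation N := n.+1.
Local Notation S := (antidiag R n).
Local Notation X := (shift_mx R n).
Local Notation en := (delta_mx ord_max 0 : 'cV[R]_n.+1).
Local Notation ee i := (delta_mx i 0 : 'cV[R]_n.+1).
Implicit Types (lam : 'rV[R]_N -> R) (x : 'rV[R]_N).

Definition raising_mx : 'M[R]_N := grading n 0 *m X^T.

Lemma raising_mx_col (v : 'cV[R]_N) i :
  (raising_mx *m v) i 0 = i%:R * v (inord i.-1) 0.
Proof.
rewrite /raising_mx -mulmxA mul_diag_mx mxE shiftT_mull mxE subr0.
by case: ifP => // /negbT; rewrite -eqn0Ngt => /eqP ->; rewrite mul0r mul0r.
Qed.

(** The coframe [d x_k + k x_(k-1) d lam]. *)
Definition potential_coframe lam x : 'M[R]_N :=
  1%:M + raising_mx *m x^T *m grad_row lam x.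

(** The exterior derivative of [k x_(k-1) d lam] is [k d x_(k-1) /\ d lam], and
    replacing [d x_(k-1)] by the form [k - 1] of the coframe only adds a
    multiple of [d lam /\ d lam]. *)
Lemma potential_coframe_structure (U : set 'rV[R]_N) lam x :
  open U -> U x -> smooth_on U lam ->
  structure_equation (potential_coframe lam) lam x.
Proof.
move=> oU Ux sl i j.
pose hess k : 'rV[R]_N := pder_mx k (grad_row lam) x.
have dgr : diff_mx (grad_row lam) x.
  move=> a b; rewrite (_ : (fun y => _) = pder b lam).
    exact: (sl [:: b]).
  by apply/funext => y; rewrite mxE.
have dx : diff_mx (fun y : 'rV[R]_N => y^T) x.
  apply: diff_mxT => a b; rewrite (ord1 a); exact: differentiable_coord.
have P k : pder_mx k (potential_coframe lam) x =
    raising_mx *m (ee k *m grad_row lam x + x^T *m hess k).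
  have -> : pder_mx k (potential_coframe lam) x =
     pder_mx k (fun y => raising_mx *m (y^T *m grad_row lam y)) x.
    apply/matrixP => a b; rewrite !mxE.
    rewrite (_ : (fun y => _) = fun y => (1%:M : 'M[R]_N) a b +
       (raising_mx *m (y^T *m grad_row lam y)) a b); last first.
      by apply/funext => y; rewrite mxE mulmxA.
    rewrite pderD; first by rewrite pder_cst add0r.
      exact: differentiable_cst.
    by apply: diff_mxM; [exact: diff_mx_cst|exact: diff_mxM].
  rewrite pder_mxM; [|exact: diff_mx_cst|exact: diff_mxM].
  rewrite pder_mx_cst mul0mx add0r pder_mxM // pder_mxT.
  congr (_ *m (_ *m _ + _)); apply/matrixP => a b; rewrite !mxE !ord1.
  by rewrite pder_coord eqxx andbT eq_sym.
have G k : grad_row lam x *m ee k = (pder k lam x)%:M.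
  by apply/matrixP => a b; rewrite !ord1 -colE !mxE mulr1n.
have hessE k l : hess k 0 l = pder k (pder l lam) x.
  by rewrite /hess mxE; congr (pder k _ x); apply/funext => y; rewrite mxE.
clearbody hess.
have Hs : hess i *m ee j = hess j *m ee i.
  apply/matrixP => a b; rewrite !ord1 -!colE.
  by rewrite [LHS]mxE [RHS]mxE !hessE; exact: (pder_swap i j oU sl Ux).
rewrite !P /potential_coframe -/raising_mx; move: raising_mx => D.
rewrite -!mulmxA -mulmxBr; congr (_ *m _).
have Gi := G i; have Gj := G j; move: Hs Gi Gj.
move: (grad_row lam x) (hess i) (hess j) (pder i lam x) (pder j lam x).
move=> gr hi hj a b Hs Gi Gj.
rewrite !mulmxDl -!mulmxA Hs Gi Gj !mul1mx !mul_mx_scalar.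
rewrite !scalerDr -!scalemxAr !scalerA [b * a]mulrC.
move: (x^T *m _) (D *m _) => Y Z.
by apply/matrixP => k l; rewrite !mxE; ring.
Qed.

Lemma smooth_grad_row (U : set 'rV[R]_N) lam : open U ->
  smooth_on U lam -> smooth_mx_on U (grad_row lam).
Proof.
move=> oU sl i j; apply: (smooth_ext oU _ (smooth_pder j sl)) => x _.
by rewrite mxE.
Qed.

Lemma smooth_potential_coframe (U : set 'rV[R]_N) lam : open U ->
  smooth_on U lam -> smooth_mx_on U (potential_coframe lam).
Proof.
move=> oU sl; apply: (smooth_mxD oU (smooth_mx_cst _)).
apply: smooth_mxM => //; last exact: smooth_grad_row.
apply: smooth_mxM => //; first exact: smooth_mx_cst.
by move=> i j; apply: (smooth_ext oU _ (smooth_coord i)) => x _; rewrite !ord1 mxE.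
Qed.

Variable ell : R -> R.

Definition last_slope x : R := 1 + n%:R * derive1 ell (xc x n.+1) * xc x n.

Definition nf_column x : 'cV[R]_N := derive1 ell (xc x n.+1) *: (raising_mx *m x^T).

(** This is [potential_coframe] for the function [ell] of the last coordinate,
    written so that it makes sense even where [ell] is not differentiable. *)
Definition nf_coframe x : 'M[R]_N := 1%:M + nf_column x *m en^T.

Lemma xc_last x : xc x n.+1 = x 0 ord_max.
Proof. by rewrite /xc /=; congr (x 0 _); apply/val_inj; rewrite /= inordK. Qed.

Lemma nf_columnE x i : nf_column x i 0 = i%:R * derive1 ell (xc x n.+1) * xc x i.
Proof. by rewrite mxE raising_mx_col mxE /xc; ring. Qed.

Lemma nf_column0 x : nf_column x ord0 0 = 0.
Proof. by rewrite nf_columnE !mul0r. Qed.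

Lemma en_nf_column x : 1 + (en^T *m nf_column x) 0 0 = last_slope x.
Proof. by rewrite trmx_delta -rowE mxE nf_columnE /last_slope. Qed.

Lemma en_nf_coframe x : en^T *m nf_coframe x = last_slope x *: en^T.
Proof.
rewrite mulmxDr mulmx1 mulmxA [en^T *m _]mx11_scalar mul_scalar_mx -en_nf_column.
by rewrite scalerDl scale1r.
Qed.

(** A rank one perturbation of the identity has an explicit inverse. *)
Lemma nf_coframe_unit x : (nf_coframe x \in unitmx) = (last_slope x != 0).
Proof.
apply/idP/idP => [uT|s0].
  apply: contraTneq uT => s0; apply/negP => uT.
  have := mulmxK uT en^T; rewrite en_nf_coframe s0 scale0r mul0mx.
  move/(congr1 (fun A : 'rV[R]_N => A 0 ord_max)); rewrite !mxE !eqxx /= => /eqP.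
  by rewrite eq_sym oner_eq0.
suff [] : nf_coframe x \in unitmx /\
    1%:M - (last_slope x)^-1 *: (nf_column x *m en^T) \in unitmx by [].
apply: mulmx1_unit; rewrite mulmxBr mulmx1 -scalemxAr.
have -> : nf_coframe x *m (nf_column x *m en^T) = last_slope x *: (nf_column x *m en^T).
  rewrite mulmxDl mul1mx -mulmxA (mulmxA en^T) [en^T *m nf_column x]mx11_scalar.
  by rewrite mul_scalar_mx -scalemxAr -en_nf_column scalerDl scale1r.
by rewrite scalerA mulVf // scale1r /nf_coframe addrK.
Qed.

Lemma nf_metricE eps x :
  nf_metric eps ell x = eps *: ((nf_coframe x)^T *m S *m nf_coframe x).
Proof.
congr (_ *: _); set c := nf_column x.
have -> : (nf_coframe x)^T *m S *m nf_coframe x =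
    S + S *m c *m en^T + en *m (S *m c)^T + en *m (c^T *m S *m c) *m en^T.
  rewrite /nf_coframe -/c [(_ + _)^T]linearD /= tr_scalar_mx trmx_mul trmxK.
  rewrite mulmxDl mul1mx mulmxDr mulmx1 mulmxDl trmx_mul antidiagT !mulmxA.
  by rewrite !addrA; congr (_ + _); rewrite addrAC.
apply/matrixP => i j; have Hi := ltn_ord i; have Hj := ltn_ord j.
rewrite [LHS]mxE [RHS]mxE [X in _ = X + _]mxE [X in _ = X + _ + _]mxE.
have E1 : (S *m c *m en^T) i j = (j == ord_max)%:R * c (rev_ord i) 0.
  by rewrite mxE big_ord1 antidiag_mull !mxE eqxx andbT mulrC.
have E2 : (en *m (S *m c)^T) i j = (i == ord_max)%:R * c (rev_ord j) 0.
  by rewrite mxE big_ord1 mxE eqxx andbT mxE antidiag_mull.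
have E3 : (en *m (c^T *m S *m c) *m en^T) i j =
    (i == ord_max)%:R * (j == ord_max)%:R * \sum_k c (rev_ord k) 0 * c k 0.
  rewrite mxE big_ord1 mxE big_ord1 !mxE !eqxx !andbT mulrAC; congr (_ * _).
  by apply: eq_bigr => k _; rewrite antidiag_mulr mxE.
rewrite E1 E2 E3 [S i j]mxE -!val_eqE /= !ltnS eqSS.
have [n0|n0] := posnP n.
  have -> : nat_of_ord i = 0%N by lia.
  have -> : nat_of_ord j = 0%N by lia.
  have c0 (l : 'I_N) : c l 0 = 0.
    have -> : l = ord0 by apply/val_inj => /=; have := ltn_ord l; lia.
    exact: nf_column0.
  have z : (0%N == n) = true by rewrite n0.
  have -> : \sum_(k < N) c (rev_ord k) 0 * c k 0 = 0.
    by apply: big1 => k _; rewrite !c0 mulr0.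
  by rewrite addn0 z !c0 !mulr0 !addr0.
have ca (l : 'I_N) : c l 0 = acoef ell x l - (l == n :> nat)%:R.
  rewrite /c nf_columnE /acoef; ring.
case: (ltnP i n) => Hin; case: (ltnP j n) => Hjn /=.
- rewrite (ltn_eqF Hin) (ltn_eqF Hjn) !mul0r !addr0; congr (_%:R); lia.
- have -> : nat_of_ord j = n by lia.
  rewrite eqxx (ltn_eqF Hin) !mul0r !mul1r !addr0 ca /= subSS.
  have -> : (i + n == n)%N = (n - i == n)%N by lia.
  by rewrite addrC subrK.
- have -> : nat_of_ord i = n by lia.
  rewrite eqxx (ltn_eqF Hjn) !mulr0 !mul0r !mul1r !addr0 ca /= subSS.
  have -> : (n + j == n)%N = (n - j == n)%N by lia.
  by rewrite addrC subrK.
- have -> : nat_of_ord i = n by lia.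
  have -> : nat_of_ord j = n by lia.
  rewrite eqxx !mul1r (_ : (n + n == n)%N = false) ?add0r; last by lia.
  have -> : rev_ord j = ord0 by apply/val_inj => /=; lia.
  have -> : rev_ord i = ord0 by apply/val_inj => /=; lia.
  rewrite {1 2}/c !nf_column0 !addr0 !add0r.
  pose f k := c (rev_ord (inord k : 'I_N)) 0 * c (inord k) 0.
  transitivity (\sum_(0 <= k < N) f k); last first.
    by rewrite big_mkord; apply: eq_bigr => k _; rewrite /f inord_val.
  rewrite [RHS]big_ltn // [X in _ = _ + X]big_nat_recr //=.
  have c00 : c ord0 0 = 0 by exact: nf_column0.
  have f0 : f 0%N = 0.
    rewrite /f; have -> : inord 0 = ord0 :> 'I_N by apply/val_inj; rewrite /= inordK.
    by rewrite c00 mulr0.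
  have fn : f n = 0.
    rewrite /f; have -> : rev_ord (inord n : 'I_N) = ord0.
      by apply/val_inj; rewrite /= inordK ?subnn.
    by rewrite c00 mul0r.
  rewrite f0 fn add0r addr0; apply: eq_big_nat => k /andP[k0 kn].
  rewrite /f !ca inordK; last by lia.
  rewrite /= inordK; last by lia.
  rewrite (ltn_eqF kn) subr0 subSS (_ : (n - k == n)%N = false); last by lia.
  by rewrite subr0 mulrC subSn ?subn1 // ltnW.
Qed.

Lemma nf_endoE x :
  nf_endo ell x = (ell (xc x n.+1))%:M + X *m nf_coframe x.
Proof.
apply/matrixP => i j; have Hi := ltn_ord i; have Hj := ltn_ord j.
rewrite [LHS]mxE [RHS]mxE [X in _ = X + _]mxE mulmxDr mulmx1 mulmxA [X in _ = _ + X]mxE.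
rewrite [X i j]mxE.
have -> : (X *m nf_column x *m en^T) i j =
    (j == ord_max)%:R * (if (i < n)%N then acoef ell x i.+1 - (i.+1 == n)%:R else 0).
  rewrite mxE big_ord1 shift_mull [(en^T) _ _]mxE [en _ _]mxE eqxx andbT mulrC.
  congr (_ * _).
  case: ifP => // H; rewrite nf_columnE /acoef inordK //; ring.
rewrite -!val_eqE /= !eqSS.
have [->|ij] := eqVneq (i : nat) j.
  rewrite mulr1n (_ : (j.+1 == j)%N = false) ?add0r; last by lia.
  case: ltnP => [jn|_]; last by rewrite mulr0 addr0.
  by rewrite (ltn_eqF jn) mul0r addr0.
rewrite mulr0n add0r; have [jn|jn] := eqVneq (j : nat) n.
  have -> : (i < n)%N by lia.
  by rewrite mul1r jn addrC subrK.
by rewrite mul0r addr0.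
Qed.

Lemma nf_endo_coframe x :
  nf_coframe x *m nf_endo ell x = jordan_block N (ell (xc x n.+1)) *m nf_coframe x.
Proof.
rewrite nf_endoE jordan_blockE mulmxDr [RHS]mulmxDl mul_mx_scalar.
rewrite mul_scalar_mx; congr (_ + _); rewrite mulmxA; congr (_ *m _).
by rewrite mulmxDl mul1mx -mulmxA en_shift mulmx0 addr0.
Qed.

Lemma grad_row_last x : derivable ell (xc x N) 1 ->
  differentiable (fun y : 'rV[R]_N => ell (xc y N)) x /\
  forall i, pder i (fun y : 'rV[R]_N => ell (xc y N)) x =
    (i == ord_max)%:R * derive1 ell (xc x N).
Proof.
move=> dl.
have lastE : (fun y : 'rV[R]_N => ell (xc y N)) = ell \o (fun y : 'rV[R]_N => y 0 ord_max).
  by apply/funext => y; rewrite /= xc_last.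
have dc : differentiable (fun y : 'rV[R]_N => y 0 ord_max : R) x.
  exact: differentiable_coord.
have de : differentiable ell (x 0 ord_max : R).
  by apply/derivable1_diffP; rewrite -xc_last.
rewrite lastE; split=> [|i]; first exact: differentiable_comp.
rewrite /pder deriveE; last exact: differentiable_comp.
rewrite (diff_comp dc de) /= -(deriveE _ dc) -/(pder i _ x) pder_coord.
by rewrite diff1E // xc_last.
Qed.

End NormalFormCoframe.

Lemma jordan_unit (R : realType) n (lam : R) : lam != 0 ->
  jordan_block n.+1 lam \in unitmx.
Proof.
move=> lam0; rewrite unitmxE -det_tr det_trig.
  by rewrite unitfE; apply/prodf_neq0 => i _; rewrite !mxE eqxx.
apply/is_trig_mxP => i j ij; rewrite !mxE.
by rewrite -val_eqE /= !gtn_eqF // ltnW.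
Qed.

Section Converse.
Variables (R : realType) (n : nat) (J : set R) (lam : R -> R) (eps : R).
Hypotheses (oJ : open J) (slam : smooth1_on J lam).
Hypotheses (lam0 : forall t, J t -> lam t != 0) (eps1 : eps = 1 \/ eps = -1).
Local Notation N := n.+1.
Local Notation en := (delta_mx ord_max 0 : 'cV[R]_n.+1).
Local Notation V := [set x : 'rV[R]_N | J (xc x N)].
Local Notation lamN := (fun x : 'rV[R]_N => lam (xc x N)).

Lemma open_last_coord : open V.
Proof.
rewrite (_ : V = (fun x : 'rV[R]_N => x 0 ord_max : R) @^-1` J); last first.
  by apply/seteqP; split=> x /=; rewrite xc_last.
by apply: open_comp => // x _; exact: coord_continuous.
Qed.

Lemma smooth_last_coord k : smooth_on V (fun x : 'rV[R]_N => derive1n k lam (xc x N)).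
Proof.
apply/smooth_onP => l; elim: l k => [|l IHl] k.
  by split=> // x Vx; have [] := grad_row_last (@slam k _ Vx).
split=> [x Vx|i]; first by have [] := grad_row_last (@slam k _ Vx).
apply: (Ck_ext open_last_coord _ (Ck_mul open_last_coord
  (Ck_cst _ _ (i == ord_max)%:R) (IHl k.+1))) => x /set_mem Vx.
by have [_ ->] := grad_row_last (@slam k _ Vx); rewrite derive1nS.
Qed.

Lemma grad_row_lastE x : V x -> grad_row lamN x = derive1 lam (xc x N) *: en^T.
Proof.
move=> Vx; apply/rowP => j; rewrite trmx_delta !mxE eqxx /=.
by have [_ ->] := grad_row_last (@slam 0%N _ Vx); rewrite mulrC.
Qed.

Lemma nf_coframe_potential x : V x -> nf_coframe lam x = potential_coframe lamN x.
Proof.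
move=> Vx; rewrite /nf_coframe /potential_coframe grad_row_lastE //.
by rewrite /nf_column -scalemxAl -scalemxAr.
Qed.

Lemma nf_metric_unit (x : 'rV[R]_N) : nf_metric eps lam x \in unitmx <->
  1 + n%:R * derive1 lam (xc x n.+1) * xc x n != 0.
Proof.
have e0 : eps \is a GRing.unit.
  by rewrite unitfE; case: eps1 => ->; rewrite ?oppr_eq0 oner_eq0.
rewrite nf_metricE unitmxZ // !unitmx_mul unitmx_tr antidiag_unit andbT andbb.
by rewrite nf_coframe_unit.
Qed.

Local Notation U := [set x : 'rV[R]_N | V x /\ nf_metric eps lam x \in unitmx].

Lemma smooth_nf_coframe : smooth_mx_on V (nf_coframe lam).
Proof.
apply: (smooth_mx_ext open_last_coord (A := potential_coframe lamN)).
  by move=> x /set_mem Vx; rewrite nf_coframe_potential.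
apply: smooth_potential_coframe; first exact: open_last_coord.
exact: (smooth_last_coord 0).
Qed.

Lemma open_nondegenerate : open U.
Proof.
have sdet : smooth_on V (fun x => \det (nf_coframe lam x)).
  exact: (smooth_det open_last_coord smooth_nf_coframe).
rewrite openE => x [Vx ux]; rewrite /interior.
have uT (y : 'rV[R]_N) : nf_metric eps lam y \in unitmx <-> \det (nf_coframe lam y) != 0.
  apply: (iff_trans (nf_metric_unit y)).
  by rewrite -/(last_slope lam y) -nf_coframe_unit unitmxE unitfE.
have d0 : 0 < `|\det (nf_coframe lam x)| by rewrite normr_gt0; exact/uT.
have cd : {for x, continuous (fun y => \det (nf_coframe lam y))}.
  by apply: differentiable_continuous; exact: (smooth_diff sdet Vx).
have nd : \forall y \near x,
    `|\det (nf_coframe lam x) - \det (nf_coframe lam y)| < `|\det (nf_coframe lam x)|.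
  by move/cvgrPdist_lt : cd; apply.
have nV : \forall y \near x, V y.
  exact: open_nbhs_nbhs (conj open_last_coord Vx).
apply: filterS2 nV nd => y Vy dy; split=> //; apply/uT.
by apply: contraTneq dy => ->; rewrite subr0 ltxx.
Qed.

Lemma nf_adapted : adapted_coframe U (nf_metric eps lam) (nf_endo lam) (nf_coframe lam)
  lamN eps.
Proof.
split.
- by apply: smooth_mx_sub smooth_nf_coframe => x [].
- by apply: smooth_sub (smooth_last_coord 0) => x [].
- by case: eps1 => ->; rewrite ?mulrNN mulr1.
move=> x [Vx ux]; split; [|exact: nf_metricE|exact: nf_endo_coframe].
by rewrite nf_coframe_unit; exact/nf_metric_unit.
Qed.

Lemma smooth_nf_endo : smooth_mx_on V (nf_endo lam).
Proof.
have sl := smooth_last_coord 0.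
apply: (smooth_mx_ext open_last_coord
  (A := fun x => lamN x *: 1%:M + shift_mx R n *m nf_coframe lam x)).
  by move=> x _; rewrite nf_endoE scalemx1.
apply: (smooth_mxD open_last_coord).
  by apply: (smooth_mxZ open_last_coord sl); exact: smooth_mx_cst.
by apply: (smooth_mxM open_last_coord) smooth_nf_coframe; exact: smooth_mx_cst.
Qed.

Lemma nf_compatible :
  [/\ open U, pseudo_metric_on U (nf_metric eps lam),
      smooth_mx_on U (nf_endo lam)
    & compatible_on U (nf_metric eps lam) (nf_endo lam)].
Proof.
have oU := open_nondegenerate; have ad := nf_adapted.
have UV : U `<=` V by move=> x [].
split=> //.
- split=> [|x [Vx ux]]; last first.
    split=> //; exact: (coframe_gsym ad (conj Vx ux)).
  apply: (smooth_mx_sub UV).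
  apply: (smooth_mx_ext open_last_coord (A := fun x =>
    eps *: ((nf_coframe lam x)^T *m antidiag R n *m nf_coframe lam x))).
    by move=> x _; rewrite nf_metricE.
  apply: (smooth_mxZ open_last_coord (@smooth_cst R N V eps)).
  apply: (smooth_mxM open_last_coord) smooth_nf_coframe.
  apply: (smooth_mxM open_last_coord (smooth_mxT open_last_coord smooth_nf_coframe)).
  exact: smooth_mx_cst.
- exact: (smooth_mx_sub UV smooth_nf_endo).
move=> x Ux; have [Vx ux] := Ux; split.
- exact: (coframe_selfadjoint ad Ux).
- have uT := coframe_unit ad Ux; rewrite (coframe_L ad Ux).
  by rewrite !unitmx_mul unitmx_inv uT /= andbT jordan_unit ?lam0.
have sE : structure_equation (nf_coframe lam) lamN x.
  have str := potential_coframe_structure open_last_coord Vx (smooth_last_coord 0).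
  move=> i j; have := str i j.
  have Ep k : pder_mx k (potential_coframe lamN) x = pder_mx k (nf_coframe lam) x.
    apply: (pder_mx_ext _ open_last_coord Vx) => y /set_mem Vy.
    by rewrite nf_coframe_potential.
  by rewrite !Ep nf_coframe_potential.
pose mu := derive1 lam (xc x N) / last_slope lam x.
apply: (structure_compatible oU ad Ux (mu := mu)) => //.
rewrite grad_row_lastE // en_nf_coframe scalerA /mu divfK //.
by apply/nf_metric_unit.
Qed.

End Converse.

(** * The canonical frame of a selfadjoint Jordan block *)

Section SmoothSqrt.
Variables (R : realType) (n : nat) (U : set 'rV[R]_n) (f : 'rV[R]_n -> R).
Hypotheses (oU : open U) (f0 : forall x, U x -> 0 < f x).

Lemma differentiable_sqrt x : U x -> differentiable f x ->
  differentiable (fun y => Num.sqrt (f y)) x.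
Proof.
move=> Ux df; have [ds Es] := is_derive1_sqrt (f0 Ux).
by apply: (differentiable_comp df); exact/derivable1_diffP.
Qed.

Lemma pder_sqrt x i : U x -> differentiable f x ->
  pder i (fun y => Num.sqrt (f y)) x = (2 * Num.sqrt (f x))^-1 * pder i f x.
Proof.
move=> Ux df; have [ds Es] := is_derive1_sqrt (f0 Ux).
have dS : differentiable (@Num.sqrt R) (f x) by exact/derivable1_diffP.
rewrite /pder deriveE; last exact: (differentiable_comp df dS).
rewrite (diff_comp df dS) /= -(deriveE _ df) -/(pder i _ x).
by rewrite diff1E // derive1E Es /GRing.scale /= mulrC.
Qed.

(** The derivative of a square root is expressed through the square root, whence
    an induction on the order. *)
Lemma smooth_sqrt : smooth_on U f -> smooth_on U (fun x => Num.sqrt (f x)).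
Proof.
move=> /smooth_onP Cf; apply/smooth_onP.
have ds x : U x -> differentiable (fun y => Num.sqrt (f y)) x.
  by move=> Ux; apply: differentiable_sqrt => //; exact: (Ck_diff (Cf 0%N)).
elim=> [|k IHk]; first by split.
split=> // i.
have Cs : Ck k U (fun x => (2 * Num.sqrt (f x))^-1 * pder i f x).
  apply: (Ck_mul oU) (Ck_pder i (Cf k.+1)); apply: Ck_inv => //.
    by move=> x Ux; rewrite mulf_neq0 // gt_eqF // sqrtr_gt0 f0.
  exact: (Ck_mul oU (Ck_cst _ _ _)).
apply: Ck_ext oU _ Cs => x /set_mem Ux.
by rewrite pder_sqrt //; exact: (Ck_diff (Cf 0%N)).
Qed.

End SmoothSqrt.

Section CyclicVector.
Variables (R : realType) (n : nat).
Local Notation N := n.+1.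
Local Notation M := 'M[R]_n.+1.
Local Notation S := (antidiag R n).
Local Notation X0 := (shift_mx R n).

Definition bform (G A : M) (v w : 'cV[R]_N) : R := (v^T *m G *m A *m w) 0 0.

Lemma bformDl G A u v w : bform G A (u + v) w = bform G A u w + bform G A v w.
Proof. by rewrite /bform linearD /= !mulmxDl mxE. Qed.

Lemma bformDr G A u v w : bform G A u (v + w) = bform G A u v + bform G A u w.
Proof. by rewrite /bform mulmxDr mxE. Qed.

Lemma bformZl G A c v w : bform G A (c *: v) w = c * bform G A v w.
Proof. by rewrite /bform linearZ /= -!scalemxAl mxE. Qed.

Lemma bformZr G A c v w : bform G A v (c *: w) = c * bform G A v w.
Proof. by rewrite /bform -scalemxAr mxE. Qed.

Lemma bform0 G v w : bform G 0 v w = 0.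
Proof. by rewrite /bform mulmx0 mul0mx mxE. Qed.

Section Selfadjoint.
Variables (G X : M).
Hypotheses (symG : G^T = G) (saX : G *m X = X^T *m G).

Lemma selfadjoint_exp k : G *m X ^+ k = (X ^+ k)^T *m G.
Proof.
elim: k => [|k IHk]; first by rewrite !expr0 trmx1 mulmx1 mul1mx.
by rewrite {1}exprS -mulmxE mulmxA saX -mulmxA IHk mulmxA -trmx_mul mulmxE -exprSr.
Qed.

Lemma bform_exp (i j k : nat) v w :
  bform G (X ^+ k) (X ^+ i *m v) (X ^+ j *m w) = bform G (X ^+ (i + j + k)) v w.
Proof.
rewrite /bform trmx_mul -(mulmxA v^T) -selfadjoint_exp -!mulmxA.
rewrite (mulmxA (X ^+ k)) (mulmxA (X ^+ i)) !mulmxE -!exprD.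
by rewrite addnCA addnAC addnA [(i + k)%N]addnC.
Qed.

Lemma bform_sym k v w : bform G (X ^+ k) v w = bform G (X ^+ k) w v.
Proof.
have -> : bform G (X ^+ k) v w = (v^T *m G *m X ^+ k *m w)^T 0 0 by rewrite mxE.
rewrite !trmx_mul trmxK symG /bform; congr (_ _ _).
by rewrite mulmxA -!(mulmxA w^T) selfadjoint_exp !mulmxA.
Qed.

(** Polarization of the symmetric form [g (X^k v, w)]. *)
Lemma bform_nonzero k : G \in unitmx -> X ^+ k != 0 ->
  exists v, bform G (X ^+ k) v v != 0.
Proof.
move=> uG Xk; apply: contrapT => none.
have zero v : bform G (X ^+ k) v v = 0.
  by apply: contrapT => /eqP nz; apply: none; exists v.
have zero2 v w : bform G (X ^+ k) v w = 0.
  have := zero (v + w); rewrite bformDl !bformDr !zero add0r addr0.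
  by rewrite [X in _ + X]bform_sym => E; lra.
case/eqP: Xk; apply: (can_inj (mulKmx uG)); rewrite mulmx0.
apply/matrixP => i j; rewrite [RHS]mxE -(zero2 (delta_mx i 0) (delta_mx j 0)).
by rewrite /bform -(mulmxA _ G) trmx_delta -rowE -colE [RHS]mxE [RHS]mxE.
Qed.

Hypothesis nilX : X ^+ N = 0.

Lemma nilpotent_exp k : (n < k)%N -> X ^+ k = 0.
Proof. by move=> nk; rewrite -(subnK nk) exprD nilX mulr0. Qed.

(** One step of the normalization of a cyclic vector [v]: it corrects the
    product of [X ^+ (n - m.+1) v] and [v] without changing those of higher
    order. The equation for [c] is linear since the quadratic term contains a
    power of [X] beyond the [n]-th. *)
Lemma normalize_step eps (m : nat) v (c := - (eps / 2) * bform G (X ^+ (n - m.+1)) v v) :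
  eps * eps = 1 -> (m < n)%N ->
  (forall k, (n - m <= k)%N -> (k <= n)%N ->
     bform G (X ^+ k) v v = eps * (k == n)%:R) ->
  forall k, (n - m.+1 <= k)%N -> (k <= n)%N ->
    bform G (X ^+ k) (v + c *: (X ^+ m.+1 *m v)) (v + c *: (X ^+ m.+1 *m v))
    = eps * (k == n)%:R.
Proof.
move=> eps2 mn IH k k1 k2.
have expand : bform G (X ^+ k) (v + c *: (X ^+ m.+1 *m v)) (v + c *: (X ^+ m.+1 *m v))
   = bform G (X ^+ k) v v + 2 * c * bform G (X ^+ (m.+1 + k)) v v
     + c * c * bform G (X ^+ (m.+1 + m.+1 + k)) v v.
  rewrite bformDl !bformDr !bformZl !bformZr bform_exp.
  have E1 := bform_exp m.+1 0 k v v; have E2 := bform_exp 0 m.+1 k v v.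
  rewrite expr0 mul1mx addn0 in E1; rewrite expr0 mul1mx add0n in E2.
  by rewrite E1 E2; ring.
rewrite expand (nilpotent_exp (k := m.+1 + m.+1 + k)); last by lia.
rewrite bform0 mulr0 addr0.
have [kn|kn] := ltnP (n - m.+1) k.
  by rewrite (nilpotent_exp (k := m.+1 + k)) ?bform0 ?mulr0 ?addr0 ?IH //; lia.
have -> : k = (n - m.+1)%N by lia.
rewrite subnKC // (IH n) ?leq_subr // eqxx (ltn_eqF (_ : (n - m.+1 < n)%N)); last by lia.
rewrite mulr1 mulr0 /c.
have -> : 2 * (- (eps / 2) * bform G (X ^+ (n - m.+1)) v v) * eps =
  - (eps * eps) * bform G (X ^+ (n - m.+1)) v v by field.
by rewrite eps2 mulN1r subrr.
Qed.

Definition cyclic_frame (xi : 'cV[R]_N) : M := \matrix_(i, j) (X ^+ (n - j) *m xi) i 0.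

Lemma cyclic_frame_col xi j : col j (cyclic_frame xi) = X ^+ (n - j) *m xi.
Proof. by apply/colP => i; rewrite !mxE. Qed.

Lemma cyclic_frame_metric eps xi :
  (forall k, (k <= n)%N -> bform G (X ^+ k) xi xi = eps * (k == n)%:R) ->
  (cyclic_frame xi)^T *m G *m cyclic_frame xi = eps *: S.
Proof.
move=> Hxi; apply/matrixP => i j; have Hi := ltn_ord i; have Hj := ltn_ord j.
have -> : ((cyclic_frame xi)^T *m G *m cyclic_frame xi) i j =
    bform G (X ^+ 0) (X ^+ (n - i) *m xi) (X ^+ (n - j) *m xi).
  rewrite /bform expr0 mulmx1 -!cyclic_frame_col !mxE; apply: eq_bigr => k _.
  rewrite [X in _ = _ * X]mxE !mxE; congr (_ * _); apply: eq_bigr => l _.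
  by rewrite !mxE.
rewrite bform_exp addn0 !mxE.
have [le|lt] := leqP (n - i + (n - j)) n.
  by rewrite Hxi //; congr (_ * _%:R); lia.
rewrite nilpotent_exp // bform0 (_ : (i + j == n)%N = false) ?mulr0 //; lia.
Qed.

Lemma cyclic_frame_shift xi : X *m cyclic_frame xi = cyclic_frame xi *m X0.
Proof.
apply/matrixP => i j; have Hj := ltn_ord j; rewrite shift_mulr.
have -> : (X *m cyclic_frame xi) i j = (X ^+ (n - j).+1 *m xi) i 0.
  rewrite exprS -mulmxE -mulmxA -cyclic_frame_col !mxE.
  by apply: eq_bigr => l _; rewrite !mxE.
case: ifP => j0.
  by rewrite [RHS]mxE inordK; [congr ((X ^+ _ *m _) _ _); lia|lia].
by rewrite nilpotent_exp ?mul0mx ?mxE //; lia.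
Qed.

End Selfadjoint.

End CyclicVector.

Section CanonicalCoframe.
Variables (R : realType) (n : nat).
Local Notation N := n.+1.
Variables (W : set 'rV[R]_N) (g L : 'rV[R]_N -> 'M[R]_N) (lam : 'rV[R]_N -> R).
Hypotheses (oW : open W) (sg : smooth_mx_on W g) (sL : smooth_mx_on W L).
Hypotheses (slam : smooth_on W lam).
Hypotheses (symg : forall x, W x -> (g x)^T = g x).
Hypotheses (saL : forall x, W x -> g x *m L x = (L x)^T *m g x).
Local Notation X := (fun x => L x - (lam x)%:M).
Hypotheses (nilX : forall x, W x -> X x ^+ N = 0).

Lemma nilpart_selfadjoint x : W x -> g x *m X x = (X x)^T *m g x.
Proof.
move=> Wx; rewrite [(_ - _)^T]linearB /= tr_scalar_mx mulmxBr mulmxBl (saL Wx).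
by rewrite mul_mx_scalar mul_scalar_mx.
Qed.

Lemma smooth_nilpart_exp k : smooth_mx_on W (fun x => X x ^+ k).
Proof.
have sX : smooth_mx_on W X.
  apply: (smooth_mx_ext oW (A := fun x => L x + (- lam x) *: 1%:M)).
    by move=> x _; rewrite scaleNr scalemx1.
  apply: (smooth_mxD oW sL); apply: (smooth_mxZ oW (smooth_opp oW slam)).
  exact: smooth_mx_cst.
elim: k => [|k IHk].
  exact: (smooth_mx_ext oW (A := fun=> 1%:M)) (smooth_mx_cst _).
apply: (smooth_mx_ext oW (A := fun x => X x *m X x ^+ k)).
  by move=> x _; rewrite exprS mulmxE.
exact: smooth_mxM.
Qed.

Lemma smooth_bform k (v w : 'rV[R]_N -> 'cV[R]_N) (V : set 'rV[R]_N) :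
  open V -> V `<=` W -> smooth_mx_on V v -> smooth_mx_on V w ->
  smooth_on V (fun x => bform (g x) (X x ^+ k) (v x) (w x)).
Proof.
move=> oV VW sv sw.
have H : smooth_mx_on V (fun x => (v x)^T *m g x *m (X x ^+ k) *m w x).
  apply: (smooth_mxM oV _ sw).
  apply: (smooth_mxM oV _ (smooth_mx_sub VW (smooth_nilpart_exp k))).
  exact: (smooth_mxM oV (smooth_mxT oV sv) (smooth_mx_sub VW sg)).
exact: H.
Qed.

(** A vector field [xi] generating the Jordan chain, normalized by
    [g (X^k xi, xi) = 0] for [k < n] and [eps] for [k = n]; the fields
    [X^k xi] form the frame. *)
Lemma exists_adapted_coframe (x0 : 'rV[R]_N) :
  W x0 -> g x0 \in unitmx -> X x0 ^+ n != 0 ->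
  exists (r eps : R) (A : 'rV[R]_N -> 'M[R]_N),
    [/\ 0 < r, ball x0 r `<=` W, eps = 1 \/ eps = -1 &
        adapted_coframe (ball x0 r) g L A lam eps].
Proof.
move=> Wx0 ug0 Xn0.
have [v0 hv0] := bform_nonzero (symg Wx0) (nilpart_selfadjoint Wx0) ug0 Xn0.
pose h x := bform (g x) (X x ^+ n) v0 v0.
have sh : smooth_on W h by apply: smooth_bform => //; exact: smooth_mx_cst.
pose eps : R := Num.sg (h x0).
have eps1 : eps = 1 \/ eps = -1.
  have : (h x0 < 0) || (0 < h x0) by rewrite -neq_lt.
  by case/orP => h0; [right; rewrite /eps ltr0_sg|left; rewrite /eps gtr0_sg].
have eps2 : eps * eps = 1 by case: eps1 => ->; rewrite ?mulrNN mulr1.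
have eh0 : 0 < eps * h x0.
  by rewrite -normrEsg normr_gt0.
have [r r0 [rW hr]] : exists2 r : R, 0 < r &
    ball x0 r `<=` W /\ forall x, ball x0 r x -> 0 < eps * h x.
  have ch : {for x0, continuous (fun x => eps * h x)}.
    apply: differentiable_continuous; apply: differentiableM.
      exact: differentiable_cst.
    exact: (sh [::]).
  have nh : \forall x \near x0, `|eps * h x0 - eps * h x| < eps * h x0.
    by move/cvgrPdist_lt : ch; apply.
  have /nbhs_ballP[r /= r0 Hr] : nbhs x0 [set x | W x /\
      `|eps * h x0 - eps * h x| < eps * h x0].
    by apply: filterS2 (open_nbhs_nbhs (conj oW Wx0)) nh => x; split.
  exists r => //; split=> x /Hr[// _]; rewrite ltr_norml => /andP[_]; lra.
set B := ball x0 r in rW hr *; have oB : open B by exact: ball_open.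
have normalized m : (m <= n)%N -> exists xi : 'rV[R]_N -> 'cV[R]_N,
    smooth_mx_on B xi /\ forall x, B x ->
      forall k, (n - m <= k)%N -> (k <= n)%N ->
        bform (g x) (X x ^+ k) (xi x) (xi x) = eps * (k == n)%:R.
  elim: m => [|m IHm] mn.
    pose w x := (Num.sqrt (eps * h x))^-1.
    have sw : smooth_on B w.
      apply: smooth_inv => // [x Bx|]; first by rewrite gt_eqF // sqrtr_gt0 hr.
      apply: smooth_sqrt => //; apply: smooth_mul => //; first exact: smooth_cst.
      exact: smooth_sub sh.
    exists (fun x => w x *: v0); split.
      by apply: smooth_mxZ => //; exact: smooth_mx_cst.
    move=> x Bx k k1 k2; have -> : k = n by lia.
    rewrite eqxx mulr1 bformZl bformZr -/(h x) mulrA -expr2 /w exprVn.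
    rewrite sqr_sqrtr; last by rewrite ltW // hr.
    have := hr _ Bx; case: eps1 => ->; rewrite ?mul1r ?mulN1r => h1.
      by rewrite mulVf // gt_eqF.
    by rewrite invrN mulNr mulVf // lt_eqF // -oppr_gt0.
  have [xi [sxi Hxi]] := IHm (ltnW mn).
  pose c x := - (eps / 2) * bform (g x) (X x ^+ (n - m.+1)) (xi x) (xi x).
  exists (fun x => xi x + c x *: (X x ^+ m.+1 *m xi x)); split.
    apply: (smooth_mxD oB sxi); apply: (smooth_mxZ oB).
      by apply: (smooth_mul oB (smooth_cst _)); exact: smooth_bform.
    exact: (smooth_mxM oB (smooth_mx_sub rW (smooth_nilpart_exp _)) sxi).
  move=> x Bx; have Wx := rW _ Bx.
  exact: (normalize_step (nilpart_selfadjoint Wx) (nilX Wx) eps2 mn (Hxi x Bx)).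
have [xi [sxi Hxi]] := normalized n (leqnn n).
pose E x := cyclic_frame (X x) (xi x).
have gE x : B x -> (E x)^T *m g x *m E x = eps *: antidiag R n.
  move=> Bx; have Wx := rW _ Bx.
  apply: (cyclic_frame_metric (nilpart_selfadjoint Wx) (nilX Wx)) => k kn.
  by apply: Hxi => //; rewrite subnn.
have uE x : B x -> E x \in unitmx.
  move=> Bx; have : eps *: antidiag R n \in unitmx.
    rewrite unitmxZ ?antidiag_unit // unitfE; case: eps1 => ->;
      by rewrite ?oppr_eq0 oner_eq0.
  by rewrite -(gE x Bx) !unitmx_mul => /andP[].
have sE : smooth_mx_on B E.
  move=> i j.
  have H := smooth_mxM oB (smooth_mx_sub rW (smooth_nilpart_exp (n - j))) sxi.
  by apply: (smooth_ext oB _ (H i 0)) => x _; rewrite [RHS]mxE.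
exists r, eps, (fun x => invmx (E x)); split=> //; split=> //.
- exact: smooth_invmx.
- exact: smooth_sub slam.
move=> x Bx; have Wx := rW _ Bx; have ux := uE x Bx; split.
- by rewrite unitmx_inv.
- rewrite scalemxAl scalemxAr -(gE x Bx) trmx_inv.
  by rewrite -!mulmxA mulmxV // mulmx1 mulKmx ?unitmx_tr.
apply: (can_inj (mulKmx ux)); rewrite mulKVmx //; apply: (can_inj (mulmxK ux)).
rewrite mulmxA mulmxKV //.
have -> : L x = (lam x)%:M + X x by rewrite addrC subrK.
rewrite mulmxDl jordan_blockE mulmxDr mul_mx_scalar mul_scalar_mx; congr (_ + _).
exact: (cyclic_frame_shift (nilX Wx)).
Qed.

End CanonicalCoframe.

(** * Integration of the structure equation *)

Section Coordinates.
Variables (R : realType) (n : nat).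
Local Notation N := n.+1.
Local Notation en := (delta_mx ord_max 0 : 'cV[R]_n.+1).
Local Notation ee i := (delta_mx i 0 : 'cV[R]_n.+1).

Lemma structure_equation_entry A lam (x : 'rV[R]_N) (k i j : 'I_N) :
  structure_equation A lam x ->
  pder i (fun y => A y k j) x - pder j (fun y => A y k i) x =
  k%:R * (pder j lam x * A x (inord k.-1) i - pder i lam x * A x (inord k.-1) j).
Proof.
move=> /(_ i j)/(congr1 (fun B : 'cV[R]_N => B k 0)) /=.
by rewrite raising_mx_col -!colE !mxE.
Qed.

(** Row [k] of the structure equation says that [theta^k - k x_(k-1) d lam] is
    closed as soon as [d x_(k-1)] has the required value. *)
Lemma integrate_coframe A lam (x0 : 'rV[R]_N) (r : R) : 0 < r ->
  smooth_mx_on (ball x0 r) A -> smooth_on (ball x0 r) lam ->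
  (forall x, ball x0 r x -> structure_equation A lam x) ->
  exists2 r' : R, 0 < r' & ball x0 r' `<=` ball x0 r /\
    exists phi : 'rV[R]_N -> 'rV[R]_N,
    [/\ smooth_mx_on (ball x0 r') phi, phi x0 = 0 &
        forall x, ball x0 r' x ->
          A x = Jmx phi x + raising_mx R n *m (phi x)^T *m grad_row lam x].
Proof.
move=> r0 sA slam str.
have step m : (m <= N)%N -> exists2 r' : R, 0 < r' & ball x0 r' `<=` ball x0 r /\
    exists f : nat -> 'rV[R]_N -> R,
    (forall k, smooth_on (ball x0 r') (f k) /\ f k x0 = 0) /\
    forall k x i, (k < m)%N -> ball x0 r' x ->
      pder i (f k) x = A x (inord k) i - k%:R * f k.-1 x * pder i lam x.
  elim: m => [_|m IHm mN].
    exists r => //; split=> //; exists (fun _ _ => 0); split=> // k.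
    by split=> //; exact: smooth_cst.
  have [r1 r10 [r1r [f [sf Hf]]]] := IHm (ltnW mN).
  have ob : open (ball x0 r1) by exact: ball_open.
  have bx0 : ball x0 r1 x0 by apply/mem_ballP; rewrite subrr normr0.
  pose w i x := A x (inord m) i + - (m%:R * f m.-1 x * pder i lam x).
  have sl i : smooth_on (ball x0 r1) (pder i lam).
    by apply: smooth_pder; exact: smooth_sub slam.
  have sA1 k i : smooth_on (ball x0 r1) (fun x => A x k i).
    exact: smooth_sub (sA k i).
  have sw i : smooth_on (ball x0 r1) (w i).
    apply: (smooth_add ob (sA1 _ _)); apply: (smooth_opp ob).
    apply: (smooth_mul ob _ (sl i)); apply: (smooth_mul ob (smooth_cst _)).
    by have [] := sf m.-1.
  have pw x i j : ball x0 r1 x -> pder i (w j) x = pder i (fun y => A y (inord m) j) x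
      - m%:R * (f m.-1 x * pder i (pder j lam) x + pder i (f m.-1) x * pder j lam x).
    move=> xr; have df : differentiable (f m.-1) x := smooth_diff (sf m.-1).1 xr.
    have dl : differentiable (pder j lam) x := smooth_diff (sl j) xr.
    have dc : differentiable (fun=> m%:R : R) x by exact: differentiable_cst.
    have dcf : differentiable (fun y => m%:R * f m.-1 y) x by exact: differentiableM.
    have dp : differentiable (fun y => m%:R * f m.-1 y * pder j lam y) x.
      exact: differentiableM.
    rewrite /w pderD; [|exact: smooth_diff (sA1 _ _) xr|exact: differentiableN].
    rewrite pderN // pderM // pderM // pder_cst mul0r addr0.
    by congr (_ - _); ring.
  (* The terms with [pder i lam x * pder j lam x] cancel, and the second
     derivatives of [lam] cancel by symmetry. *)
  have cl x i j : ball x0 r1 x -> pder i (w j) x = pder j (w i) x.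
    move=> xr; have S2 := pder_swap i j ob (smooth_sub r1r slam) xr.
    have E := structure_equation_entry (inord m) i j (str x (r1r _ xr)).
    rewrite (inordK mN) in E.
    apply: etrans (pw x i j xr) (etrans _ (esym (pw x j i xr))).
    have Hi := Hf m.-1 x i; have Hj := Hf m.-1 x j.
    move: S2 E Hi Hj.
    move: (pder i (fun y => A y _ _) x) (pder j (fun y => A y _ _) x) => a b.
    move: (pder i (pder j lam) x) (pder j (pder i lam) x) => ha hb ->.
    move: (pder i lam x) (pder j lam x) (pder i (f _) x) (pder j (f _) x).
    move: (A x _ i) (A x _ j) (f m.-1 x) (m.-1%:R * _).
    move=> p q t d la lb fi fj E Hi Hj.
    case: (posnP m) E Hi Hj => [->|m0] E Hi Hj.
      by apply/eqP; rewrite !mul0r !subr0 -subr_eq0 E mul0r.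
    rewrite Hi // ?Hj //; [|lia|lia].
    have -> : a = b + m%:R * (lb * p - la * q) by rewrite -E addrC subrK.
    by ring.
  have [r2 [F [r20 r2r1 F0 sF pF]]] := poincare ob bx0 sw cl.
  exists r2 => //; split; first by move=> x /r2r1/r1r.
  exists (fun k => if k == m then F else f k); split=> [k|k x i km xr].
    case: eqP => // _; have [sfk f0] := sf k; split=> //.
    exact: smooth_sub sfk.
  have mm : (m.-1 == m) = false \/ m = 0%N by case: (m) => [|l]; [right|left; rewrite /=; lia].
  have fE y : m%:R * (if m.-1 == m then F else f m.-1) y = m%:R * f m.-1 y.
    by case: mm => ->; rewrite ?mul0r.
  have [->|km'] := eqVneq k m; first by rewrite pF // /w fE.
  have -> : (k.-1 == m) = false by lia.
  by rewrite Hf //; [lia|exact: r2r1].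
have [r' r'0 [r'r [f [sf Hf]]]] := step N (leqnn N).
exists r' => //; split=> //; exists (fun x => \row_k f k x); split.
- move=> i j; apply: (smooth_ext (ball_open _ _) _ (sf j).1) => x _.
  by rewrite mxE.
- by apply/rowP => k; rewrite !mxE (sf k).2.
move=> x xr; apply/matrixP => a b; rewrite !mxE big_ord1 raising_mx_col !mxE.
rewrite (_ : (fun y => _) = f a); last by apply/funext => y; rewrite mxE.
rewrite Hf // inord_val inordK; first by ring.
by have := ltn_ord a; lia.
Qed.

End Coordinates.

Lemma near_norm_lt (R : realType) (t rho : R) :
  `|t| < rho -> \forall u \near t, `|u| < rho.
Proof.
move=> tr; have : nbhs t (ball (0 : R) rho).
  apply: open_nbhs_nbhs; split; first exact: ball_open.
  by rewrite /ball /= sub0r normrN.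
by apply: filterS => u; rewrite /ball /= sub0r normrN.
Qed.

Section FunctionOfOneCoordinate.
Variables (R : realType) (n : nat).
Local Notation N := n.+1.
Local Notation en := (delta_mx ord_max 0 : 'cV[R]_n.+1).
Local Notation last_axis := (delta_mx 0 ord_max : 'rV[R]_n.+1).
Variables (rho : R) (kappa : 'rV[R]_N -> R).
Hypothesis skap : smooth_on (ball (0 : 'rV[R]_N) rho) kappa.
Local Notation B := (ball (0 : 'rV[R]_N) rho).

Definition axis_restriction (t : R) : R := kappa (t *: last_axis).

Lemma axis_ball (t : R) : `|t| < rho -> B (t *: last_axis).
Proof.
move=> tr; apply/mem_ballP; rewrite subr0 normrZ; apply: le_lt_trans tr.
by rewrite ler_piMr // normr_delta.
Qed.

Lemma axis_restriction_derive k t : `|t| < rho ->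
  derive1n k axis_restriction t = iter k (pder ord_max) kappa (t *: last_axis) /\
  derivable (derive1n k axis_restriction) t 1.
Proof.
move=> tr.
pose h k (t : R) := iter k (pder ord_max) kappa (t *: last_axis).
have sk l : smooth_on B (iter l (pder ord_max) kappa).
  by elim: l => [|l IHl] //=; exact: smooth_pder.
have dh l (s : R) : `|s| < rho -> is_derive s 1 (h l) (h l.+1 s).
  move=> sr; have d : differentiable (iter l (pder ord_max) kappa) (0 + s *: last_axis).
    by rewrite add0r; apply: (smooth_diff (sk l)); exact: axis_ball.
  have := is_derive_line d; rewrite sum_delta add0r.
  rewrite (_ : (fun s : R => _) = h l) //.
  by apply/funext => u; rewrite /h add0r.
have E l : forall s : R, `|s| < rho -> derive1n l axis_restriction s = h l s.
  elim: l => [//|l IHl] s sr; rewrite derive1nS derive1E.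
  have [_ <-] := dh l s sr; apply: near_eq_derive.
  by apply: filterS (near_norm_lt sr) => u; exact: IHl.
split; first exact: E.
have [d _] := dh k t tr; apply: near_eq_derivable d.
by apply: filterS (near_norm_lt tr) => u ur; rewrite E.
Qed.

Lemma function_of_last_coord :
  (forall y i, B y -> i != ord_max -> pder i kappa y = 0) ->
  forall y, B y -> kappa y = axis_restriction (xc y N).
Proof.
move=> k0 y By; rewrite xc_last /axis_restriction.
have yr : `|y| < rho by move/mem_ballP: By; rewrite subr0.
have tB : B (y 0 ord_max *: last_axis).
  by apply: axis_ball; apply: le_lt_trans yr; exact: normr_coord.
have Ey : y = y 0 ord_max *: last_axis + (y - y 0 ord_max *: last_axis).
  by rewrite addrC subrK.
have Bs t : 0 <= t <= 1 -> B (y 0 ord_max *: last_axis + t *: (y - y 0 ord_max *: last_axis)).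
  by move=> t01; apply: segment_ball2 => //; rewrite -Ey.
have [t /Bs Bt|t /andP[t0 t1]] := @mean_value R N kappa (y 0 ord_max *: last_axis)
    (y - y 0 ord_max *: last_axis).
  exact: smooth_diff Bt.
rewrite -Ey big1 => [/eqP|j _]; first by rewrite subr_eq0 => /eqP.
have [->|jn] := eqVneq j ord_max; first by rewrite !mxE !eqxx mulr1 subrr mul0r.
by rewrite k0 ?mulr0 //; apply: Bs; rewrite !ltW.
Qed.

End FunctionOfOneCoordinate.

Section LocalNormalForm.
Variables (R : realType) (n : nat).
Local Notation N := n.+1.
Local Notation en := (delta_mx ord_max 0 : 'cV[R]_n.+1).
Implicit Types (U V : set 'rV[R]_N).

Lemma Jmx_comp U V (F G : 'rV[R]_N -> 'rV[R]_N) y :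
  smooth_mx_on U F -> smooth_mx_on V G -> V y -> U (G y) ->
  Jmx (fun z => F (G z)) y = Jmx F (G y) *m Jmx G y.
Proof.
move=> sF sG Vy UGy; apply/matrixP => a b; rewrite !mxE.
rewrite (pder_comp (F := G) (f := fun x => F x 0 a)) => [|j|].
- by apply: eq_bigr => j _; rewrite !mxE mulrC.
- exact: smooth_diff (sG 0 j) Vy.
- exact: smooth_diff (sF 0 a) UGy.
Qed.

Lemma grad_row_comp U V (f : 'rV[R]_N -> R) (G : 'rV[R]_N -> 'rV[R]_N) y :
  smooth_on U f -> smooth_mx_on V G -> V y -> U (G y) ->
  grad_row (fun z => f (G z)) y = grad_row f (G y) *m Jmx G y.
Proof.
move=> sf sG Vy UGy; apply/rowP => b; rewrite !mxE.
rewrite pder_comp => [|j|].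
- by apply: eq_bigr => j _; rewrite !mxE mulrC.
- exact: smooth_diff (sG 0 j) Vy.
- exact: smooth_diff sf UGy.
Qed.

Lemma Jmx_id (y : 'rV[R]_N) : Jmx id y = 1%:M.
Proof. by apply/matrixP => a b; rewrite !mxE pder_coord eq_sym. Qed.

Lemma Jmx_ext U (F G : 'rV[R]_N -> 'rV[R]_N) y : open U -> U y ->
  (forall z, U z -> F z = G z) -> Jmx F y = Jmx G y.
Proof.
move=> oU Uy FG; apply/matrixP => a b; rewrite !mxE.
by apply: (pder_ext _ oU _ Uy) => z /set_mem Uz; rewrite FG.
Qed.

Variables (g L A : 'rV[R]_N -> 'M[R]_N) (lam : 'rV[R]_N -> R) (eps r : R) (x0 : 'rV[R]_N).
Hypotheses (r0 : 0 < r) (adA : adapted_coframe (ball x0 r) g L A lam eps).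
Hypothesis cpt : compatible_on (ball x0 r) g L.

(** The coordinates [phi] solve [A = J phi + raising_mx phi^T d lam]; as [d lam]
    is proportional to the last form of the coframe, it is also proportional to
    the differential of the last coordinate. *)
Lemma local_normal_form :
  exists V (rho : R) (phi G : 'rV[R]_N -> 'rV[R]_N) (ell : R -> R),
  [/\ [/\ open V, V x0, V `<=` ball x0 r & 0 < rho],
      [/\ smooth_mx_on V phi, smooth_mx_on (ball (0 : 'rV[R]_N) rho) G,
          forall x, V x -> ball (0 : 'rV[R]_N) rho (phi x) /\ G (phi x) = x &
          forall y, ball (0 : 'rV[R]_N) rho y -> V (G y) /\ phi (G y) = y],
      forall k t, `|t| < rho -> derivable (derive1n k ell) t 1 &
      forall y, ball (0 : 'rV[R]_N) rho y ->
        [/\ lam (G y) = ell (xc y N),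
            (Jmx G y)^T *m g (G y) *m Jmx G y = nf_metric eps ell y &
            invmx (Jmx G y) *m L (G y) *m Jmx G y = nf_endo ell y]].
Proof.
have ob : open (ball x0 r) by exact: ball_open.
have [sA slam eps2 pA] := adA.
have bx0 (s : R) : 0 < s -> ball x0 s x0.
  by move=> s0; apply/mem_ballP; rewrite subrr normr0.
have str x : ball x0 r x -> (exists mu : R, grad_row lam x = mu *: (en^T *m A x)) /\
    structure_equation A lam x.
  by move=> xr; exact: (compatible_structure ob adA xr cpt).
have [r1 r10 [r1r [phi [sphi phi0 Aphi]]]] :=
  integrate_coframe r0 sA slam (fun x xr => (str x xr).2).
have ob1 : open (ball x0 r1) by exact: ball_open.
have uJ : Jmx phi x0 \in unitmx.
  have := Aphi x0 (bx0 _ r10); rewrite phi0 trmx0 mulmx0 mul0mx addr0 => <-.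
  by case: (pA _ (bx0 _ r0)).
have [V [rho [G [oV Vx0 Vr1 rho0 [GF FG sG]]]]] :=
  inverse_function ob1 (bx0 _ r10) sphi uJ.
rewrite phi0 in GF FG sG; set B := ball (0 : 'rV[R]_N) rho in GF FG sG *.
have oB : open B by exact: ball_open.
have Vr x : V x -> ball x0 r x by move/Vr1/r1r.
pose kappa y := lam (G y).
have skap : smooth_on B kappa.
  apply: (smooth_comp oB (V := ball x0 r)) => //.
  by move=> y /FG[/Vr].
have JJ y : B y -> Jmx phi (G y) *m Jmx G y = 1%:M.
  move=> By; have [VGy _] := FG y By.
  rewrite -(Jmx_comp sphi sG By (Vr1 _ VGy)) -(Jmx_id y).
  by apply: (Jmx_ext oB By) => z /FG[].
have gradk y : B y -> grad_row kappa y = grad_row lam (G y) *m Jmx G y.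
  by move=> By; apply: (grad_row_comp slam sG By); apply: Vr; have [] := FG y By.
have AJ y : B y -> A (G y) *m Jmx G y = potential_coframe kappa y.
  move=> By; have [VGy FGy] := FG y By.
  by rewrite (Aphi _ (Vr1 _ VGy)) mulmxDl JJ // FGy -mulmxA -gradk.
have last_only y : B y -> exists nu : R, grad_row kappa y = nu *: en^T.
  move=> By; have [VGy FGy] := FG y By; have [[mu gl] _] := str _ (Vr _ VGy).
  have gk : grad_row kappa y = mu *: (en^T *m potential_coframe kappa y).
    by rewrite gradk // gl -scalemxAl -mulmxA AJ.
  pose c := (en^T *m (raising_mx R n *m y^T)) 0 0.
  have Ek : grad_row kappa y = mu *: en^T + (mu * c) *: grad_row kappa y.
    rewrite {1}gk /potential_coframe mulmxDr mulmx1 scalerDr mulmxA.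
    by rewrite [en^T *m (_ *m _)]mx11_scalar mul_scalar_mx scalerA.
  have Es : (1 - mu * c) *: grad_row kappa y = mu *: en^T.
    by rewrite scalerBl scale1r {1}Ek addrK.
  (* If the factor vanishes then so does [mu], and with it [d lam]. *)
  have [s0|s0] := eqVneq (1 - mu * c) 0; last first.
    by exists ((1 - mu * c)^-1 * mu); rewrite -scalerA -Es scalerA mulVf // scale1r.
  exists 0; rewrite scale0r gk.
  have mu0 : mu = 0.
    move: Es; rewrite s0 scale0r => /(congr1 (fun v : 'rV[R]_N => v 0 ord_max)).
    by rewrite !mxE !eqxx mulr1.
  by rewrite mu0 scale0r.
pose ell := axis_restriction kappa.
have kE y : B y -> kappa y = ell (xc y N).
  apply: (function_of_last_coord skap) => z i Bz iN.
  have [nu /(congr1 (fun v : 'rV[R]_N => v 0 i))] := last_only z Bz.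
  by rewrite trmx_delta !mxE (negPf iN) andbF mulr0.
have dell k t : `|t| < rho -> derivable (derive1n k ell) t 1.
  by move=> tr; have [] := axis_restriction_derive skap k tr.
have AJnf y : B y -> A (G y) *m Jmx G y = nf_coframe ell y.
  move=> By; rewrite AJ // /potential_coframe /nf_coframe.
  suff -> : grad_row kappa y = derive1 ell (xc y N) *: en^T.
    by rewrite /nf_column -scalemxAl -scalemxAr.
  have yr : `|xc y N| < rho.
    rewrite xc_last; move/mem_ballP: By; rewrite subr0; apply: le_lt_trans.
    exact: normr_coord.
  apply/rowP => j; rewrite trmx_delta !mxE eqxx /=.
  have [_ pl] := grad_row_last (dell 0%N _ yr).
  rewrite -[RHS]mulrC -pl; apply: (pder_ext _ oB _ By) => z /set_mem Bz.
  exact: kE.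
exists V, rho, phi, G, ell; split=> //.
  by split=> //; exact: smooth_mx_sub sphi.
move=> y By; have [VGy FGy] := FG y By; have [uA gA LA] := pA _ (Vr _ VGy).
have uJG : Jmx G y \in unitmx by have [] := mulmx1_unit (JJ y By).
split; first exact: kE.
  rewrite gA nf_metricE -AJnf // trmx_mul -scalemxAr -scalemxAl.
  by rewrite !mulmxA.
have uT : nf_coframe ell y \in unitmx by rewrite -AJnf // unitmx_mul uA.
apply: (can_inj (mulKmx uT)); rewrite nf_endo_coframe -AJnf //.
by rewrite !mulmxA mulmxK // LA -kE // mulmxA.
Qed.

End LocalNormalForm.

(** * Charts *)

Section Charts.
Variables (R : realType) (n : nat) (M : topologicalType).
Local Notation N := n.+1.
Implicit Types (c : chart R N M).

Lemma chart_invK c x : is_chart c -> chart_img c x ->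
  chart_dom c (chart_inv c x) /\ chart_map c (chart_inv c x) = x.
Proof. by move=> [_ _ inv _ _] [q dq <-]; rewrite inv. Qed.

Lemma open_chart_image c (O : set M) : is_chart c -> open O ->
  open (chart_map c @` (chart_dom c `&` O)).
Proof.
move=> ic oO; have [_ oi inv _ ci] := ic.
rewrite openE => x [q [dq Oq] qx]; rewrite /interior.
have ix : chart_img c x by exists q.
have nO : \forall y \near x, O (chart_inv c y).
  apply: (ci x ix); apply: open_nbhs_nbhs; split=> //.
  by rewrite -qx inv.
have ni : \forall y \near x, chart_img c y by exact: open_nbhs_nbhs.
apply: filterS2 ni nO => y iy Oy; have [dy my] := chart_invK ic iy.
by exists (chart_inv c y).
Qed.

Variables (S : smooth_manifold R N M) (c0 : chart R N M).
Hypothesis ac0 : atlas S c0.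
Variables (V B : set 'rV[R]_N) (phi G : 'rV[R]_N -> 'rV[R]_N).
Hypotheses (oV : open V) (Vi : V `<=` chart_img c0) (oB : open B).
Hypotheses (sphi : smooth_mx_on V phi) (sG : smooth_mx_on B G).
Hypothesis GF : forall x, V x -> B (phi x) /\ G (phi x) = x.
Hypothesis FG : forall y, B y -> V (G y) /\ phi (G y) = y.

Definition change_chart : chart R N M :=
  Chart (chart_dom c0 `&` [set q | V (chart_map c0 q)])
    (phi \o chart_map c0) (chart_inv c0 \o G).
Local Notation c := change_chart.

Let ic0 := atlas_chart ac0.

Lemma change_chart_img : chart_img c = B.
Proof.
apply/seteqP; split=> [_ [q [dq Vq] <-]|y By]; first by have [] := GF Vq.
have [VGy FGy] := FG By; have [d m] := chart_invK ic0 (Vi VGy).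
by exists (chart_inv c0 (G y)); rewrite /= ?m //; split=> //=; rewrite m.
Qed.

Lemma change_is_chart : is_chart c.
Proof.
have [od oi inv cm ci] := ic0; split.
- rewrite openE => q [dq Vq]; rewrite /interior.
  have nV : \forall y \near q, V (chart_map c0 y).
    by apply: (cm q dq); exact: open_nbhs_nbhs.
  have nd : \forall y \near q, chart_dom c0 y by exact: open_nbhs_nbhs.
  by apply: filterS2 nd nV => y; split.
- by rewrite change_chart_img.
- by move=> q [dq Vq] /=; have [_ ->] := GF Vq; rewrite inv.
- move=> q [dq Vq]; apply: continuous_comp; first exact: cm.
  exact: smooth_row_cont sphi Vq.
- move=> y; rewrite change_chart_img => By; have [VGy _] := FG By.
  apply: continuous_comp; first exact: smooth_row_cont sG By.
  exact: ci (Vi VGy).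
Qed.

(** Transitions between the new chart and the atlas factor through [c0]. *)
Lemma change_atlas : atlas S c.
Proof.
apply: atlas_maximal change_is_chart _ => c' ac'.
have ic := change_is_chart; have ic' := atlas_chart ac'.
have [s1 s2] := atlas_compat ac0 ac'.
have [od' _ inv' _ _] := ic'; have [_ _ inv0 _ _] := ic0.
split=> i j.
  apply: (smooth_comp (F := G) (V := overlap c0 c')
    (f := fun x => transition c0 c' x i j)).
  - by apply: open_chart_image.
  - move=> _ [q [[dq Vq] dq'] <-] /=; have [_ ->] := GF Vq.
    by exists q.
  - apply: smooth_mx_sub sG => _ [q [[dq Vq] dq'] <-] /=.
    by have [] := GF Vq.
  - exact: s1.
apply: (smooth_comp (F := transition c' c0) (V := V) (f := fun x => phi x i j)).
- apply: (open_chart_image ic'); by have [] := ic.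
- move=> _ [q [dq' [dq Vq]] <-] /=; by rewrite /transition /= inv'.
- by apply: smooth_mx_sub s2 => _ [q [dq' [dq Vq]] <-]; exists q.
- exact: sphi.
Qed.

Lemma change_transition y : B y -> transition c c0 y = G y.
Proof.
move=> By; have [VGy _] := FG By.
by have [_] := chart_invK ic0 (Vi VGy).
Qed.

Lemma change_overlap y : B y -> overlap c c0 y.
Proof.
move=> By; have [VGy FGy] := FG By; have [d m] := chart_invK ic0 (Vi VGy).
by exists (chart_inv c0 (G y)); rewrite /= ?m //; split=> //; split=> //=; rewrite m.
Qed.

End Charts.

Section JordanType.
Variables (R : realType) (n : nat).
Local Notation N := n.+1.
Local Notation X0 := (shift_mx R n).

Lemma shift_exp k (i j : 'I_N) : (X0 ^+ k) i j = (i + k == j)%N%:R.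
Proof.
elim: k i j => [|k IHk] i j; first by rewrite expr0 mxE addn0 val_eqE.
have Hi := ltn_ord i; have Hj := ltn_ord j.
rewrite exprS -mulmxE shift_mull; case: ifP => H; last first.
  by rewrite (_ : (_ == _) = false) //; lia.
by rewrite IHk inordK // addSnnS.
Qed.

Lemma conjugate_exp (P A : 'M[R]_N) k : P \in unitmx ->
  (P *m A *m invmx P) ^+ k = P *m A ^+ k *m invmx P.
Proof.
move=> uP; elim: k => [|k IHk]; first by rewrite !expr0 mulmx1 mulmxV.
by rewrite exprS IHk -mulmxE !mulmxA mulmxKV // exprS -!mulmxA.
Qed.

(** Recovering the eigenvalue from the trace shows that it is a smooth function
    of the point. *)
Lemma jordan_conjugate (P A : 'M[R]_N) (lam : R) (X := A - (\tr A / N%:R)%:M) :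
  P \in unitmx -> A = P *m jordan_block N lam *m invmx P ->
  [/\ \tr A / N%:R = lam, X ^+ N = 0 & X ^+ n != 0].
Proof.
move=> uP EA.
have trA : \tr A / N%:R = lam.
  rewrite EA mxtrace_mulC mulmxA mulVmx // mul1mx jordan_blockE mxtraceD.
  by rewrite trace_shift addr0 mxtrace_scalar -[lam *+ _]mulr_natr mulfK // pnatr_eq0.
have XE : X = P *m X0 *m invmx P.
  rewrite /X trA EA jordan_blockE mulmxDr mulmxDl mul_mx_scalar -scalemxAl.
  by rewrite mulmxV // scalemx1 addrC addKr.
split=> //; rewrite XE conjugate_exp //.
  have -> : X0 ^+ N = 0.
    apply/matrixP => i j; rewrite shift_exp mxE (_ : (_ == _) = false) //.
    by have := ltn_ord j; lia.
  by rewrite mulmx0 mul0mx.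
apply/eqP => E; have : X0 ^+ n = 0.
  have uV : invmx P \in unitmx by rewrite unitmx_inv.
  apply: (can_inj (mulKmx uP)); apply: (can_inj (mulmxK uV)).
  by rewrite E mulmx0 mul0mx.
move/(congr1 (fun B : 'M[R]_N => B ord0 ord_max)).
by rewrite shift_exp mxE add0n eqxx => /eqP; rewrite oner_eq0.
Qed.

End JordanType.

Section Forward.
Variables (R : realType) (n : nat) (M : topologicalType).
Local Notation N := n.+1.
Variables (S : smooth_manifold R N M) (g L : tensor_components R N M).
Variables (p : M) (lam : M -> R).
Hypotheses (pg : pseudo_riemannian S g) (tL : is_tensor11 S L).
Hypotheses (cpt : compatible S g L) (jor : \forall q \near p, single_jordan_at S L q (lam q)).

Lemma normal_form_chart : exists (c : chart R N M) (eps : R) (ell : R -> R),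
  [/\ atlas S c, chart_dom c p, eps = 1 \/ eps = -1,
      smooth1_on [set xc (chart_map c q) N | q in chart_dom c] ell
    & forall q, chart_dom c q ->
      [/\ lam q = ell (xc (chart_map c q) N),
          g c (chart_map c q) = nf_metric eps ell (chart_map c q)
        & L c (chart_map c q) = nf_endo ell (chart_map c q)]].
Proof.
have [c0 [ac0 dp]] := atlas_cover S p.
have ic0 := atlas_chart ac0; have [od oi inv cm ci] := ic0.
pose x0 := chart_map c0 p; have ix0 : chart_img c0 x0 by exists p.
have nj : \forall x \near x0, single_jordan_at S L (chart_inv c0 x) (lam (chart_inv c0 x)).
  have := jor; rewrite -{1}(inv p dp) => jor'.
  exact: (ci x0 ix0 _ jor').
have /nbhs_ballP[r /= r0 Hr] : nbhs x0 [set x | chart_img c0 x /\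
    single_jordan_at S L (chart_inv c0 x) (lam (chart_inv c0 x))].
  by apply: filterS2 (open_nbhs_nbhs (conj oi ix0)) nj => x; split.
set W := ball x0 r in Hr; have oW : open W by exact: ball_open.
have Wi : W `<=` chart_img c0 by move=> x /Hr[].
have Wx0 : W x0 by apply/mem_ballP; rewrite subrr normr0.
pose gc := g c0; pose Lc := L c0; pose lc x := \tr (Lc x) / N%:R.
have [[sg_ lawg] metg] := pg; have [sL_ lawL] := tL.
have sgc : smooth_mx_on W gc by apply: smooth_mx_sub Wi _; exact: sg_.
have sLc : smooth_mx_on W Lc by apply: smooth_mx_sub Wi _; exact: sL_.
have slc : smooth_on W lc.
  by apply: (smooth_mul oW (smooth_trace oW sLc)); exact: smooth_cst.
have [_ ugc] := metg c0 ac0.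
have symg x : W x -> (gc x)^T = gc x by move=> /Wi/ugc[].
have cptW : compatible_on W gc Lc by move=> x /Wi; exact: (cpt ac0).
have saL x : W x -> gc x *m Lc x = (Lc x)^T *m gc x.
  move=> Wx; have [E _ _] := cptW x Wx; have [_ ug] := ugc _ (Wi _ Wx).
  by rewrite -{1}E /gadjoint !mulmxA mulmxV // mul1mx.
have jorW x : W x -> [/\ lc x = lam (chart_inv c0 x),
    (Lc x - (lc x)%:M) ^+ N = 0 & (Lc x - (lc x)%:M) ^+ n != 0].
  move=> Wx; have [ix sj] := Hr _ Wx; have [d m] := chart_invK ic0 ix.
  have [P uP] := sj c0 ac0 d; rewrite m => EP.
  exact: (jordan_conjugate uP EP).
have nilX x : W x -> (Lc x - (lc x)%:M) ^+ N = 0 by move=> /jorW[].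
have [_ _ Xn] := jorW _ Wx0; have [_ ug0] := ugc _ ix0.
have [r1 [eps [A [r10 r1W eps1 adA]]]] :=
  exists_adapted_coframe oW sgc sLc slc symg saL nilX Wx0 ug0 Xn.
have cpt1 : compatible_on (ball x0 r1) gc Lc by move=> x /r1W; exact: cptW.
have [V [rho [phi [G [ell [[oV Vx0 Vr1 rho0] [sphi sG GF FG] sell nf]]]]]] :=
  local_normal_form r10 adA cpt1.
set B := ball 0 rho in sG GF FG nf; have oB : open B by exact: ball_open.
have VW : V `<=` W by move=> x /Vr1/r1W.
have Vi : V `<=` chart_img c0 by move=> x /VW/Wi.
pose c := change_chart c0 V phi G.
have ac : atlas S c by exact: (change_atlas ac0 oV Vi oB sphi sG GF FG).
have Bq q : chart_dom c q -> B (chart_map c q) by move=> [dq Vq]; have [] := GF _ Vq.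
exists c, eps, ell; split=> //.
  move=> k _ [q /Bq By <-]; apply: sell; rewrite xc_last.
  by move/mem_ballP: By; rewrite subr0; apply: le_lt_trans; exact: normr_coord.
move=> q dcq; have By := Bq q dcq; have [dq Vq] := dcq.
have [nl ng nL] := nf _ By; have [_ GFq] := GF _ Vq.
have ov := change_overlap ac0 Vi FG By.
have tE := change_transition ac0 Vi FG By.
have JE : Jmx (transition c c0) (chart_map c q) = Jmx G (chart_map c q).
  by apply: (Jmx_ext oB By) => z Bz; exact: (change_transition ac0 Vi FG Bz).
split.
- rewrite -nl; have [-> _ _] := jorW _ (VW _ (FG _ By).1).
  by rewrite /= GFq inv.
- by rewrite (lawg c c0 _ ac ac0 ov) JE tE.
- by rewrite (lawL c c0 _ ac ac0 ov) JE tE.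
Qed.

End Forward.

Theorem theorem1p5 (R : realType) (n : nat) :
  (forall (M : topologicalType) (S : smooth_manifold R n.+1 M)
      (g L : tensor_components R n.+1 M) (p : M) (lam : M -> R),
    pseudo_riemannian S g ->
    is_tensor11 S L ->
    compatible S g L ->
    (\forall q \near p, single_jordan_at S L q (lam q)) ->
    exists (c : chart R n.+1 M) (eps : R) (ell : R -> R),
      [/\ atlas S c,
          chart_dom c p,
          eps = 1 \/ eps = -1,
          smooth1_on [set xc (chart_map c q) n.+1 | q in chart_dom c] ell
        & forall q, chart_dom c q ->
          [/\ lam q = ell (xc (chart_map c q) n.+1),
              g c (chart_map c q) = nf_metric eps ell (chart_map c q)
            & L c (chart_map c q) = nf_endo ell (chart_map c q)]])
  /\
  (forall (J : set R) (lam : R -> R) (eps : R),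
    open J ->
    smooth1_on J lam ->
    (forall t, J t -> lam t != 0) ->
    eps = 1 \/ eps = -1 ->
    (forall x : 'rV[R]_n.+1,
      nf_metric eps lam x \in unitmx
      <-> 1 + n%:R * derive1 lam (xc x n.+1) * xc x n != 0) /\
    let U := [set x : 'rV[R]_n.+1 |
               J (xc x n.+1) /\ nf_metric eps lam x \in unitmx] in
    [/\ open U,
        pseudo_metric_on U (nf_metric eps lam),
        smooth_mx_on U (nf_endo lam)
      & compatible_on U (nf_metric eps lam) (nf_endo lam)]).
Proof.
split.
  move=> M S g L p lam pg tL cpt jor.
  exact: (normal_form_chart pg tL cpt jor).
move=> J lam eps oJ slam lam0 eps1; split=> [x|U].
  exact: nf_metric_unit.
exact: nf_compatible.
Qed.
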